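(* Let $d\in\mathbb{N}$, let $\Omega\subset\mathbb{R}^d$ be a bounded Lipschitz domain and $s\in(0,1)$. Then the trace operator $$\mathrm{Tr}_s: V^{s,1}(\Omega\,|\,\mathbb{R}^d)\to L^1(\Omega^c;\mu_s),\qquad u\mapsto u|_{\Omega^c},$$ is continuous and linear. There exists a continuous linear right inverse $$\mathrm{Ext}_s:\mathcal{T}^{s,1}(\Omega^c)\to V^{s,1}(\Omega\,|\,\mathbb{R}^d),\qquad \mathrm{Tr}_s(\mathrm{Ext}_s(g))=g\ \text{ for all } g\in\mathcal{T}^{s,1}(\Omega^c).$$ The continuity constants of the trace and extension operators depend only on $\Omega$ and a lower bound on $s$ (i.e. for every $s_\star\in(0,1)$ they can be chosen uniformly over $s\in[s_\star,1)$), except that in dimension $d=1$ the norm of the extension operator also depends on a lower bound on $1-s$ (i.e. it can be chosen uniformly over $s\in[s_\star,s^\star]$ for $0<s_\star\le s^\star<1$).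
   Context: $\Omega\subset\mathbb{R}^d$ is a Lipschitz domain if it is open (not necessarily connected) and has a uniform Lipschitz boundary: $\partial\Omega\neq\emptyset$ and there are $r>0$, $L>0$ such that for every $z\in\partial\Omega$ there are a map $T_z:\mathbb{R}^d\to\mathbb{R}^d$ composed of a translation and a rotation with $T_z(z)=0$, and a Lipschitz function $\phi_z:\mathbb{R}^{d-1}\to\mathbb{R}$ with Lipschitz constant at most $L$, with $T_z(\Omega\cap B_r(z))=\{(x',x_d)\in B_r(0): \phi_z(x')>x_d\}$. Write $\Omega^c=\mathbb{R}^d\setminus\Omega$, $d_x=\mathrm{dist}(x,\partial\Omega)$, $a\wedge b=\min\{a,b\}$. Functions are identified if equal almost everywhere. $V^{s,1}(\Omega\,|\,\mathbb{R}^d)$ is the space of measurable $u:\mathbb{R}^d\to\mathbb{R}$ with $$[u]_{V^{s,1}(\Omega|\mathbb{R}^d)}=(1-s)\int_\Omega\int_{\mathbb{R}^d}\frac{|u(x)-u(y)|}{|x-y|^{d+s}}\,dy\,dx<\infty,$$ with norm $\|u\|_{V^{s,1}(\Omega|\mathbb{R}^d)}=\|u\|_{L^1(\Omega)}+[u]_{V^{s,1}(\Omega|\mathbb{R}^d)}$. The measure $\mu_s$ (for $p=1$) is $\mu_s(dx)=\mathbf{1}_{\Omega^c}(x)(1-s)d_x^{-s}(1+d_x)^{-d}\,dx$. The space $\mathcal{T}^{s,1}(\Omega^c)$ consists of measurable $g:\Omega^c\to\mathbb{R}$ with finite norm $$\|g\|_{\mathcal{T}^{s,1}(\Omega^c)}=\|g\|_{L^1(\Omega^c;\mu_s)}+\int_{\Omega^c}\int_{\Omega^c}\frac{|g(x)-g(y)|}{((|x-y|+d_x+d_y)\wedge1)^{d-s}}\,\mu_s(dx)\,\mu_s(dy).$$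 *)

(* Defs.v *)
From HB Require Import structures.
From mathcomp Require Import all_boot all_order all_algebra.
From mathcomp Require Import all_classical all_reals all_analysis.
From mathcomp Require Import measurable_realfun.

Set Implicit Arguments.
Unset Strict Implicit.
Unset Printing Implicit Defensive.

Import Order.TTheory GRing.Theory Num.Theory.
Import numFieldNormedType.Exports.

Local Open Scope classical_set_scope.
Local Open Scope ring_scope.

Section measurable_rV.
Context (R : realType) (n : nat).

Definition rV_coord (i : 'I_n) (v : 'rV[R]_n) : measurableTypeR R := v ord0 i.

Let rV_set0 : g_sigma_preimage rV_coord set0.
Proof. exact: sigma_algebra0. Qed.

Let rV_setC A : g_sigma_preimage rV_coord A -> g_sigma_preimage rV_coord (~` A).
Proof. exact: sigma_algebraC. Qed.

Let rV_bigcup (F : _^nat) : (forall i, g_sigma_preimage rV_coord (F i)) ->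
  g_sigma_preimage rV_coord (\bigcup_i (F i)).
Proof. exact: sigma_algebra_bigcup. Qed.

(* The product sigma-algebra of the Borel sigma-algebras of the coordinates;
   see [open_measurable_rV] for the inclusion of the open sets. *)
HB.instance Definition _ := @isMeasurable.Build default_measure_display
  'rV[R]_n (g_sigma_preimage rV_coord) rV_set0 rV_setC rV_bigcup.

Lemma measurable_rV_coord (i : 'I_n) : measurable_fun [set: 'rV[R]_n] (rV_coord i).
Proof.
move=> _ Y mY; rewrite setTI; apply: sub_sigma_algebra => /=.
rewrite -bigcup_seq/=; exists i => /=; first by rewrite mem_index_enum.
by exists Y => //; rewrite setTI.
Qed.

Lemma measurable_fun_rV d (T : measurableType d) (f : T -> 'rV[R]_n) :
  (forall i, measurable_fun [set: T] (rV_coord i \o f)) ->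
  measurable_fun [set: T] f.
Proof.
move=> mf _ A mA; rewrite setTI.
suff : preimage_set_system [set: T] f (g_sigma_preimage rV_coord) `<=` measurable.
  by apply; exists A => //; rewrite setTI.
rewrite -g_sigma_preimageE; apply: smallest_sub.
  exact: sigma_algebra_measurable.
move=> _ [B + <-]; rewrite -bigcup_seq => -[i _ [C mC <-]].
by rewrite !setTI -comp_preimage -[X in measurable X]setTI; exact: mf.
Qed.

Lemma open_measurable_rV (U : set 'rV[R]_n) : open U -> measurable U.
Proof.
move=> oU.
pose box (p : 'rV[rat]_n * rat) : set 'rV[R]_n :=
  \bigcap_(i in [set: 'I_n])
    (rV_coord i @^-1` ball (ratr (p.1 ord0 i) : R) (ratr p.2)).
have mbox p : measurable (box p).
  apply: fin_bigcap_measurable => // i _.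
  rewrite -[X in measurable X]setTI; apply: measurable_rV_coord => //.
  by apply: open_measurable; exact: ball_open.
have -> : U = \bigcup_(p in [set p | box p `<=` U]) box p.
  apply/seteqP; split=> [x Ux|x [p /= pU]]; last exact: pU.
  have /nbhs_ballP[e/= e0 xeU] : nbhs x U by exact: open_nbhs_nbhs.
  have [q] : exists q : rat, ratr q \in `]0, (e / 2)[%R.
    by apply: rat_in_itvoo; rewrite divr_gt0.
  rewrite in_itv/= => /andP[q0 qe].
  have cP i : exists c : rat, ratr c \in `](x ord0 i), (x ord0 i + ratr q)[%R.
    by apply: rat_in_itvoo; rewrite ltrDl.
  have /choice[c cE] := cP.
  have bx i : ball (ratr (c i) : R) (ratr q) (x ord0 i).
    move: (cE i); rewrite in_itv/= => /andP[c1 c2].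
    rewrite /ball/= ger0_norm ?subr_ge0 ?(ltW c1)//.
    by rewrite ltrBlDl.
  exists (\row_i c i, q); last first.
    by move=> i _; rewrite /= mxE; exact: bx.
  move=> y yb; apply: xeU; split => // i j.
  rewrite (ord1 i) [e]splitr; apply: (@ball_triangle _ _ (ratr (c j) : R)).
    by apply: ball_sym; apply: le_ball (bx j); exact: ltW.
  have := yb j Logic.I; rewrite /= mxE; apply: le_ball; exact: ltW.
rewrite bigcup_mkcond; apply: countable_bigcupT_measurable => // p.
by case: ifP.
Qed.

Lemma continuous_measurable_rV (f : 'rV[R]_n -> R) :
  continuous f -> measurable_fun [set: 'rV[R]_n] f.
Proof.
move=> /continuousP cf; apply: (measurability _ (RGenOpens.measurableE R)).
move=> _ [_ [a [b ->] <-]]; rewrite setTI; apply: open_measurable_rV.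
exact/cf/interval_open.
Qed.

End measurable_rV.

Section lebesgue_measure_rV.
Context {R : realType}.

Definition rV_cons n (p : R * 'rV[R]_n) : 'rV[R]_n.+1 := row_mx p.1%:M p.2.

Definition rV_uncons n (v : 'rV[R]_n.+1) : R * 'rV[R]_n :=
  (v ord0 ord0, \row_i v ord0 (lift ord0 i)).

Lemma rV_cons0 n (p : R * 'rV[R]_n) : rV_cons p ord0 ord0 = p.1.
Proof.
by rewrite mxE; case: splitP => // j _; rewrite (ord1 j) mxE eqxx.
Qed.

Lemma rV_consS n (p : R * 'rV[R]_n) i : rV_cons p ord0 (lift ord0 i) = p.2 ord0 i.
Proof.
rewrite mxE; case: splitP => [j|j [ij]]; first by rewrite (ord1 j).
by congr (p.2 _ _); exact/esym/val_inj.
Qed.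

Lemma rV_consK n : cancel (@rV_cons n) (@rV_uncons n).
Proof.
move=> [x v]; congr (_, _); first by rewrite rV_cons0.
by apply/rowP => i; rewrite mxE rV_consS.
Qed.

Lemma rV_unconsK n : cancel (@rV_uncons n) (@rV_cons n).
Proof.
move=> v; apply/rowP => i; case: (unliftP ord0 i) => [j ->|->].
  by rewrite rV_consS mxE.
by rewrite rV_cons0.
Qed.

Lemma measurable_rV_cons n :
  measurable_fun [set: measurableTypeR R * 'rV[R]_n] (@rV_cons n).
Proof.
apply: measurable_fun_rV => i; case: (unliftP ord0 i) => [j ->|->]; last first.
  rewrite (_ : _ \o _ = fst); first exact: measurable_fst.
  by apply/funext => p; exact: rV_cons0.
rewrite (_ : _ \o _ = @rV_coord R n j \o snd).
  by apply: measurableT_comp => //; exact: measurable_rV_coord.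
by apply/funext => p; exact: rV_consS.
Qed.

Lemma measurable_rV_uncons n : measurable_fun [set: 'rV[R]_n.+1]
  (@rV_uncons n : _ -> measurableTypeR R * 'rV[R]_n).
Proof.
apply/measurable_fun_pairP; split.
  exact: (@measurable_rV_coord R n.+1 ord0).
apply: measurable_fun_rV => i.
rewrite (_ : _ \o _ = rV_coord (lift ord0 i)); first exact: measurable_rV_coord.
by apply/funext => v; rewrite /rV_coord/= mxE.
Qed.

Section lebesgue_rV_step.
Variables (n : nat) (m : {sigma_finite_measure set 'rV[R]_n -> \bar R}).

Definition lebesgue_rV_step : set 'rV[R]_n.+1 -> \bar R :=
  pushforward (@lebesgue_measure R \x m)%E (@rV_cons n).

Let step0 : lebesgue_rV_step set0 = 0%E.
Proof. by rewrite /lebesgue_rV_step /pushforward preimage_set0 measure0. Qed.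

Let step_ge0 A : (0 <= lebesgue_rV_step A)%E.
Proof. by rewrite /lebesgue_rV_step /pushforward; apply: measure_ge0. Qed.

Let step_sigma_additive : semi_sigma_additive lebesgue_rV_step.
Proof.
move=> F mF tF mUF.
have mpre (A : set 'rV[R]_n.+1) : measurable A ->
    measurable (@rV_cons n @^-1` A : set (measurableTypeR R * 'rV[R]_n)).
  by move=> mA; rewrite -[X in measurable X]setTI; exact: measurable_rV_cons.
rewrite /lebesgue_rV_step /pushforward preimage_bigcup.
apply: measure_semi_sigma_additive.
- by move=> i; exact: mpre.
- apply/trivIsetP => /= i j _ _ ij; rewrite -preimage_setI.
  by move/trivIsetP : tF => /(_ _ _ _ _ ij) ->//; rewrite preimage_set0.
- by rewrite -preimage_bigcup; exact: mpre.
Qed.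

HB.instance Definition _ := isMeasure.Build _ _ _ lebesgue_rV_step
  step0 step_ge0 step_sigma_additive.

Let step_sigma_finite : sigma_finite [set: 'rV[R]_n.+1] lebesgue_rV_step.
Proof.
have /sigma_finiteP[F [TF ndF Foo]] := sigma_finiteT (@lebesgue_measure R).
have /sigma_finiteP[G [TG ndG Goo]] := sigma_finiteT m.
exists (fun k => @rV_uncons n @^-1` (F k `*` G k)).
  rewrite -preimage_bigcup (_ : \bigcup_k _ = setT) ?preimage_setT//.
  rewrite -setXTT TF TG predeqE => -[x y]; split.
    by move=> [k _ []/= ? ?]; split; exists k.
  move=> [/= [k _ Fkx] [l _ Gly]]; exists (maxn k l) => //; split.
  - by move: x Fkx; exact/subsetPset/ndF/leq_maxl.
  - by move: y Gly; exact/subsetPset/ndG/leq_maxr.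
move=> k; have [mF Fk] := Foo k; have [mG Gk] := Goo k; split.
  rewrite -[X in measurable X]setTI; apply: measurable_rV_uncons => //.
  exact: measurableX.
rewrite /lebesgue_rV_step /pushforward -comp_preimage.
rewrite (_ : _ \o _ = id); last exact/funext/rV_consK.
by rewrite preimage_id product_measure1E// lte_mul_pinfty// ge0_fin_numE.
Qed.

HB.instance Definition _ := Measure_isSigmaFinite.Build _ _ _ lebesgue_rV_step
  step_sigma_finite.

End lebesgue_rV_step.

(* Lebesgue measure on R^n as the n-fold product of the Lebesgue measure of R *)
Fixpoint lebesgue_rV_rec n : {sigma_finite_measure set 'rV[R]_n -> \bar R} :=
  match n with
  | 0 => @dirac _ 'rV[R]_0 (0 : 'rV[R]_0) R
  | n'.+1 => lebesgue_rV_step (lebesgue_rV_rec n')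
  end.

Definition lebesgue_rV n : set 'rV[R]_n -> \bar R := lebesgue_rV_rec n.

HB.instance Definition _ n := SigmaFiniteMeasure.on (@lebesgue_rV n).

End lebesgue_measure_rV.
Arguments lebesgue_rV {R} n.

Section euclidean.
Context {R : realType} {n : nat}.
Implicit Types (x y : 'rV[R]_n) (A : set 'rV[R]_n).

(* The norm [`|x|] of the library on ['rV[R]_n] is the sup norm *)
Definition enorm x : R := Num.sqrt (\sum_(i < n) x ord0 i ^+ 2).

Definition eball x (r : R) : set 'rV[R]_n := [set y | enorm (y - x) < r].

Definition boundary A : set 'rV[R]_n := closure A `\` interior A.

Definition dist_set A x : R := inf [set enorm (x - y) | y in A].

Definition dist_boundary A x : R := dist_set (boundary A) x.

Lemma dist_set_ge0 A x : 0 <= dist_set A x.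
Proof.
have [->|/set0P[a Aa]] := eqVneq A set0.
  by rewrite /dist_set image_set0 inf0.
apply: lb_le_inf; first by exists (enorm (x - a)); exists a.
by move=> _ [y _ <-]; exact: sqrtr_ge0.
Qed.

Lemma enorm_continuous : continuous enorm.
Proof.
move=> x; apply: continuous_comp; last exact: sqrt_continuous.
apply: continuous_big => [|i _ y].
  by move=> p; apply: cvgD; [exact: cvg_fst|exact: cvg_snd].
apply: (@continuous_comp _ _ _ (fun v : 'rV[R]_n => v ord0 i) (fun t : R => t ^+ 2)).
  exact: coord_continuous.
exact: exprn_continuous.
Qed.

Lemma measurable_dist_set A : measurable_fun [set: 'rV[R]_n] (dist_set A).
Proof.
have [->|/set0P[a Aa]] := eqVneq A set0.
  rewrite (_ : dist_set _ = cst 0); first exact: measurable_cst.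
  by apply/funext => x; rewrite /dist_set image_set0 inf0.
apply: (measurability _ (RGenInftyO.measurableE R)).
move=> _ [_ [r ->] <-]; rewrite setTI; apply: open_measurable_rV.
rewrite (_ : _ @^-1` _ = \bigcup_(y in A) [set x | enorm (x - y) < r]).
  apply: bigcup_open => y _.
  have /continuousP/(_ _ (@open_lt R r)) // :
    continuous (fun x => enorm (x - y)).
  move=> x; apply: continuous_comp; last exact: enorm_continuous.
  by apply: continuousB => //; exact: cst_continuous.
have lbA x : has_inf [set enorm (x - y) | y in A].
  split; first by exists (enorm (x - a)); exists a.
  by exists 0 => _ [y _ <-]; exact: sqrtr_ge0.
apply/seteqP; split=> x /=; rewrite in_itv/=.
  move=> xr; have e0 : 0 < r - dist_set A x by rewrite subr_gt0.
  have [_ [y Ay <-]] := inf_adherent e0 (lbA x).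
  by rewrite subrKC => ?; exists y.
move=> [y Ay]; apply: le_lt_trans; apply: ge_inf; last by exists y.
by case: (lbA x).
Qed.

End euclidean.

Section lipschitz_domain.
Context {R : realType} {n : nat}.
Implicit Types (Omega : set 'rV[R]_n.+1).

Definition rV_init (y : 'rV[R]_n.+1) : 'rV[R]_n :=
  \row_(i < n) y ord0 (widen_ord (leqnSn n) i).

(* "Rotation" is read as orthogonal matrix, determinant -1 included: composing
   with a reflection in the first n coordinates shows that this makes no
   difference in dimension n.+1 >= 2, whereas in dimension 1 the left endpoint
   of an interval requires x |-> - x. *)
Definition uniform_lipschitz_boundary Omega :=
  boundary Omega !=set0 /\
  exists r L : R, [/\ 0 < r, 0 < L &
    forall z, boundary Omega z ->
    exists (Q : 'M[R]_n.+1) (c : 'rV[R]_n.+1) (phi : 'rV[R]_n -> R),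
      let T := fun x => x *m Q + c in
      [/\ Q *m Q^T = 1%:M, T z = 0,
          (forall x' y', `|phi x' - phi y'| <= L * enorm (x' - y')) &
          T @` (Omega `&` eball z r) =
          [set y | eball 0 r y /\ phi (rV_init y) > y ord0 ord_max]]].

Definition lipschitz_domain Omega := open Omega /\ uniform_lipschitz_boundary Omega.

End lipschitz_domain.

Section exterior_measure.
Context {R : realType} {n : nat}.
Variables (Omega : set 'rV[R]_n) (s : R).

Definition mu_density (x : 'rV[R]_n) : R :=
  (1 - s) * dist_boundary Omega x `^ (- s) * (1 + dist_boundary Omega x) ^- n.

Definition mu_s : set 'rV[R]_n -> \bar R :=
  fun A => (\int[lebesgue_rV n]_(x in A) (\1_(~` Omega) x * mu_density x)%:E)%E.

Hypotheses (oOmega : open Omega) (s1 : s <= 1).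

Let density x : \bar R := (\1_(~` Omega) x * mu_density x)%:E.

Let density_ge0 x : (0 <= density x)%E.
Proof.
have d0 : 0 <= dist_boundary Omega x by exact: dist_set_ge0.
rewrite lee_fin; apply: mulr_ge0; first by rewrite indicE.
by rewrite !mulr_ge0 ?powR_ge0 ?subr_ge0// invr_ge0 exprn_ge0// addr_ge0.
Qed.

Let measurable_density : measurable_fun [set: 'rV[R]_n] density.
Proof.
apply/measurable_EFinP; apply: measurable_funM.
  by apply: measurable_indic; apply: measurableC; exact: open_measurable_rV.
have md : measurable_fun [set: 'rV[R]_n] (dist_boundary Omega).
  exact: measurable_dist_set.
apply: measurable_funM.
  apply: measurable_funM => //.
  exact: (measurableT_comp (measurable_powR (- s))).
rewrite (_ : (fun x => _) =
    (fun x => (1 + dist_boundary Omega x) `^ (- n%:R))); last first.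
  apply/funext => x; rewrite powRN powR_mulrn// addr_ge0//.
  exact: dist_set_ge0.
apply: (measurableT_comp (measurable_powR (- n%:R))).
exact: measurable_funD.
Qed.

Let mu_s0 : mu_s set0 = 0%E.
Proof. exact: integral_set0. Qed.

Let mu_s_ge0 A : (0 <= mu_s A)%E.
Proof. by apply: integral_ge0 => x _; exact: density_ge0. Qed.

Let mu_s_sigma_additive : semi_sigma_additive mu_s.
Proof.
exact: (semi_sigma_additive_nng_induced measurable_density density_ge0).
Qed.

HB.instance Definition _ := isMeasure.Build _ _ _ mu_s
  mu_s0 mu_s_ge0 mu_s_sigma_additive.

End exterior_measure.

(* A seminormed space of functions modulo an equivalence of functions; [fnorm]
   takes extended real values and is relevant only on [fcarrier]. *)
Record function_space (R : realType) (X : Type) := FunctionSpace {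
  fcarrier : set (X -> R) ;
  fnorm : (X -> R) -> \bar R ;
  fequiv : (X -> R) -> (X -> R) -> Prop
}.

Section operators.
Context {R : realType} {X : Type}.
Variables (E F : function_space R X) (A : (X -> R) -> (X -> R)).

Definition linear_operator :=
  [/\ forall u, fcarrier E u -> fcarrier F (A u),
      forall u v, fcarrier E u -> fcarrier E v -> fequiv E u v ->
        fequiv F (A u) (A v) &
      forall (a b : R) u v, fcarrier E u -> fcarrier E v ->
        fequiv F (A (fun x => a * u x + b * v x))
                (fun x => a * A u x + b * A v x)].

Definition continuous_operator :=
  forall u, fcarrier E u -> forall e : R, 0 < e -> exists2 d : R, 0 < d &
    forall v, fcarrier E v -> (fnorm E (v \- u)%R < d%:E)%E ->
      (fnorm F (A v \- A u)%R < e%:E)%E.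

Definition continuity_constant (C : R) :=
  forall u, fcarrier E u -> (fnorm F (A u) <= C%:E * fnorm E u)%E.

End operators.

Section spaces.
Context {R : realType} {n : nat}.
Variables (Omega : set 'rV[R]_n) (s : R).
Implicit Types (u g : 'rV[R]_n -> R).
Local Notation leb := (@lebesgue_rV R n).
Local Notation mu := (mu_s Omega s).
Local Notation d_ := (dist_boundary Omega).
Local Open Scope ereal_scope.

(* The functions are Borel measurable: every Lebesgue measurable function is a.e.
   equal to a Borel one, so this does not affect the classes modulo a.e. equality. *)

Definition V_seminorm u : \bar R :=
  (1 - s)%:E * \int[leb]_(x in Omega) \int[leb]_y
    (`|u x - u y| / enorm (x - y) `^ (n%:R + s))%:E.

Definition V_space : function_space R 'rV[R]_n := {|
  fcarrier := [set u | measurable_fun setT u /\ V_seminorm u < +oo] ;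
  fnorm := fun u => \int[leb]_(x in Omega) `|u x|%:E + V_seminorm u ;
  fequiv := fun u v => u = v %[ae leb]
|}.

(* Functions on the complement of Omega are represented by total functions whose
   values on Omega are irrelevant. *)

Definition L1_norm g : \bar R := \int[mu]_(x in ~` Omega) `|g x|%:E.

Definition L1_space : function_space R 'rV[R]_n := {|
  fcarrier := [set g | measurable_fun (~` Omega) g /\ L1_norm g < +oo] ;
  fnorm := L1_norm ;
  fequiv := fun g h => g = h %[ae leb in ~` Omega]
|}.

Definition T_norm g : \bar R :=
  L1_norm g +
  \int[mu]_(y in ~` Omega) \int[mu]_(x in ~` Omega)
    (`|g x - g y| / Num.min (enorm (x - y) + d_ x + d_ y)%R 1 `^ (n%:R - s))%:E.

Definition T_space : function_space R 'rV[R]_n := {|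
  fcarrier := [set g | measurable_fun (~` Omega) g /\ T_norm g < +oo] ;
  fnorm := T_norm ;
  fequiv := fun g h => g = h %[ae leb in ~` Omega]
|}.

Definition Tr u : 'rV[R]_n -> R := u \_ (~` Omega).

End spaces.

(* Main.v *)
(** Trace. The cone property of Lipschitz domains provides at each boundary point
    a direction e such that the translates by w, 2w, 3w, ... of the strip
    S_h = {y outside Omega, d_y <= h}, for w close to a fixed multiple of h e,
    are pairwise disjoint and contained in Omega.  Hence the integral of |u| over
    S_h is at most h times the L^1 norm of u on Omega plus the integral over Omega
    of |u(x) - u(x - w)|; averaging over w in a ball of radius h and integrating
    against h^(-1-s) dh gives the weighted bound, uniformly as s -> 1.  The case
    u = 1 shows that the boundary is a null set and that mu_s is finite.

    Extension. Inside Omega, u(x) is the average of g with respect to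
    |x-z|^(-d) mu_s(dz), whose mass is at least a multiple of d_x^(-s).  The
    interaction of Omega with its complement is bounded by integrating the kernel
    |x-z|^(s-d) |x-y|^(-d-s) over x in Omega.  Two points of Omega at distance at
    least d_x/2 are compared through the values of g on an exterior ball at
    distance about d_x; for two closer points the averaging kernels differ by a
    factor |x-y|/d_x, which leads to the kernel d_x^s |x-z|^(-d) |x-w|^(-d). *)
Require Import Defs.
From mathcomp Require Import all_boot all_order all_algebra.
From mathcomp Require Import all_classical all_reals all_analysis.
From mathcomp Require Import measurable_realfun ring lra.

Set Implicit Arguments.
Unset Strict Implicit.
Unset Printing Implicit Defensive.

Import Order.TTheory GRing.Theory Num.Theory.
Import numFieldNormedType.Exports.

Local Open Scope classical_set_scope.
Local Open Scope ring_scope.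

(** Uniformity as s tends to 1 rests on a balance: each factor 1 - s is spent against one integral
    of h^(-s) near 0, which is of order 1/(1 - s). This occurs in the L^1 term of the strip
    estimate, in the lower bound for the mass (whose density carries 1 - s) and in the integral over
    y close to x, where the gain |x-y|/d_x turns |x-y|^(-d-s) into the integrable |x-y|^(1-s-d). In
    the interaction with the complement the factor is absorbed into the density of [mu_s] at y.
    Since the mass is of order d_x^(-s), dividing by it multiplies by d_x^s and costs no power of 1
    - s. What resists is a tail integral with exponent d - s. It is controlled by a parameter
    [sigma] with 0 < [sigma] <= d - s: the value 1 serves in dimension two and higher, whereas
    dimension one forces s to stay away from 1. A power of 0 with nonzero exponent is 0 here, so the
    weights vanish on the boundary instead of being infinite. This is harmless because the boundary
    is a null set, a fact that has to be proved first. *)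

Section integral_tools.
Local Open Scope ereal_scope.
Context d (T : measurableType d) (R : realType).
Variable m : {measure set T -> \bar R}.

(* The library asks for measurability, which the supremum over simple functions
   does not need. *)
Lemma nneg_le_integral (D : set T) (f g : T -> \bar R) :
  (forall x, D x -> 0 <= f x) -> (forall x, D x -> f x <= g x) ->
  \int[m]_(x in D) f x <= \int[m]_(x in D) g x.
Proof.
move=> f0 fg.
have g0 x : D x -> 0 <= g x by move=> Dx; exact: le_trans (f0 _ Dx) (fg _ Dx).
rewrite !(integral_mkcond D) !ge0_integralTE; last 2 first.
- by move=> x; rewrite patchE; case: ifPn => // /set_mem; exact: g0.
- by move=> x; rewrite patchE; case: ifPn => // /set_mem; exact: f0.
apply: le_ereal_sup => _ [h hf <-]; exists h => // x.
apply: le_trans (hf x) _; rewrite !patchE; case: ifPn => // /set_mem; exact: fg.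
Qed.

Import HBNNSimple.

(** Both sides are limits along the same increasing simple functions, which reduces the claim to
    level sets, where [nuE] applies. It serves to rewrite integrals against [mu_s] as Lebesgue
    integrals. *)
Lemma integral_density (nu : {measure set T -> \bar R}) (h : T -> R)
    (D : set T) (f : T -> \bar R) :
  measurable_fun setT h -> (forall x, 0 <= h x)%R ->
  (forall A, measurable A -> nu A = \int[m]_(x in A) (h x)%:E) ->
  measurable D -> measurable_fun D f -> (forall x, D x -> 0 <= f x) ->
  \int[nu]_(x in D) f x = \int[m]_(x in D) (f x * (h x)%:E).
Proof.
move=> mh h0 nuE mD mf f0.
pose g := nnsfun_approx mD mf.
have -> : \int[nu]_(x in D) f x = limn (fun n => \int[nu]_(x in D) (g n x)%:E).
  rewrite -monotone_convergence//.
  - apply: eq_integral => y /[!inE] yD; apply/esym/cvg_lim => //.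
    exact: cvg_nnsfun_approx.
  - by move=> n; exact/measurable_EFinP/measurable_funTS/measurable_funP.
  - by move=> n y _; rewrite lee_fin.
  - by move=> y _ a b ab; rewrite lee_fin; exact/lefP/nd_nnsfun_approx.
have -> : \int[m]_(x in D) (f x * (h x)%:E) =
    limn (fun n => \int[m]_(x in D) (g n x * h x)%:E).
  rewrite -monotone_convergence//.
  - apply: eq_integral => y /[!inE] yD; apply/esym/cvg_lim => //.
    under eq_fun do rewrite EFinM.
    by apply: cvgeZr => //; exact: cvg_nnsfun_approx.
  - move=> n; apply/measurable_EFinP/measurable_funTS/measurable_funM => //.
  - by move=> n y _; rewrite lee_fin mulr_ge0.
  - move=> y _ a b ab; rewrite lee_fin ler_wpM2r//.
    exact/lefP/nd_nnsfun_approx.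
congr (limn _); apply/funext => n.
transitivity (\int[nu]_(x in D)
   (\sum_(y \in range (g n)) (y * \1_(g n @^-1` [set y]) x)%:E)).
  by apply: eq_integral => t tE; rewrite /= fimfunE -fsumEFin.
rewrite ge0_integral_fsum//; last 2 first.
- by move=> y; apply/measurable_EFinP/measurable_funTS/measurable_funM.
- by move=> y x _; rewrite nnfun_muleindic_ge0.
transitivity (\int[m]_(x in D)
   (\sum_(y \in range (g n)) (y * \1_(g n @^-1` [set y]) x * h x)%:E)); last first.
  apply: eq_integral => t tE; rewrite /= fimfunE fsumEFin//; congr EFin.
  by rewrite !fsbig_finite//= mulr_suml.
rewrite ge0_integral_fsum//; last 2 first.
- move=> y; apply/measurable_EFinP/measurable_funTS/measurable_funM => //.
  exact: measurable_funM.
- move=> y x _; rewrite EFinM mule_ge0 ?lee_fin//.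
  by have := nnfun_muleindic_ge0 (g n) y x; rewrite -lee_fin.
apply: eq_fsbigr => y /[!inE] -[x _ yx].
have y0 : (0 <= y)%R by rewrite -yx.
under eq_integral do rewrite EFinM.
rewrite ge0_integralZl_EFin//; last by apply/measurable_EFinP/measurable_funTS.

under [RHS]eq_integral do rewrite -mulrA EFinM.
rewrite ge0_integralZl_EFin//; last 2 first.
- by move=> ? _; rewrite lee_fin mulr_ge0.
- by apply/measurable_EFinP/measurable_funTS/measurable_funM.
congr (_ * _).
rewrite integral_indic// nuE; last exact: measurableI.
rewrite setIC integral_mkcondr; apply: eq_integral => z _.
by rewrite patchE indicE; case: ifPn; rewrite ?mul1r ?mul0r.
Qed.

End integral_tools.

(** * Lebesgue measure on row vectors: translations and cubes *)

Section lebesgue_rV_tools.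
Local Open Scope ereal_scope.
Context {R : realType}.

(** By uniqueness of Lebesgue measure, half-open intervals are enough to test. *)
Lemma lebesgue_measure_shift (c : R) (A : set (measurableTypeR R)) : measurable A ->
  pushforward (@lebesgue_measure R) ((fun x : R => c + x)%R : measurableTypeR R -> measurableTypeR R) A
  = lebesgue_measure A.
Proof.
have mc : measurable_fun setT ((fun x : R => c + x)%R : measurableTypeR R -> measurableTypeR R).
  exact: measurable_funD.
move=> mA; apply/esym/lebesgue_measure_unique => //= _ [[a b]] _ <-.
rewrite /pushforward (_ : _ @^-1` _ = `](a - c)%R, (b - c)%R]%classic); last first.
  by apply/seteqP; split => x /=; rewrite !in_itv/= ltrBlDl lerBrDl.
rewrite !lebesgue_measure_itv/= !lte_fin ltrD2r; case: ifPn => // _.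
by rewrite -!EFinD; congr EFin; ring.
Qed.

Lemma integral_lebesgue_shift (c : R) (f : measurableTypeR R -> \bar R) :
  measurable_fun setT f -> (forall x, 0 <= f x) ->
  \int[lebesgue_measure]_x f (c + x)%R = \int[lebesgue_measure]_x f x.
Proof.
move=> mf f0.
have mc : measurable_fun setT ((fun x : R => c + x)%R : measurableTypeR R -> measurableTypeR R).
  exact: measurable_funD.
have := ge0_integral_pushforward mc (@lebesgue_measure R) measurableT mf (fun x _ => f0 x).
rewrite preimage_setT /= => <-.
by apply: eq_measure_integral => A mA _; exact: lebesgue_measure_shift.
Qed.

Lemma integral_lebesgue_rVS n (f : 'rV[R]_n.+1 -> \bar R) :
  measurable_fun setT f -> (forall x, 0 <= f x) ->
  \int[lebesgue_rV n.+1]_x f x =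
  \int[@lebesgue_measure R]_t \int[lebesgue_rV n]_y f (rV_cons (t, y)).
Proof.
move=> mf f0.
rewrite (_ : \int[lebesgue_rV n.+1]_x f x =
  \int[pushforward (@lebesgue_measure R \x @lebesgue_rV R n) (@rV_cons R n)]_x f x) //.
rewrite ge0_integral_pushforward//; last exact: measurable_rV_cons.
rewrite preimage_setT fubini_tonelli1//.
by apply: measurableT_comp => //; exact: measurable_rV_cons.
by move=> x; exact: f0.
Qed.

Lemma rV_consD n (t c : R) (y v : 'rV[R]_n) :
  (rV_cons (t, y) + rV_cons (c, v) = rV_cons (t + c, y + v))%R.
Proof.
apply/rowP => i; rewrite mxE; case: (unliftP ord0 i) => [j ->|->].
  by rewrite !rV_consS mxE.
by rewrite !rV_cons0.
Qed.

Lemma measurable_fun_rV_addl n (c : 'rV[R]_n) :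
  measurable_fun setT (fun x : 'rV[R]_n => c + x)%R.
Proof.
apply: measurable_fun_rV => i; rewrite (_ : _ \o _ = (fun x => rV_coord i c + rV_coord i x)%R).
  by apply: measurable_funD => //; exact: measurable_rV_coord.
by apply/funext => x; rewrite /rV_coord /= mxE.
Qed.

(** Induction on the dimension: Tonelli splits off the first coordinate, which is shifted by the
    one-dimensional result, and the induction hypothesis shifts the others. *)
Lemma integral_lebesgue_rV_shift n (c : 'rV[R]_n) (f : 'rV[R]_n -> \bar R) :
  measurable_fun setT f -> (forall x, 0 <= f x) ->
  \int[lebesgue_rV n]_x f (c + x)%R = \int[lebesgue_rV n]_x f x.
Proof.
elim: n c f => [|n IH] c f mf f0.
  by apply: eq_integral => x _; congr f; apply/rowP; case.
have mfc : measurable_fun setT (fun x => f (c + x)%R).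
  by apply: measurableT_comp => //; exact: measurable_fun_rV_addl.
rewrite !integral_lebesgue_rVS//.
rewrite -[c]rV_unconsK; case: (rV_uncons c) => c0 v.
pose F t := \int[lebesgue_rV n]_y f (rV_cons (t, y)).
have mf2 : measurable_fun setT (fun p : measurableTypeR R * 'rV[R]_n => f (rV_cons p)).
  by apply: measurableT_comp => //; exact: measurable_rV_cons.
transitivity (\int[lebesgue_measure]_t F (c0 + t)%R).
  apply: eq_integral => t _; rewrite /F -[RHS](IH v); last 2 first.
  - exact: (measurableT_comp mf2 (@pair1_measurable _ _ (measurableTypeR R) _ (c0 + t)%R)).
  - by move=> x; exact: f0.
  by apply: eq_integral => y _; rewrite rV_consD.
rewrite integral_lebesgue_shift//.
- exact: (measurable_fun_fubini_tonelli_F _ mf2 (fun=> f0 _)).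
- by move=> x; exact: integral_ge0.
Qed.

Lemma measurable_cube n (c : 'rV[R]_n) (r : R) :
  measurable [set x : 'rV[R]_n | forall i, c ord0 i - r < x ord0 i < c ord0 i + r]%R.
Proof.
rewrite (_ : [set _ | _] = \bigcap_(i in [set: 'I_n])
   (rV_coord i @^-1` `](c ord0 i - r)%R, (c ord0 i + r)%R[%classic)).
  apply: fin_bigcap_measurable => // i _; rewrite -[X in measurable X]setTI.
  by apply: measurable_rV_coord => //; exact: measurable_itv.
apply/seteqP; split => x /= H i; first by move=> _; rewrite /= in_itv; exact: H.
by have := H i Logic.I; rewrite /= in_itv.
Qed.

(** Cubes are the only sets whose volume is computed; Euclidean balls are compared with inscribed
    and circumscribed cubes. *)
Lemma lebesgue_rV_cube n (c : 'rV[R]_n) (r : R) : (0 < r)%R ->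
  lebesgue_rV n [set x | forall i, c ord0 i - r < x ord0 i < c ord0 i + r]%R
  = ((2 * r) ^+ n)%:E.
Proof.
move=> r0; elim: n c => [|n IH] c.
  rewrite expr0 /lebesgue_rV /= /dirac /= indicE mem_set//=.
  by case.
rewrite /lebesgue_rV /= /lebesgue_rV_step /pushforward.
rewrite (_ : _ @^-1` _ = `](c ord0 ord0 - r)%R, (c ord0 ord0 + r)%R[%classic `*`
   [set x : 'rV[R]_n | forall i, (\row_i c ord0 (lift ord0 i)) ord0 i - r < x ord0 i < (\row_i c ord0 (lift ord0 i)) ord0 i + r]%R); last first.
  apply/seteqP; split => -[t y] /=.
    move=> H; split; first by have := H ord0; rewrite rV_cons0 in_itv.
    by move=> i; have := H (lift ord0 i); rewrite rV_consS mxE.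
  move=> [H1 H2] i; case: (unliftP ord0 i) => [j ->|->].
    by rewrite rV_consS; have := H2 j; rewrite mxE.
  by rewrite rV_cons0; move: H1; rewrite in_itv.
rewrite product_measure1E//; last first.
  exact: measurable_cube.
rewrite /= lebesgue_measure_itv /= lte_fin ltrD2l gtrN// -!EFinD.
have := IH (\row_i c ord0 (lift ord0 i)); rewrite /lebesgue_rV => ->.
by rewrite -EFinM exprS; congr (EFin (_ * _)%R); ring.
Qed.

End lebesgue_rV_tools.

(** * Measurability by structural search *)

Section measurability.
Context d (T : measurableType d) {R : realType}.

Lemma measurable_natr (b : T -> bool) : measurable_fun setT b ->
  measurable_fun setT (fun t => (b t)%:R : R).
Proof.
move=> mb; rewrite (_ : (fun t => _) = (fun t => if b t then 1 else 0)).
  exact: measurable_fun_ifT.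
by apply/funext => t; case: (b t).
Qed.

Lemma measurable_mem d' (T' : measurableType d') (A : set T') (f : T -> T') :
  measurable A -> measurable_fun setT f -> measurable_fun setT (fun t => f t \in A).
Proof.
move=> mA mf; apply: (measurable_fun_bool true).
rewrite (_ : _ @^-1` _ = f @^-1` A); last first.
  by apply/seteqP; split=> t /=; [move=> /set_mem|move=> ?; exact/mem_set].
exact: mf.
Qed.

Lemma measurable_coord n (f : T -> 'rV[R]_n) i : measurable_fun setT f ->
  measurable_fun setT (fun t => f t ord0 i : R).
Proof.
move=> mf; rewrite (_ : (fun t => _) = @rV_coord R n i \o f) //.
by apply: measurableT_comp => //; exact: measurable_rV_coord.
Qed.

Lemma measurable_rVD n (f g : T -> 'rV[R]_n) :
  measurable_fun setT f -> measurable_fun setT g ->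
  measurable_fun setT (fun t => f t + g t).
Proof.
move=> mf mg; apply: measurable_fun_rV => i.
rewrite (_ : _ \o _ = (fun t => f t ord0 i + g t ord0 i)).
  by apply: measurable_funD; exact: measurable_coord.
by apply/funext => t; rewrite /rV_coord /= mxE.
Qed.

Lemma measurable_rVZ n (f : T -> 'rV[R]_n) (k : T -> R) :
  measurable_fun setT k -> measurable_fun setT f ->
  measurable_fun setT (fun t => k t *: f t).
Proof.
move=> mk mf; apply: measurable_fun_rV => i.
rewrite (_ : _ \o _ = (fun t => k t * f t ord0 i)).
  by apply: measurable_funM => //; exact: measurable_coord.
by apply/funext => t; rewrite /rV_coord /= mxE.
Qed.

Lemma measurable_rVN n (f : T -> 'rV[R]_n) : measurable_fun setT f ->
  measurable_fun setT (fun t => - f t).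
Proof.
move=> mf; rewrite (_ : (fun t => _) = (fun t => (-1) *: f t)).
  exact: measurable_rVZ.
by apply/funext => t; rewrite scaleN1r.
Qed.

Lemma measurable_enorm n (f : T -> 'rV[R]_n) : measurable_fun setT f ->
  measurable_fun setT (fun t => enorm (f t)).
Proof.
by move=> mf; apply: (measurableT_comp (continuous_measurable_rV (@enorm_continuous R n))).
Qed.

Lemma measurable_dist n (A : set 'rV[R]_n) (f : T -> 'rV[R]_n) : measurable_fun setT f ->
  measurable_fun setT (fun t => dist_set A (f t)).
Proof. by move=> mf; apply: (measurableT_comp (measurable_dist_set A)). Qed.

Lemma measurable_dist_boundary n (A : set 'rV[R]_n) (f : T -> 'rV[R]_n) : measurable_fun setT f ->
  measurable_fun setT (fun t => dist_boundary A (f t)).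
Proof. exact: measurable_dist. Qed.

Lemma measurable_fun_powR p (f : T -> R) : measurable_fun setT f ->
  measurable_fun setT (fun t => f t `^ p).
Proof. by move=> mf; apply: (measurableT_comp (measurable_powR p)). Qed.

(** The inverse is written as f times the power -1 of f^2: real powers behave well on nonnegative
    bases only, and at zeros of f both sides are 0. *)
Lemma measurable_fun_inv (f : T -> R) : measurable_fun setT f ->
  measurable_fun setT (fun t => (f t)^-1).
Proof.
move=> mf; rewrite (_ : (fun t => _) = (fun t => f t * (f t ^+ 2) `^ (-1))).
  by apply: measurable_funM => //; apply: measurable_fun_powR; exact: measurable_funX.
apply/funext => t; rewrite powR_inv1 ?sqr_ge0//.
have [->|f0] := eqVneq (f t) 0; first by rewrite invr0 mul0r.
by rewrite expr2 invfM mulrA mulfV// mul1r.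
Qed.

Lemma measurable_fun_norm (f : T -> R) : measurable_fun setT f ->
  measurable_fun setT (fun t => `|f t|).
Proof. by move=> mf; apply: measurableT_comp. Qed.

Lemma measurable_fun_min (f g : T -> R) : measurable_fun setT f ->
  measurable_fun setT g -> measurable_fun setT (fun t => Num.min (f t) (g t)).
Proof. exact: measurable_minr. Qed.

End measurability.

(** Descends through the shape of the function. Hypotheses are tried first, so that functions known
    to be measurable stop the descent. *)
Ltac mea1 := first
  [ assumption
  | match goal with H : measurable_fun setT ?f |- measurable_fun _ (fun x => ?f (@?g x)) =>
      apply: (measurableT_comp H) end
  | match goal with
    | |- measurable_fun _ (fun x => x) => exact: measurable_id
    | |- measurable_fun _ (fun x => ?c) => exact: measurable_cst
    | |- measurable_fun _ fst => exact: measurable_fst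
    | |- measurable_fun _ snd => exact: measurable_snd
    | |- measurable_fun _ (fun x => fst x) => exact: measurable_fst
    | |- measurable_fun _ (fun x => snd x) => exact: measurable_snd
    | |- measurable_fun _ (fun x => fst (@?g x)) => apply: (measurableT_comp measurable_fst)
    | |- measurable_fun _ (fun x => snd (@?g x)) => apply: (measurableT_comp measurable_snd)
    | |- measurable_fun _ (fun x => EFin (@?g x)) => apply/measurable_EFinP
    | |- measurable_fun _ (fun x => GRing.natmul _ (nat_of_bool _)) => apply: measurable_natr
    | |- measurable_fun _ (fun x => in_mem _ _) => apply: measurable_mem => //
    | |- measurable_fun _ (fun x => andb _ _) => apply: measurable_and
    | |- measurable_fun _ (fun x => negb _) => apply: measurable_neg
    | |- measurable_fun _ (fun x => Order.le _ _) => apply: measurable_fun_ler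
    | |- measurable_fun _ (fun x => Order.lt _ _) => apply: measurable_fun_ltr
    | |- measurable_fun _ (fun x => GRing.inv _) => apply: measurable_fun_inv
    | |- measurable_fun _ (fun x => Num.norm _) => apply: measurable_fun_norm
    | |- measurable_fun _ (fun x => Order.min _ _) => apply: measurable_fun_min
    | |- measurable_fun _ (fun x => powR _ _) => apply: measurable_fun_powR
    | |- measurable_fun _ (fun x => enorm _) => apply: measurable_enorm
    | |- measurable_fun _ (fun x => dist_boundary _ _) => apply: measurable_dist_boundary
    | |- measurable_fun _ (fun x => dist_set _ _) => apply: measurable_dist
    | |- measurable_fun _ (fun x => GRing.mul _ _) => apply: measurable_funM
    | |- measurable_fun _ (fun x => GRing.exp _ _) => apply: measurable_funX
    | |- measurable_fun _ (fun x => GRing.scale _ _) => apply: measurable_rVZ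
    | |- measurable_fun _ (dist_boundary _) => exact: (measurable_dist_boundary _ (@measurable_id _ _ _))
    | |- measurable_fun _ (dist_set _) => exact: measurable_dist_set
    | |- measurable_fun _ enorm => exact: (measurable_enorm (@measurable_id _ _ _))
    | |- measurable_fun _ -%R =>
        first [exact: (measurable_rVN (@measurable_id _ _ _)) | exact: (measurable_funN (@measurable_id _ _ _))]
    | |- measurable_fun ?D (+%R ?c) => change (measurable_fun D (fun x => c + x)%R)
    | |- measurable_fun _ (fun x => (_ + _)%R) =>
        first [apply: measurable_funD | apply: measurable_rVD]
    | |- measurable_fun _ (fun x => (- _)%R) =>
        first [apply: measurable_funN | apply: measurable_rVN]
    end
  | apply: measurable_coord
  | exact: measurable_funTS ].
Ltac mea := repeat mea1.

(** * Integrals of powers on the half-line *)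

Section powR_integrals.
Context {R : realType}.
Implicit Types a b c h : R.
Local Notation lb := (@lebesgue_measure R).

Lemma powRD_gt0 a b c : 0 < a -> a `^ (b + c) = a `^ b * a `^ c.
Proof. by move=> a0; rewrite powRD// (gt_eqF a0)//; exact: implybT. Qed.

Lemma mulr_powR a b : 0 < a -> a * a `^ b = a `^ (1 + b).
Proof. by move=> a0; rewrite powRD_gt0// powRr1// ltW. Qed.

Lemma powR_continuous_at (p x : R) : 0 < x -> {for x, continuous (fun h : R => h `^ p)}.
Proof.
move=> x0; apply: differentiable_continuous; apply/derivable1_diffP.
by apply: derivable_powR; rewrite in_itv/= andbT.
Qed.

Lemma integral_powR c a (p : R) : 0 < c -> c < a -> p != 0 ->
  (\int[lb]_(h in `[c, a]) (h `^ (p - 1))%:E = ((a `^ p - c `^ p) / p)%:E)%E.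
Proof.
move=> c0 ca p0.
have a0 : 0 < a by exact: lt_trans ca.
have cts (q : R) x : x \in `[c, a] -> {for x, continuous (fun h : R => h `^ q)}.
  by rewrite in_itv/= => /andP[cx _]; apply: powR_continuous_at; exact: lt_le_trans cx.
have dF (x : R) : 0 < x -> is_derive x 1 (fun h : R => p^-1 * h `^ p) (x `^ (p - 1)).
  move=> x0; have H := is_derive1_powR p x0.
  rewrite (_ : (fun h => _) = p^-1 \*: (fun h : R => h `^ p)) //.
  have H2 := is_deriveZ p^-1 H; apply: (is_derive_eq H2).
  by rewrite /GRing.scale/= mulrA mulVf// mul1r.
rewrite (@continuous_FTC2 _ _ (fun h : R => p^-1 * h `^ p))//.
- by rewrite -EFinB; congr EFin; rewrite -mulrBr mulrC.
- by apply: continuous_in_subspaceT => x /set_mem; exact: cts.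
- have ctF (x : R) : 0 < x -> {for x, continuous (fun h : R => p^-1 * h `^ p)}.
    move=> x0; apply: differentiable_continuous; apply/derivable1_diffP.
    exact: (@ex_derive _ _ _ _ _ _ _ (dF x x0)).
  split.
  + move=> x; rewrite in_itv/= => /andP[cx _].
    exact: (@ex_derive _ _ _ _ _ _ _ (dF x (lt_trans c0 cx))).
  + by apply: cvg_at_right_filter; exact: ctF.
  + by apply: cvg_at_left_filter; exact: ctF.
- move=> x; rewrite in_itv/= => /andP[cx _]; rewrite derive1E.
  exact: (@derive_val _ _ _ _ _ _ _ (dF x (lt_trans c0 cx))).
Qed.

Lemma integral_powR_le (D : set R) (F : nat -> set R) p (C : R) :
  (forall i, measurable (F i)) -> nondecreasing_seq F -> \bigcup_i F i = D ->
  (forall i, \int[lb]_(h in F i) (h `^ p)%:E <= C%:E)%E ->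
  (\int[lb]_(h in D) (h `^ p)%:E <= C%:E)%E.
Proof.
move=> mF ndF <- FC.
have mf i : measurable_fun (F i : set (measurableTypeR R)) (fun h : R => (h `^ p)%:E).
  by apply/measurable_EFinP; apply: measurable_funTS; exact: measurable_powR.
have H := @ge0_nondecreasing_set_cvg_integral _ (measurableTypeR R) R F
  (fun h : R => (h `^ p)%:E) lebesgue_measure ndF mF mf
  (fun i x _ => powR_ge0 x p : (0 <= (x `^ p)%:E)%E).
rewrite -(cvg_lim _ H)//; apply: lime_le; first by apply/cvg_ex; exists (\int[lb]_(x in \bigcup_i F i) (x `^ p)%:E)%E.
by apply: nearW.
Qed.

Lemma integral_powR_near a b : 0 < a -> 0 < b ->
  (\int[lb]_(h in `]0%R, a]) (h `^ (b - 1))%:E <= (a `^ b / b)%:E)%E.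
Proof.
move=> a0 b0.
(* The denominators start at 2 so that every left end point is strictly below a. *)
apply: (@integral_powR_le _ (fun i => `[a / i.+2%:R, a]%classic)).
- by move=> i; exact: measurable_itv.
- apply/nondecreasing_seqP => i; rewrite subsetEset => x /=; rewrite !in_itv/= => /andP[h1 ->].
  rewrite andbT; apply: le_trans h1; rewrite ler_pM2l// lef_pV2 ?posrE ?ltr0n// ler_nat.
  by [].
- apply/seteqP; split => x /=.
    move=> [i _] /=; rewrite !in_itv/= => /andP[h1 ->]; rewrite andbT.
    by apply: lt_le_trans h1; rewrite divr_gt0.
  rewrite in_itv/= => /andP[x0 xa].
  exists (Num.truncn (a / x)) => //=; rewrite in_itv/= xa andbT.
  rewrite ler_pdivrMr// mulrC -ler_pdivrMr//; apply: ltW.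
  apply: lt_trans (truncnS_gt _) _; by rewrite ltr_nat.
- move=> i; rewrite integral_powR//; last 3 first.
  + by rewrite divr_gt0.
  + by rewrite ltr_pdivrMr// ltr_pMr// ltr1n.
  + by rewrite gt_eqF.
  by rewrite lee_fin ler_pM2r ?invr_gt0// gerBl powR_ge0.
Qed.

Lemma integral_powR_tail a b : 0 < a -> 0 < b ->
  (\int[lb]_(h in `[a, +oo[) (h `^ (- b - 1))%:E <= (a `^ (- b) / b)%:E)%E.
Proof.
move=> a0 b0.
apply: (@integral_powR_le _ (fun i => `[a, a + i.+1%:R]%classic)).
- by move=> i; exact: measurable_itv.
- apply/nondecreasing_seqP => i; rewrite subsetEset => x /=; rewrite !in_itv/= => /andP[-> h1] /=.
  by apply: le_trans h1 _; rewrite lerD2l ler_nat.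
- apply/seteqP; split => x /=.
    by move=> [i _] /=; rewrite !in_itv/= => /andP[-> _].
  rewrite in_itv/= andbT => xa.
  exists (Num.truncn (x - a)) => //=; rewrite in_itv/= xa/=.
  by rewrite -lerBlDl; apply: ltW; exact: truncnS_gt.
- move=> i; rewrite integral_powR//; last 2 first.
  + by rewrite ltrDl.
  + by rewrite oppr_eq0 gt_eqF.
  rewrite lee_fin invrN mulrN -mulNr ler_pM2r ?invr_gt0// opprB gerBl powR_ge0//.
Qed.

Lemma integral_powR_near_ge a b : 0 < a -> 0 < b ->
  ((a `^ b / (2 * b))%:E <= \int[lb]_(h in `]0%R, a]) (h `^ (b - 1))%:E)%E.
Proof.
move=> a0 b0.
(* This c satisfies c^b = a^b / 2, so the integral over [c, a] alone already has half of the full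
   value. *)
pose c := a * 2 `^ (- b^-1).
have c0 : 0 < c by rewrite mulr_gt0// powR_gt0.
have cb : c `^ b = a `^ b / 2.
  rewrite /c powRM ?(ltW a0) ?powR_ge0// -powRrM mulNr mulVf ?gt_eqF//.
  by rewrite powR_inv1.
have ca : c < a.
  rewrite ltNge; apply/negP => ac.
  have : a `^ b <= c `^ b by apply: ge0_ler_powR => //; rewrite ?nnegrE ltW.
  by rewrite cb leNgt ltr_pdivrMr// ltr_pMr ?powR_gt0// ltr1n.
apply: (@le_trans _ _ (\int[lb]_(h in `[c, a]) (h `^ (b - 1))%:E)%E).
  rewrite integral_powR ?gt_eqF// cb lee_fin.
  rewrite le_eqVlt; apply/orP; left; apply/eqP; field.
  by rewrite gt_eqF.
apply: ge0_subset_integral => //=.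
- by apply/measurable_EFinP; apply: measurable_funTS; exact: measurable_powR.
- by move=> x _; rewrite lee_fin powR_ge0.
- by move=> x /=; rewrite !in_itv/= => /andP[h ->]; rewrite andbT (lt_le_trans c0).
Qed.

(** In the layer cake arguments a power of y is recovered, up to a constant, from the scales h in
    [y, 2y] alone. *)
Lemma integral_powR_dyadic y p : 0 < y -> p <= 0 ->
  ((y * (2 * y) `^ p)%:E <= \int[lb]_(h in `[y, (2 * y)%R]) (h `^ p)%:E)%E.
Proof.
move=> y0 p0.
have y2 : y < 2 * y by rewrite ltr_pMl// ltr1n.
apply: (@le_trans _ _ (\int[lb]_(h in `[y, (2 * y)%R]) ((2 * y) `^ p)%:E)%E).
  rewrite integral_cst//= lebesgue_measure_itv/= lte_fin y2 -EFinD -EFinM lee_fin.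
  by rewrite mulrC ler_wpM2l ?powR_ge0//; lra.
apply: nneg_le_integral => h; rewrite /= in_itv/= => /andP[yh h2].
  by rewrite lee_fin powR_ge0.
have h0 : 0 < h by exact: lt_le_trans yh.
rewrite lee_fin -[p]opprK !(powRN _ (- p)) lef_pV2 ?posrE ?powR_gt0//; last by lra.
by apply: ge0_ler_powR; rewrite ?nnegrE ?oppr_ge0 ?(ltW h0)//; lra.
Qed.

End powR_integrals.

(** * The Euclidean norm *)

Section euclidean_tools.
Context {R : realType} {n : nat}.
Implicit Types x y z : 'rV[R]_n.

Lemma enorm_ge0 x : 0 <= enorm x.
Proof. exact: sqrtr_ge0. Qed.

Lemma enorm_sqr x : enorm x ^+ 2 = \sum_(i < n) x ord0 i ^+ 2.
Proof. by rewrite sqr_sqrtr// sumr_ge0// => i _; rewrite sqr_ge0. Qed.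

Lemma enormN x : enorm (- x) = enorm x.
Proof. by congr Num.sqrt; apply: eq_bigr => i _; rewrite mxE sqrrN. Qed.

Lemma enormB x y : enorm (x - y) = enorm (y - x).
Proof. by rewrite -enormN opprB. Qed.

Lemma enormZ (a : R) x : enorm (a *: x) = `|a| * enorm x.
Proof.
rewrite /enorm -sqrtr_sqr -sqrtrM ?sqr_ge0//; congr Num.sqrt.
by rewrite mulr_sumr; apply: eq_bigr => i _; rewrite mxE exprMn.
Qed.

Lemma enorm0 : enorm (0 : 'rV[R]_n) = 0.
Proof. by rewrite -(scale0r (0 : 'rV[R]_n)) enormZ normr0 mul0r. Qed.

Lemma coord_le_enorm x i : `|x ord0 i| <= enorm x.
Proof.
rewrite -sqrtr_sqr ler_wsqrtr// (bigD1 i)//= lerDl.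
by rewrite sumr_ge0// => j _; rewrite sqr_ge0.
Qed.

Lemma enorm_eq0 x : enorm x = 0 -> x = 0.
Proof.
move=> x0; apply/rowP => i; rewrite mxE; apply/eqP; rewrite -normr_le0.
by rewrite -x0 coord_le_enorm.
Qed.

(** The sum of the squares of |y| x_i - |x| y_i is nonnegative; expanding it gives the inequality
    multiplied by 2 |x| |y|. Vectors of norm 0 are therefore treated apart. *)
Lemma cauchy_schwarz x y : \sum_(i < n) x ord0 i * y ord0 i <= enorm x * enorm y.
Proof.
have [x0|x0] := eqVneq (enorm x) 0.
  rewrite x0 mul0r (enorm_eq0 x0) big1// => i _; by rewrite mxE mul0r.
have [y0|y0] := eqVneq (enorm y) 0.
  rewrite y0 mulr0 (enorm_eq0 y0) big1// => i _; by rewrite mxE mulr0.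
have xp : 0 < enorm x by rewrite lt_neqAle eq_sym x0 enorm_ge0.
have yp : 0 < enorm y by rewrite lt_neqAle eq_sym y0 enorm_ge0.
have H : 0 <= \sum_(i < n) (enorm y * x ord0 i - enorm x * y ord0 i) ^+ 2.
  by rewrite sumr_ge0// => i _; rewrite sqr_ge0.
have E : \sum_(i < n) (enorm y * x ord0 i - enorm x * y ord0 i) ^+ 2 =
   enorm y ^+ 2 * (\sum_(i < n) x ord0 i ^+ 2) + enorm x ^+ 2 * (\sum_(i < n) y ord0 i ^+ 2)
     - 2 * (enorm x * enorm y) * \sum_(i < n) x ord0 i * y ord0 i.
  transitivity (\sum_(i < n) (enorm y ^+ 2 * x ord0 i ^+ 2 + enorm x ^+ 2 * y ord0 i ^+ 2
     - 2 * (enorm x * enorm y) * (x ord0 i * y ord0 i))).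
    by apply: eq_bigr => i _; ring.
  by rewrite sumrB big_split/= -!mulr_sumr.
have H2 : 2 * (enorm x * enorm y) * \sum_(i < n) x ord0 i * y ord0 i <=
   2 * (enorm x * enorm y) * (enorm x * enorm y).
  by move: H; rewrite E -!enorm_sqr; set S := \sum_(i < n) _; nra.
by move: H2; rewrite ler_pM2l// !mulr_gt0.
Qed.

Lemma ler_enormD x y : enorm (x + y) <= enorm x + enorm y.
Proof.
rewrite -(@ler_pXn2r _ 2)// ?nnegrE ?addr_ge0 ?enorm_ge0//.
rewrite sqrrD !enorm_sqr.
have -> : \sum_(i < n) (x + y) ord0 i ^+ 2 = \sum_(i < n) x ord0 i ^+ 2 +
   (\sum_(i < n) x ord0 i * y ord0 i) *+ 2 + \sum_(i < n) y ord0 i ^+ 2.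
  rewrite -sumrMnl -!big_split/=; apply: eq_bigr => i _; rewrite mxE; ring.
by rewrite lerD2r lerD2l lerMn2r/=; exact: cauchy_schwarz.
Qed.

Lemma ler_enorm_dist x y z : enorm (x - z) <= enorm (x - y) + enorm (y - z).
Proof. by rewrite -[x in enorm (x - z)](subrK y) -addrA ler_enormD. Qed.

Lemma measurable_eball z r : measurable (eball z r).
Proof.
rewrite -[X in measurable X]setTI.
have : measurable_fun setT (fun y : 'rV[R]_n => enorm (y - z)) by mea.
move=> /(_ measurableT `]-oo, r[%classic (measurable_itv _)).
by congr (measurable (_ `&` _)); apply/seteqP; split => x /=; rewrite in_itv.
Qed.

Lemma lebesgue_rV_eball_le z r : 0 < r -> (lebesgue_rV n (eball z r) <= ((2 * r) ^+ n)%:E)%E.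
Proof.
move=> r0; rewrite -(lebesgue_rV_cube z r0).
apply: le_measure; rewrite ?inE.
- exact: measurable_eball.
- exact: measurable_cube.
- move=> x xr i; rewrite -ltr_distl; apply: le_lt_trans xr.
  by have := coord_le_enorm (x - z) i; rewrite !mxE.
Qed.

End euclidean_tools.

Notation "'[?' b ]" := ((nat_of_bool b%R)%:R) (at level 0, b at level 200, format "[? b ]").

Ltac nng1 := first
  [ match goal with
    | |- is_true (_ <= powR _ _) => exact: powR_ge0
    | |- is_true (_ <= enorm _) => exact: enorm_ge0
    end
  | done | exact: powR_ge0 | exact: enorm_ge0 | exact: normr_ge0 | exact: ler0n
  | match goal with
    | |- is_true (_ <= GRing.exp _ _) => apply: exprn_ge0
    | |- is_true (_ <= GRing.mul _ _) => apply: mulr_ge0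
    | |- is_true (_ <= GRing.inv _) => rewrite invr_ge0
    | |- is_true (_ <= (_ + _)%R) => apply: addr_ge0
    end
  | apply: mulr_ge0 ].
Ltac nng := intros; rewrite ?lee_fin; repeat nng1.

(** Domains of integration become indicator factors, the form in which translations and Tonelli
    apply. *)
Lemma integral_memE d (T : measurableType d) (R : realType) (m : {measure set T -> \bar R})
    (D : set T) (f : T -> R) :
  (\int[m]_(x in D) (f x)%:E = \int[m]_x ((x \in D)%:R * f x)%:E)%E.
Proof.
rewrite integral_mkcond; apply: eq_integral => x _; rewrite patchE.
by case: ifPn; rewrite ?mul1r ?mul0r.
Qed.

(** * Integrals of radial powers *)

Section radial.
Context {R : realType} {n : nat}.
Implicit Types (z : 'rV[R]_n) (b r : R).
Local Notation lb := (@lebesgue_measure R).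
Local Notation leb := (@lebesgue_rV R n).

Lemma lebesgue_rV_ball_le z h : 0 < h ->
  (\int[leb]_x ([?enorm (x - z) <= h])%:E <= ((4 * h) ^+ n)%:E)%E.
Proof.
move=> h0; have h2 : 0 < 2 * h by rewrite mulr_gt0.
apply: (@le_trans _ _ (leb (eball z (2 * h)))); last first.
  apply: le_trans (lebesgue_rV_eball_le z h2) _.
  by rewrite mulrA -natrM.
have -> : leb (eball z (2 * h)) = (\int[leb]_x (\1_(eball z (2 * h)) x)%:E)%E.
  by rewrite integral_indic ?setIT//; exact: measurable_eball.
apply: nneg_le_integral => x _; first by rewrite lee_fin.
rewrite lee_fin indicE; case: (leP (enorm (x - z)) h) => // xh.
by rewrite mem_set//= /eball/=; lra.
Qed.

Lemma enorm_le_sum (x : 'rV[R]_n) : enorm x <= \sum_(i < n) `|x ord0 i|.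
Proof.
have S0 : 0 <= \sum_(i < n) `|x ord0 i| by rewrite sumr_ge0.
rewrite -(@ler_pXn2r _ 2)// ?nnegrE ?enorm_ge0// enorm_sqr expr2 mulr_suml.
apply: ler_sum => i _; rewrite -real_normK ?num_real// expr2 ler_wpM2l//.
by rewrite (bigD1 i)//= lerDl sumr_ge0.
Qed.

Lemma lebesgue_rV_eball_ge z r : 0 < r ->
  (((2 * (r / n.+1%:R)) ^+ n)%:E <= leb (eball z r))%E.
Proof.
(* Dividing by [n.+1] instead of [n] makes the sum of the n coordinates strictly smaller than r and
   includes n = 0. *)
move=> r0; have rn : 0 < r / n.+1%:R by rewrite divr_gt0.
rewrite -(lebesgue_rV_cube z rn); apply: le_measure; rewrite ?inE.
- exact: measurable_cube.
- exact: measurable_eball.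
- move=> x H; rewrite /eball/=; apply: le_lt_trans (enorm_le_sum _) _.
  apply: (@le_lt_trans _ _ (\sum_(i < n) (r / n.+1%:R))).
    apply: ler_sum => i _; rewrite !mxE ltW//.
    by have := H i; rewrite -ltr_distl.
  rewrite sumr_const card_ord -[ltRHS](divfK (_ : n.+1%:R != 0))// mulr_natr.
  by rewrite [ltRHS]mulrSr ltrDl.
Qed.

(** A substitute for polar coordinates: f(|x - z|) is dominated by a superposition of indicators of
    balls of radius h with density k, and Tonelli leaves only the volumes of these balls. *)
Lemma radial_layer (D : set (measurableTypeR R)) (k f : R -> R) (c C : R) z :
  measurable D -> (forall h, D h -> 0 < h) ->
  measurable_fun setT (k : measurableTypeR R -> _) -> (forall h, 0 <= k h) ->
  (forall y, 0 <= f y) -> 0 <= c ->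
  (forall y : R, 0 <= y ->
    ((f y)%:E <= c%:E * \int[lb]_(h in D) ([?y <= h] * k h)%:E)%E) ->
  (\int[lb]_(h in D) (k h * (4 * h) ^+ n)%:E <= C%:E)%E ->
  (\int[leb]_x (f (enorm (x - z)))%:E <= (c * C)%:E)%E.
Proof.
move=> mD D0 mk k0 f0 c0 fk kC.
have mK : measurable_fun setT (fun p : 'rV[R]_n * measurableTypeR R =>
   ((p.2 \in D)%:R * ([?enorm (p.1 - z) <= p.2] * k p.2))%:E).
  by mea.
have K0 (p : 'rV[R]_n * measurableTypeR R) :
    (0 <= ((p.2 \in D)%:R * ([?enorm (p.1 - z) <= p.2] * k p.2))%:E)%E.
  by rewrite lee_fin !mulr_ge0.
apply: (@le_trans _ _ (\int[leb]_x (c%:E * \int[lb]_h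
    ((h \in D)%:R * ([?enorm (x - z) <= h] * k h))%:E))%E).
  apply: nneg_le_integral => x _; first by rewrite lee_fin.
  by rewrite -integral_memE; exact/fk/enorm_ge0.
rewrite ge0_integralZl//; last 2 first.
- exact: (measurable_fun_fubini_tonelli_F _ mK K0).
- by move=> x _; apply: integral_ge0 => h _; exact: (K0 (x, h)).
rewrite EFinM lee_pmul//.
  by apply: integral_ge0 => x _; apply: integral_ge0 => h _; exact: (K0 (x, h)).
rewrite (fubini_tonelli _ mK K0)/=.
apply: le_trans kC; rewrite integral_memE.
apply: nneg_le_integral => h _; first by apply: integral_ge0 => x _; exact: (K0 (x, h)).
have [hD|hD] := boolP (h \in D); last first.
  by rewrite mul0r integral0_eq// => x _; rewrite mul0r.
have h0 : 0 < h by apply: D0; exact/set_mem.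
rewrite mul1r.
under eq_integral do rewrite mul1r mulrC EFinM.
rewrite ge0_integralZl//; last 2 first.
- by mea.
- by rewrite lee_fin.
by rewrite EFinM lee_wpmul2l ?lee_fin//; exact: lebesgue_rV_ball_le.
Qed.

(** A common bound for the constants 4 * 8^n of [radial_near] and 2 * 16^n of [radial_tail]. *)
Definition radialC : R := 4 * 16 ^+ n.

Lemma radial_near z r b : 0 < r -> 0 < b -> b < 1 ->
  (\int[leb]_x ([?enorm (x - z) <= r] * enorm (x - z) `^ (b - n%:R))%:E
   <= (radialC * (r `^ b / b))%:E)%E.
Proof.
move=> r0 b0 b1.
(* The upper end 2r leaves room for the dyadic interval [y, 2y] of every y <= r. *)
pose D : set (measurableTypeR R) := `]0, (2 * r)]%classic.
apply: (@le_trans _ _ ((2 ^+ n.+1 * (4 ^+ n * ((2 * r) `^ b / b)))%:E)); last first.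
  rewrite lee_fin powRM// ?(ltW r0)//.
  have -> : 2 ^+ n.+1 * (4 ^+ n * (2 `^ b * r `^ b / b)) =
    (2 ^+ n.+1 * 4 ^+ n * 2 `^ b) * (r `^ b / b) by ring.
  rewrite ler_wpM2r ?divr_ge0 ?powR_ge0 ?(ltW b0)//.
  have h2 : 2 `^ b <= (2 : R).
    by rewrite -[leRHS]powRr1//; apply: ler_powR; rewrite ?ler1n// ltW.
  apply: (@le_trans _ _ (2 ^+ n.+1 * 4 ^+ n * 2)).
    by rewrite ler_wpM2l// mulr_ge0// exprn_ge0.
  rewrite /radialC exprS.
  have -> : 2 * 2 ^+ n * 4 ^+ n * 2 = 4 * (8 ^+ n) :> R.
    have -> : (8 : R) = 2 * 4 by ring.
    rewrite exprMn; ring.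
  by rewrite ler_wpM2l// lerXn2r ?nnegrE// ler_nat.
apply: (@radial_layer D (fun h => h `^ (b - n%:R - 1)) (fun y => [?y <= r] * y `^ (b - n%:R))).
- exact: measurable_itv.
- by move=> h; rewrite /D/= in_itv/= => /andP[].
- by mea.
- by move=> h; exact: powR_ge0.
- by move=> y; rewrite mulr_ge0// powR_ge0.
- by rewrite exprn_ge0.
- move=> y y0; have [yr|yr] := leP y r; last first.
    rewrite mul0r mule_ge0// ?lee_fin ?exprn_ge0// integral_ge0// => h _.
    by rewrite lee_fin mulr_ge0// powR_ge0.
  rewrite mul1r; have [->|yn0] := eqVneq y 0.
    (* At the centre the power is 0 provided that the exponent b - n is nonzero; this holds because
       0 < b < 1 is not an integer. *)
    rewrite powR0; last first.
      rewrite subr_eq0; apply/eqP => bn; move: b0 b1; rewrite bn.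
      by rewrite ltr0n ltNge ler1n => ->.
    rewrite mule_ge0// ?lee_fin ?exprn_ge0// integral_ge0// => h _.
    by rewrite lee_fin mulr_ge0// powR_ge0.
  have yp : 0 < y by rewrite lt_neqAle eq_sym yn0.
  apply: (@le_trans _ _ ((2 ^+ n.+1)%:E * (y * (2 * y) `^ (b - n%:R - 1))%:E)%E).
    rewrite -EFinM lee_fin powRM ?(ltW yp)//.
    have -> : 2 ^+ n.+1 * (y * (2 `^ (b - n%:R - 1) * y `^ (b - n%:R - 1))) =
       2 ^+ n.+1 * 2 `^ (b - n%:R - 1) * (y * y `^ (b - n%:R - 1)) by ring.
    rewrite mulr_powR// -powR_mulrn// -powRD_gt0//.
    rewrite (_ : n.+1%:R + _ = b); last by rewrite -natr1; ring.
    rewrite (_ : 1 + _ = b - n%:R); last by ring.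
    rewrite ler_peMl ?powR_ge0// -[leLHS](powRr0 2); apply: ler_powR; rewrite ?ler1n//.
    exact: ltW.
  rewrite lee_wpmul2l ?lee_fin ?exprn_ge0//.
  have pn : b - n%:R - 1 <= 0 by have : 0 <= n%:R :> R by []; lra.
  apply: le_trans (integral_powR_dyadic yp pn) _.
  rewrite integral_memE [in leRHS]integral_memE.
  apply: nneg_le_integral => h _; rewrite ?lee_fin ?mulr_ge0 ?powR_ge0//.
  have [hy|hy] := boolP (h \in `[y, 2 * y]%classic); last first.
    by rewrite mul0r !mulr_ge0 ?powR_ge0.
  move: hy; rewrite inE/= in_itv/= => /andP[h1 h2].
  rewrite h1 mem_set /D/= ?in_itv/= ?mul1r//; apply/andP; split; lra.
- rewrite (_ : \int[lb]_(h in D) _ =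
     \int[lb]_(h in D) ((4 ^+ n)%:E * (h `^ (b - 1))%:E))%E; last first.
    apply: eq_integral => h; rewrite inE /D/= in_itv/= => /andP[h0 _].
    rewrite -EFinM; congr EFin; rewrite exprMn mulrCA; congr (_ * _).
    rewrite -powR_mulrn ?(ltW h0)// -powRD_gt0//.
    congr (_ `^ _); ring.
  rewrite ge0_integralZl//; last 3 first.
  + exact: measurable_itv.
  + by apply/measurable_EFinP/measurable_funTS; exact: measurable_powR.
  + by move=> h _; rewrite lee_fin powR_ge0.
  rewrite EFinM lee_wpmul2l ?lee_fin ?exprn_ge0//.
  by apply: integral_powR_near; rewrite ?mulr_gt0.
Qed.

Lemma radial_tail z r b : 0 < r -> 0 < b -> b <= n%:R ->
  (\int[leb]_x ([?r <= enorm (x - z)] * enorm (x - z) `^ (- b - n%:R))%:E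
   <= (radialC * (r `^ (- b) / b))%:E)%E.
Proof.
move=> r0 b0 bn.
pose D : set (measurableTypeR R) := `[r, +oo[%classic.
apply: (@le_trans _ _ ((2 ^+ n.+1 * 2 ^+ n * (4 ^+ n * (r `^ (- b) / b)))%:E)); last first.
  rewrite lee_fin mulrA ler_wpM2r ?divr_ge0 ?powR_ge0 ?(ltW b0)//.
  rewrite /radialC exprS.
  have -> : 2 * 2 ^+ n * 2 ^+ n * 4 ^+ n = 2 * (16 ^+ n) :> R.
    have -> : (16 : R) = 2 * 2 * 4 by ring.
    rewrite !exprMn; ring.
  by rewrite ler_wpM2r ?exprn_ge0// ler_nat.
apply: (@radial_layer D (fun h => h `^ (- b - n%:R - 1)) (fun y => [?r <= y] * y `^ (- b - n%:R))).
- exact: measurable_itv.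
- by move=> h; rewrite /D/= in_itv/= andbT; exact: lt_le_trans.
- by mea.
- by move=> h; exact: powR_ge0.
- by move=> y; rewrite mulr_ge0// powR_ge0.
- by rewrite mulr_ge0// exprn_ge0.
- move=> y y0; have [ry|yr] := leP r y; last first.
    rewrite mul0r mule_ge0// ?lee_fin ?mulr_ge0 ?exprn_ge0// integral_ge0// => h _.
    by rewrite lee_fin mulr_ge0// powR_ge0.
  rewrite mul1r.
  have yp : 0 < y by exact: lt_le_trans ry.
  apply: (@le_trans _ _ ((2 ^+ n.+1 * 2 ^+ n)%:E * (y * (2 * y) `^ (- b - n%:R - 1))%:E)%E).
    rewrite -EFinM lee_fin powRM ?(ltW yp)//.
    have -> : 2 ^+ n.+1 * 2 ^+ n * (y * (2 `^ (- b - n%:R - 1) * y `^ (- b - n%:R - 1))) =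
       2 ^+ n.+1 * 2 ^+ n * 2 `^ (- b - n%:R - 1) * (y * y `^ (- b - n%:R - 1)) by ring.
    rewrite mulr_powR// -!powR_mulrn// -!powRD_gt0//.
    rewrite (_ : n.+1%:R + _ + _ = n%:R - b); last by rewrite -natr1; ring.
    rewrite (_ : 1 + _ = - b - n%:R); last by ring.
    rewrite ler_peMl ?powR_ge0// -[leLHS](powRr0 2); apply: ler_powR; rewrite ?ler1n//.
    by rewrite subr_ge0.
  rewrite lee_wpmul2l ?lee_fin ?mulr_ge0 ?exprn_ge0//.
  have pn : - b - n%:R - 1 <= 0 by have : 0 <= n%:R :> R by []; lra.
  apply: le_trans (integral_powR_dyadic yp pn) _.
  rewrite integral_memE [in leRHS]integral_memE.
  apply: nneg_le_integral => h _; rewrite ?lee_fin ?mulr_ge0 ?powR_ge0//.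
  have [hy|hy] := boolP (h \in `[y, 2 * y]%classic); last first.
    by rewrite mul0r !mulr_ge0 ?powR_ge0.
  move: hy; rewrite inE/= in_itv/= => /andP[h1 h2].
  by rewrite h1 mem_set /D/= ?in_itv/= ?mul1r// andbT; lra.
- rewrite (_ : \int[lb]_(h in D) _ =
     \int[lb]_(h in D) ((4 ^+ n)%:E * (h `^ (- b - 1))%:E))%E; last first.
    apply: eq_integral => h; rewrite inE /D/= in_itv/= andbT => rh.
    have h0 : 0 < h by exact: lt_le_trans rh.
    rewrite -EFinM; congr EFin; rewrite exprMn mulrCA; congr (_ * _).
    rewrite -powR_mulrn ?(ltW h0)// -powRD_gt0//.
    congr (_ `^ _); ring.
  rewrite ge0_integralZl//; last 3 first.
  + exact: measurable_itv.
  + by apply/measurable_EFinP/measurable_funTS; exact: measurable_powR.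
  + by move=> h _; rewrite lee_fin powR_ge0.
  rewrite EFinM lee_wpmul2l ?lee_fin ?exprn_ge0//.
  exact: integral_powR_tail.
Qed.

End radial.

(** * Geometry of Lipschitz domains *)

Section distance.
Context {R : realType} {n : nat}.
Implicit Types (x y z : 'rV[R]_n) (A Omega : set 'rV[R]_n).

Lemma dist_set_le A x a : A a -> dist_set A x <= enorm (x - a).
Proof.
move=> Aa; apply: ge_inf; last by exists a.
by exists 0 => _ [y _ <-]; exact: enorm_ge0.
Qed.

Lemma dist_set_ltP A x h : A !=set0 -> dist_set A x < h -> exists2 a, A a & enorm (x - a) < h.
Proof.
move=> [a Aa] xh.
have [] := @inf_lt _ [set enorm (x - y) | y in A] h.
- by exists (enorm (x - a)); exists a.
- exact: xh.
by move=> _ [b Ab <-]; exists b.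
Qed.

Lemma dist_set_ge A x h : A !=set0 -> (forall a, A a -> h <= enorm (x - a)) -> h <= dist_set A x.
Proof.
move=> [a Aa] H; apply: lb_le_inf; first by exists (enorm (x - a)); exists a.
by move=> _ [b Ab <-]; exact: H.
Qed.

Lemma nbhs_eball x r : 0 < r -> nbhs x (eball x r).
Proof.
move=> r0; have rn : 0 < r / n.+1%:R by rewrite divr_gt0.
apply: filterS (nbhsx_ballx x _ rn) => y [_ xy]; rewrite /eball/=.
apply: le_lt_trans (enorm_le_sum _) _.
apply: (@le_lt_trans _ _ (\sum_(i < n) (r / n.+1%:R))).
  apply: ler_sum => i _; rewrite !mxE ltW//.
  by rewrite distrC; exact: xy.
rewrite sumr_const card_ord -[ltRHS](divfK (_ : n.+1%:R != 0))// mulr_natr.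
by rewrite [ltRHS]mulrSr ltrDl.
Qed.

Lemma open_eball Omega x : open Omega -> Omega x -> exists2 r, 0 < r & eball x r `<=` Omega.
Proof.
move=> oO Ox; have /nbhs_ballP[r/= r0 rO] : nbhs x Omega by exact: open_nbhs_nbhs.
exists r => // y xy; apply: rO; split => // i j; rewrite (ord1 i).
rewrite /ball/= distrC; apply: le_lt_trans xy.
by have := coord_le_enorm (y - x) j; rewrite !mxE.
Qed.

Lemma boundary_openP Omega z : open Omega ->
  boundary Omega z <-> ~ Omega z /\ forall r, 0 < r -> exists2 a, Omega a & enorm (a - z) < r.
Proof.
move=> oO; rewrite /boundary (_ : interior Omega = Omega); last first.
  exact/interior_id.
split=> [[cz Oz]|[Oz H]]; split => //.
  move=> r r0; have [a [Oa za]] := cz _ (nbhs_eball z r0).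
  by exists a.
move=> B /nbhs_ballP[r/= r0 rB]; have [a Oa az] := H _ r0.
exists a; split => //; apply: rB; split => // i j; rewrite (ord1 i).
rewrite /ball/= distrC; apply: le_lt_trans az.
by have := coord_le_enorm (a - z) j; rewrite !mxE.
Qed.

(** The infimum of the parameters outside Omega works: openness puts its point outside Omega, while
    all earlier points lie in Omega and come arbitrarily close to it. *)
Lemma segment_boundary Omega x y : open Omega -> Omega x -> ~ Omega y ->
  exists2 t, 0 <= t <= 1 & boundary Omega (x + t *: (y - x)).
Proof.
move=> oO Ox Oy.
pose S := [set t : R | 0 <= t <= 1 /\ ~ Omega (x + t *: (y - x))].
have S1 : S 1 by split; [rewrite ler01 lexx|rewrite scale1r addrC subrK].
have lbS : has_lbound S by exists 0 => t [/andP[]].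
have hS : has_inf S by split => //; exists 1.
pose t := inf S.
have t0 : 0 <= t by apply: lb_le_inf; [exists 1|move=> u [/andP[]]].
have t1 : t <= 1 by apply: ge_inf.
exists t; first by rewrite t0.
have below u : 0 <= u -> u < t -> Omega (x + u *: (y - x)).
  move=> u0 ut; apply: contrapT => H; suff : t <= u by rewrite leNgt ut.
  by apply: ge_inf => //; split => //; rewrite u0/=; exact: (ltW (lt_le_trans ut t1)).
(* The summand 1 makes v a positive divisor without separating x from y first. *)
pose v := enorm (y - x) + 1.
have v0 : 0 < v by rewrite ltr_wpDl// enorm_ge0.
have dE a b : enorm ((x + a *: (y - x)) - (x + b *: (y - x))) <= `|a - b| * v.
  rewrite opprD addrACA subrr add0r -scalerBl enormZ ler_wpM2l// lerDl//.
apply/boundary_openP => //; split.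
  move=> Ot; have [r r0 rO] := open_eball oO Ot.
  have rv : 0 < r / v by rewrite divr_gt0.
  have [u Su ut] := inf_adherent rv hS.
  have tu : t <= u by apply: ge_inf.
  case: Su => _; apply; apply: rO; rewrite /eball/=.
  apply: le_lt_trans (dE u t) _; rewrite -ltr_pdivlMr//.
  by rewrite ger0_norm ?subr_ge0// ltrBlDl.
move=> r r0.
have [tz|tz] := eqVneq t 0.
  by exists x => //; rewrite tz scale0r addr0 subrr enorm0.
have tp : 0 < t by rewrite lt_neqAle eq_sym tz.
have rv : 0 < r / v by rewrite divr_gt0.
pose u := Num.max 0 (t - r / v / 2).
have u0 : 0 <= u by rewrite le_max lexx.
have ut : u < t by rewrite gt_max tp/= gtrBl divr_gt0.
exists (x + u *: (y - x)); first exact: below.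
apply: le_lt_trans (dE u t) _; rewrite -ltr_pdivlMr//.
rewrite ltr0_norm ?subr_lt0// opprB ltrBlDr -ltrBlDl.
have : t - r / v / 2 <= u by rewrite le_max lexx orbT.
apply: lt_le_trans; rewrite ltrD2l ltrN2; rewrite ltr_pdivrMr// ltr_pMr// ltr1n//.
Qed.

Lemma crossing Omega x y : open Omega -> Omega x -> ~ Omega y ->
  exists p, [/\ boundary Omega p, enorm (x - p) <= enorm (x - y) & enorm (y - p) <= enorm (x - y)].
Proof.
move=> oO Ox Oy; have [t /andP[t0 t1] bt] := segment_boundary oO Ox Oy.
exists (x + t *: (y - x)); split => //.
  rewrite opprD addrA subrr add0r enormN enormZ ger0_norm// enormB.
  by rewrite ler_piMl// enorm_ge0.
rewrite (_ : y - _ = (1 - t) *: (y - x)); last first.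
  by rewrite scalerBl scale1r opprD addrA.
rewrite enormZ ger0_norm ?subr_ge0// enormB ler_piMl ?enorm_ge0//.
by rewrite gerBl.
Qed.

Lemma measurable_boundary (Omega : set 'rV[R]_n) : measurable (boundary Omega).
Proof.
rewrite /boundary; apply: measurableD.
  by rewrite -[closure _]setCK; apply: measurableC; apply: open_measurable_rV; apply: closed_openC; exact: closed_closure.
by apply: open_measurable_rV; exact: open_interior.
Qed.

Lemma dist_boundary_in_le Omega x y : open Omega -> Omega x -> ~ Omega y ->
  dist_boundary Omega x <= enorm (x - y).
Proof.
move=> oO Ox Oy; have [p [bp xp _]] := crossing oO Ox Oy.
by apply: le_trans xp; exact: dist_set_le.
Qed.

Lemma dist_boundary_out_le Omega x y : open Omega -> Omega x -> ~ Omega y ->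
  dist_boundary Omega y <= enorm (x - y).
Proof.
move=> oO Ox Oy; have [p [bp _ yp]] := crossing oO Ox Oy.
by apply: le_trans yp; exact: dist_set_le.
Qed.

Lemma dist_boundary_gt0 Omega x : open Omega -> boundary Omega !=set0 -> Omega x ->
  0 < dist_boundary Omega x.
Proof.
move=> oO b0 Ox; have [r r0 rO] := open_eball oO Ox.
apply: lt_le_trans r0 _; apply: dist_set_ge => // a /(boundary_openP _ oO)[Oa _].
by rewrite leNgt; apply/negP => ar; apply: Oa; apply: rO; rewrite /eball/= enormB.
Qed.

Lemma dist_boundary_out_ge Omega q r : open Omega -> boundary Omega !=set0 ->
  (forall y, enorm (y - q) < r -> ~ Omega y) -> r <= dist_boundary Omega q.
Proof.
move=> oO b0 H; apply: dist_set_ge => // a /(boundary_openP _ oO)[_ Ha].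
rewrite leNgt; apply/negP => qa.
have e0 : 0 < r - enorm (q - a) by rewrite subr_gt0.
have [b Ob ba] := Ha _ e0; apply: (H b) => //.
by apply: le_lt_trans (ler_enorm_dist _ a _) _; rewrite (enormB a); lra.
Qed.

Lemma bounded_enorm A : bounded_set A ->
  exists2 D : R, 0 < D & forall x, A x -> enorm x <= D.
Proof.
move=> /ex_strict_bound_gt0[M M0 AM]; exists (n.+1%:R * M); first by rewrite mulr_gt0.
move=> x Ax; apply: le_trans (enorm_le_sum _) _.
apply: (@le_trans _ _ (\sum_(i < n) M)).
  apply: ler_sum => i _; apply: le_trans (ltW (AM _ Ax)).
  have /mapP[j Hj ->] : `|x ord0 i| \in [seq `|x k.1 k.2| | k : 'I_1 * 'I_n].
    by apply/mapP; exists (ord0, i) => //=; rewrite mem_enum.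
  by rewrite [leRHS]/Num.norm /= mx_normrE; apply/bigmax_geP; right => /=; exists j.
by rewrite sumr_const card_ord -[leLHS]mulr_natl ler_wpM2r ?(ltW M0)// ler_nat.
Qed.

Lemma boundary_diam Omega : open Omega -> bounded_set Omega ->
  exists2 D : R, 0 < D & forall x y, (Omega x \/ boundary Omega x) ->
    (Omega y \/ boundary Omega y) -> enorm (x - y) <= D.
Proof.
move=> oO /bounded_enorm[D D0 HD].
have H x : (Omega x \/ boundary Omega x) -> enorm x <= D + 1.
  case=> [/HD|/(boundary_openP _ oO)[_ /(_ _ ltr01)[a /HD Oa ax]]]; first lra.
  rewrite -[x](subrK a); apply: le_trans (ler_enormD _ _) _.
  by rewrite enormB; lra.
exists (2 * (D + 1)); first lra.
by move=> x y /H xD /H yD; apply: le_trans (ler_enormD _ _) _; rewrite enormN; lra.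
Qed.

(** Compactness of the boundary, for which Omega has to be bounded. Each of the finitely many
    centres brings its own cone direction. *)
Lemma boundary_cover Omega r : open Omega -> bounded_set Omega -> 0 < r ->
  exists2 zs : seq 'rV[R]_n, (forall z, z \in zs -> boundary Omega z) &
    forall z, boundary Omega z -> exists2 c, c \in zs & enorm (z - c) < r.
Proof.
move=> oO bO r0.
have cb : compact (boundary Omega).
  apply: bounded_closed_compact.
    have [D D0 HD] := boundary_diam oO bO.
    case: (pselect (boundary Omega !=set0)) => [[z bz]|b0]; last first.
      exists 0; split => // M _ x bx; exfalso; apply: b0; by exists x.
    exists (D + enorm z); split; first exact: num_real.
    move=> M DM x bx /=; apply: le_trans (ltW DM).
    have : enorm x <= D + enorm z.
      rewrite -[x in enorm x](subrK z); apply: le_trans (ler_enormD _ _) _.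
      by rewrite lerD2r; apply: HD; right.
    apply: le_trans; rewrite [leLHS]/Num.norm /= mx_normrE; apply: bigmax_le; first exact: enorm_ge0.
    by move=> [i j] _ /=; rewrite (ord1 i); exact: coord_le_enorm.
  by rewrite /boundary setDE; apply: closedI; [exact: closed_closure|apply: open_closedC; exact: open_interior].
move: cb; rewrite compact_cover => /(_ _ (boundary Omega) (fun z => interior (eball z r))).
case=> [z _|z bz|D' D'b cov].
- exact: open_interior.
- by exists z => //; exact: nbhs_eball.
exists (finmap.enum_fset D'); first by move=> z /D'b /set_mem.
by move=> z /cov [c /= cD /interior_subset zc]; exists c.
Qed.

End distance.

(** * The cone property *)

Section cone.
Context {R : realType}.

(** One direction e serves all points of Omega within rho of z. The truncated cone is the union over
    t of the balls of radius kappa t around t e. *)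
Definition cone_at n (Omega : set 'rV[R]_n) rho kappa (z e : 'rV[R]_n) :=
  enorm e <= 1 /\
  forall p w t, Omega p -> enorm (p - z) < rho -> 0 < t < rho ->
    enorm (w - t *: e) < kappa * t -> Omega (p + w).

Lemma enorm_orthogonal n (Q : 'M[R]_n) (x : 'rV[R]_n) : Q *m Q^T = 1%:M ->
  enorm (x *m Q) = enorm x.
Proof.
move=> QQ; congr Num.sqrt.
have E (y : 'rV[R]_n) : \sum_(i < n) y ord0 i ^+ 2 = (y *m y^T) ord0 ord0.
  by rewrite mxE; apply: eq_bigr => i _; rewrite mxE expr2.
by rewrite !E trmx_mul mulmxA -(mulmxA x) QQ mulmx1.
Qed.

Lemma enorm_rV_init n (y : 'rV[R]_n.+1) : enorm (rV_init y) <= enorm y.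
Proof.
rewrite ler_wsqrtr// [leRHS]big_ord_recr/= -[leLHS]addr0 lerD ?sqr_ge0//.
apply: ler_sum => i _; rewrite mxE le_eqVlt; apply/orP; left; apply/eqP.
by congr (y _ _ ^+ 2); exact: val_inj.
Qed.

(** In graph coordinates, a move by t along the downward axis with an error v, |v| < k t, changes
    the last coordinate by v_d - t and the graph by at most L |v|. The point stays below the graph
    as soon as (1 + L) k t <= t. *)
Lemma lipschitz_cone n (Omega : set 'rV[R]_n.+1) : lipschitz_domain Omega ->
  exists rho kappa : R, [/\ 0 < rho, 0 < kappa < 1 &
    forall z, boundary Omega z -> exists e, cone_at Omega rho kappa z e].
Proof.
move=> [oO [b0 [r [L [r0 L0 H]]]]].
have L1 : 0 < 1 + L by lra.
(* With k = 1/(1 + L) the two effects balance exactly. The radius r/4 keeps p + w in the ball of the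
   graph description, since |w| <= (1 + k) t < r/2. *)
exists (r / 4), (1 + L)^-1; split; first by rewrite divr_gt0.
  by rewrite invr_gt0 L1/= invf_lt1//; lra.
move=> z /H[Q [c [phi [QQ Tz lphi Tim]]]].
have QQ' : Q^T *m Q = 1%:M by exact: mulmx1C.
pose el : 'rV[R]_n.+1 := delta_mx ord0 ord_max.
pose e := (- el) *m Q^T.
have eQ : e *m Q = - el by rewrite /e -mulmxA QQ' mulmx1.
have el1 : enorm el = 1.
  rewrite /enorm (bigD1 ord_max)//= big1.
    by rewrite mxE !eqxx expr1n addr0 sqrtr1.
  by move=> i /negbTE ni; rewrite mxE eqxx ni expr0n.
have QinjT x : enorm (x *m Q + c) = enorm (x - z).
  rewrite -(enorm_orthogonal (x - z) QQ) mulmxBl; congr enorm; congr (_ + _).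
  by apply/eqP; rewrite -subr_eq0 opprK addrC Tz.
exists e; split; first by rewrite -(enorm_orthogonal _ QQ) eQ enormN el1.
move=> p w t Op pz /andP[t0 tr] wt.
set k := (1 + L)^-1 in wt *.
have k0 : 0 < k by rewrite invr_gt0.
have k1 : k * (1 + L) = 1 by rewrite mulVf// gt_eqF.
have w2 : enorm w <= (1 + k) * t.
  rewrite -[w in enorm w](subrK (t *: e)); apply: le_trans (ler_enormD _ _) _.
  rewrite enormZ gtr0_norm// -(enorm_orthogonal e QQ) eQ enormN el1 mulr1.
  by rewrite mulrDl mul1r addrC lerD2l ltW.
have pwz : enorm (p + w - z) < r.
  rewrite addrAC; apply: le_lt_trans (ler_enormD _ _) _.
  have : k <= 1 by nra.
  by nra.
have : [set y | eball 0 r y /\ phi (rV_init y) > y ord0 ord_max] (p *m Q + c).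
  rewrite -Tim; exists p => //; split => //.
  by rewrite /eball/=; lra.
move=> [_ pphi].
have : [set y | eball 0 r y /\ phi (rV_init y) > y ord0 ord_max] ((p + w) *m Q + c).
  split; first by rewrite /eball/= subr0 QinjT.
  have aE : w *m Q = (w - t *: e) *m Q - t *: el.
    by rewrite mulmxBl -scalemxAl eQ scalerN opprK addrK.
  set y := p *m Q + c in pphi *.
  have -> : (p + w) *m Q + c = y + w *m Q by rewrite mulmxDl addrAC.
  set v := (w - t *: e) *m Q in aE.
  have vt : enorm v < k * t by rewrite enorm_orthogonal.
  have lst : (y + w *m Q) ord0 ord_max = y ord0 ord_max + v ord0 ord_max - t.
    by rewrite aE !mxE !eqxx mulr1 addrA.
  have ini : enorm (rV_init y - rV_init (y + w *m Q)) <= enorm v.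
    rewrite enormB; apply: le_trans (enorm_rV_init v).
    rewrite le_eqVlt; apply/orP; left; apply/eqP; congr enorm; apply/rowP => i.
    rewrite aE !mxE; have -> : (widen_ord (leqnSn n) i == ord_max) = false.
      by apply/negbTE; rewrite -val_eqE/= ltn_eqF.
    by rewrite mulr0; ring.
  rewrite lst.
  have := lphi (rV_init y) (rV_init (y + w *m Q)).
  have vo : v ord0 ord_max <= enorm v.
    by apply: le_trans (ler_norm _) (coord_le_enorm _ _).
  rewrite ler_distl => /andP[_ h2].
  have h3 : L * enorm (rV_init y - rV_init (y + w *m Q)) <= L * enorm v by rewrite ler_pM2l.
  have h4 : L * enorm v <= L * (k * t) by rewrite ler_pM2l// ltW.
  have h5 : L * (k * t) + k * t = t.
    by rewrite -[RHS]mul1r -k1; ring.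
  by rewrite /= in pphi *; lra.
(* The graph description yields a point q of Omega with the same image as p + w, and the orthogonal
   matrix Q is invertible. *)
rewrite -Tim => -[q [Oq _] /addIr qE].
by rewrite -[p + w]mulmx1 -QQ mulmxA -qE -mulmxA QQ mulmx1.
Qed.

(** If p - w were in Omega, the inner cone at p - w would put p into Omega. Hence the complement has
    the opposite cone, on smaller radii that keep p - w within rho of z. *)
Lemma cone_exterior n (Omega : set 'rV[R]_n) rho kappa z e p w t :
  kappa <= 1 -> cone_at Omega rho kappa z e ->
  ~ Omega p -> enorm (p - z) < rho / 2 -> 0 < t < rho / 4 ->
  enorm (w - t *: e) < kappa * t -> ~ Omega (p - w).
Proof.
move=> k1 [e1 H] Op pz /andP[t0 tr] wt Opw; apply: Op.
rewrite -(subrK w p); apply: (H _ _ t) => //; last by lra.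
have w2 : enorm w <= (1 + kappa) * t.
  rewrite -[w in enorm w](subrK (t *: e)); apply: le_trans (ler_enormD _ _) _.
  have : `|t| * enorm e <= t by rewrite gtr0_norm// ger_pMr.
  by rewrite enormZ; lra.
rewrite addrAC; apply: le_lt_trans (ler_enormD _ _) _; rewrite enormN.
by nra.
Qed.

End cone.

Lemma sum_bool_le1 (R : numDomainType) (K : nat) (b : nat -> bool) :
  (forall i j, (i < j < K)%N -> b i -> ~~ b j) -> \sum_(i < K) [?b i] <= 1 :> R.
Proof.
elim: K => [|K IH] H; first by rewrite big_ord0.
rewrite big_ord_recr/=; case bK: (b K); last first.
  by rewrite addr0; apply: IH => i j /andP[ij jK]; apply: H; rewrite ij ltnW.
rewrite big1 ?add0r// => i _.
case bi: (b i) => //; have := H i K; rewrite ltn_ord ltnSn bi bK => /(_ isT isT).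
by [].
Qed.

(** * The trace inequality *)

Section strip.
Context {R : realType} {n : nat}.
Variables (Omega : set 'rV[R]_n.+1).
Hypotheses (oO : open Omega) (b0 : boundary Omega !=set0).
Variables (rho kappa N : R) (z e : 'rV[R]_n.+1).
Hypotheses (rho0 : 0 < rho) (N4 : 4 < N) (kappaN : kappa * N = 4).
Hypothesis cone : cone_at Omega rho kappa z e.
Local Notation leb := (@lebesgue_rV R n.+1).
Local Notation d_ := (dist_boundary Omega).

Definition strip (h : R) (y : 'rV[R]_n.+1) : bool :=
  (y \notin Omega) && (enorm (y - z) < rho / 2) && (d_ y <= h).

Let mO : measurable Omega. Proof. exact: open_measurable_rV. Qed.

Let Np : 0 < N. Proof. exact: lt_trans N4. Qed.

(** The strip point y is replaced by a point p of Omega at distance less than 2h. After k shifts the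
    error is below 2h + k h, while the cone has radius kappa k h N = 4 k h there: this is the reason
    for kappa N = 4. *)
Lemma strip_shift (h : R) (w : 'rV[R]_n.+1) k y : 0 < h -> (0 < k)%N -> k%:R * h * N < rho ->
  enorm (w - (h * N) *: e) < h -> strip h y -> Omega (y + k%:R *: w).
Proof.
move=> h0 k0 kh we /andP[/andP[yO yz] yh].
have kp : 1 <= k%:R :> R by rewrite ler1n.
have hN : h * N < rho.
  by apply: le_lt_trans kh; rewrite -mulrA ler_peMl// mulr_ge0 ?ltW.
have h4 : 4 * h < rho.
  by apply: lt_trans hN; rewrite mulrC ltr_pM2l.
have [q bq yq] : exists2 q, boundary Omega q & enorm (y - q) < 2 * h.
  by apply: dist_set_ltP => //; apply: le_lt_trans yh _; lra.
have e0 : 0 < 2 * h - enorm (y - q) by rewrite subr_gt0.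
have [p Op pq] := ((boundary_openP _ oO).1 bq).2 _ e0.
have yp : enorm (y - p) < 2 * h.
  by apply: le_lt_trans (ler_enorm_dist _ q _) _; rewrite (enormB q); lra.
move: cone => [_ C].
have := C p (y - p + k%:R *: w) (k%:R * h * N) Op.
rewrite addrCA addrA addrC subrK addrC; apply => //.
- apply: le_lt_trans (ler_enorm_dist _ y _) _; rewrite enormB; lra.
- by rewrite kh andbT !mulr_gt0//; lra.
rewrite -addrA; apply: le_lt_trans (ler_enormD _ _) _.
rewrite -mulrA -scalerA -scalerBr enormZ ger0_norm; last lra.
have -> : kappa * (k%:R * (h * N)) = 4 * (k%:R * h) by rewrite -kappaN; ring.
have : k%:R * enorm (w - (h * N) *: e) <= k%:R * h by rewrite ler_pM2l ?ltW//; lra.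
have : h <= k%:R * h by rewrite ler_peMl// ltW.
lra.
Qed.

(* At most one of the translates of the strip contains a given point, and all of
   them lie in Omega. *)
Lemma strip_shift_sum (h : R) (w : 'rV[R]_n.+1) K (f : 'rV[R]_n.+1 -> R) : 0 < h -> K%:R * h * N < rho ->
  enorm (w - (h * N) *: e) < h -> measurable_fun setT f -> (forall x, 0 <= f x) ->
  (\int[leb]_y (\sum_(i < K) [?strip h y] * f (y + i.+1%:R *: w))%:E <=
   \int[leb]_x ([?x \in Omega] * f x)%:E)%E.
Proof.
move=> h0 Kh we mf f0.
under eq_integral do rewrite -sumEFin.
rewrite ge0_integral_sum//; last 2 first.
- by move=> i; rewrite /strip; mea.
- by move=> i x _; rewrite lee_fin mulr_ge0.
under eq_bigr => i _.
  rewrite (_ : \int[leb]_y _ = \int[leb]_x ([?strip h (x - i.+1%:R *: w)] * f x)%:E)%E.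
  over.
  rewrite -[RHS](integral_lebesgue_rV_shift (i.+1%:R *: w)); last 2 first.
  - by rewrite /strip; mea.
  - by move=> x; rewrite lee_fin mulr_ge0.
  by apply: eq_integral => x _; rewrite addrAC subrr add0r (addrC x).
rewrite -ge0_integral_sum//; last 2 first.
- by move=> i; rewrite /strip; mea.
- by move=> i x _; rewrite lee_fin mulr_ge0.
apply: nneg_le_integral => x _.
  by apply: sume_ge0 => i _; rewrite lee_fin mulr_ge0.
rewrite sumEFin lee_fin -mulr_suml ler_wpM2r//.
(* If x belongs to the translate of index j, then x - (i+1) w arises from a strip point by j - i
   shifts. So it lies in Omega and cannot be a strip point itself. *)
have shiftO i j : (i < j < K)%N -> strip h (x - j.+1%:R *: w) -> Omega (x - i.+1%:R *: w).
  move=> /andP[ij jK] /(@strip_shift h w (j - i)%N) H.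
  have := H h0; rewrite subn_gt0 ij => /(_ isT).
  rewrite (_ : x - j.+1%:R *: w + _ = x - i.+1%:R *: w); first apply => //.
    apply: le_lt_trans Kh; rewrite -!mulrA ler_wpM2r ?mulr_ge0 ?(ltW h0)//.
      by rewrite ltW.
    by rewrite ler_nat (leq_trans (leq_subr _ _)) 1?ltnW.
  rewrite natrB ?(ltnW ij)// -addrA -!scaleNr -scalerDl.
  by congr (_ + _ *: _); rewrite -!natr1; ring.
have [xO|xO] := boolP (x \in Omega); last first.
  rewrite big1// => i _; case si: (strip _ _) => //; exfalso.
  move/negP: xO; apply; apply/mem_set.
  have := strip_shift (k := i.+1) h0 _ _ we si; rewrite subrK; apply => //.
  apply: le_lt_trans Kh; rewrite -!mulrA ler_wpM2r ?mulr_ge0 ?(ltW h0)//.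
    by rewrite ltW.
  by rewrite ler_nat.
apply: (@sum_bool_le1 _ K (fun i => strip h (x - i.+1%:R *: w))) => i j ijK si.
apply/negP => /(shiftO _ _ ijK) Oi.
by move: si => /andP[/andP[/negP]]; rewrite inE.
Qed.

(** |u y| is compared with each of the K values |u(y + k w)| by telescoping, and the K inequalities
    are added. The translates being disjoint, the values of u cost the L^1 norm only once, against K
    copies of the strip integral. *)
Lemma strip_mass_K (h : R) (w : 'rV[R]_n.+1) K (u : 'rV[R]_n.+1 -> R) : 0 < h -> K%:R * h * N < rho ->
  enorm (w - (h * N) *: e) < h -> measurable_fun setT u ->
  (K%:R%:E * \int[leb]_y ([?strip h y] * `|u y|)%:E <=
   \int[leb]_x ([?x \in Omega] * `|u x|)%:E +
   K%:R%:E * \int[leb]_x ([?x \in Omega] * `|u x - u (x - w)|)%:E)%E.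
Proof.
move=> h0 Kh we mu.
pose f1 x := `|u x|; pose f2 x := `|u x - u (x - w)|.
have mf1 : measurable_fun setT f1 by rewrite /f1; mea.
have mf2 : measurable_fun setT f2 by rewrite /f2; mea.
rewrite -ge0_integralZl//; last by rewrite /strip; mea.
apply: (@le_trans _ _ (\int[leb]_y ((\sum_(i < K) [?strip h y] * f1 (y + i.+1%:R *: w))%:E
   + K%:R%:E * (\sum_(i < K) [?strip h y] * f2 (y + i.+1%:R *: w))%:E))%E).
  apply: nneg_le_integral => y _; first by rewrite -EFinM lee_fin !mulr_ge0.
  rewrite -!EFinM -EFinD lee_fin.
  case: (strip h y); last by rewrite !mul0r mulr0 !big1 ?mulr0 ?addr0// => i _; rewrite mul0r.
  under eq_bigr do rewrite mul1r; under [in X in _ + X]eq_bigr do rewrite mul1r.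
  rewrite mul1r.
  (* All K increments are kept whatever k is; adding over k then produces the factor K before the
     difference term. *)
  have key k : (k <= K)%N -> `|u y| <= `|u (y + k%:R *: w)| + \sum_(i < K) f2 (y + i.+1%:R *: w).
    move=> kK; have : `|u y| <= `|u (y + k%:R *: w)| + \sum_(i < k) f2 (y + i.+1%:R *: w).
      elim: k {kK} => [|k IH]; first by rewrite scale0r addr0 big_ord0 addr0.
      rewrite big_ord_recr/= addrA; apply: le_trans IH _.
      rewrite addrAC lerD2r.
      rewrite /f2 (_ : y + k.+1%:R *: w - w = y + k%:R *: w); last first.
        by rewrite -addrA -{2}(scale1r w) -scalerBl -natr1 addrK.
      rewrite -{1}[u (y + k%:R *: w)](subrK (u (y + k.+1%:R *: w))) addrC.
      by apply: le_trans (ler_normD _ _) _; rewrite (distrC (u (y + k%:R *: w))).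
    move=> H; apply: le_trans H _; rewrite lerD2l.
    rewrite (big_ord_widen K (fun i => f2 (y + i.+1%:R *: w)) kK) big_mkcond/=.
    by apply: ler_sum => i _; case: ifP => // _; rewrite /f2.
  rewrite [leLHS](_ : _ = \sum_(i < K) `|u y|); last by rewrite sumr_const card_ord mulr_natl.
  rewrite [X in _ <= _ + X](_ : _ = \sum_(j < K) \sum_(i < K) f2 (y + i.+1%:R *: w)); last first.
    by rewrite sumr_const card_ord mulr_natl.
  by rewrite -big_split/=; apply: ler_sum => i _; exact: key.
rewrite ge0_integralD//; last 4 first.
- by move=> y _; rewrite lee_fin sumr_ge0// => i _; rewrite mulr_ge0 ?/f1.
- apply/measurable_EFinP; apply: measurable_sum => i; rewrite /strip; mea.
- by move=> y _; rewrite -EFinM lee_fin mulr_ge0// sumr_ge0// => i _; rewrite mulr_ge0 ?/f2.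
- under eq_fun do rewrite -EFinM.
  apply/measurable_EFinP; apply: measurable_funM => //.
  by apply: measurable_sum => i; rewrite /strip; mea.
rewrite ge0_integralZl//; last 2 first.
- by apply/measurable_EFinP; apply: measurable_sum => i; rewrite /strip; mea.
- by move=> y _; rewrite lee_fin sumr_ge0// => i _; rewrite mulr_ge0 ?/f2.
apply: leeD.
  by apply: strip_shift_sum => // x; rewrite /f1.
apply: lee_wpmul2l; first by rewrite lee_fin.
by apply: strip_shift_sum => // x; rewrite /f2.
Qed.

Lemma strip_mass (h : R) (w : 'rV[R]_n.+1) (u : 'rV[R]_n.+1 -> R) : 0 < h -> 2 * h * N <= rho ->
  enorm (w - (h * N) *: e) < h -> measurable_fun setT u ->
  (\int[leb]_y ([?strip h y] * `|u y|)%:E <=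
   (4 * N / rho * h)%:E * \int[leb]_x ([?x \in Omega] * `|u x|)%:E +
   \int[leb]_x ([?x \in Omega] * `|u x - u (x - w)|)%:E)%E.
Proof.
move=> h0 hN we mu.
have hNp : 0 < h * N by rewrite mulr_gt0.
(* The integer part K of t satisfies K h N <= rho/2, as the shifts require. Since t >= 1, also K >=
   t/2, that is 1/K <= 4 N h / rho. *)
pose t := rho / (2 * h * N).
have t1 : 1 <= t by rewrite ler_pdivlMr ?mul1r// !mulr_gt0.
pose K := Num.truncn t.
have Kt : K%:R <= t by rewrite Num.Theory.truncn_le; lra.
have tK : t < K.+1%:R by exact: truncnS_gt.
have K1 : (0 < K)%N by rewrite Num.Theory.truncn_gt0.
have K1' : 1 <= K%:R :> R by rewrite ler1n.
have Kh : K%:R * h * N < rho.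
  have : K%:R * (2 * h * N) <= rho by rewrite -ler_pdivlMr ?mulr_gt0.
  have : 0 < K%:R * (h * N) by rewrite mulr_gt0// ltr0n.
  lra.
have KI : (K%:R)^-1 <= 4 * N / rho * h.
  rewrite -div1r ler_pdivrMr; last lra.
  have : t <= 2 * K%:R by rewrite -natr1 in tK; lra.
  rewrite ler_pdivrMr ?mulr_gt0// => H.
  by rewrite mulrAC -mulrA mulrAC ler_pdivlMr//; lra.
have := strip_mass_K h0 Kh we mu.
set m := (\int[leb]_y ([?strip h y] * _)%:E)%E; set U := (\int[leb]_x ([?x \in Omega] * `|u x|)%:E)%E.
set W := (\int[leb]_x ([?x \in Omega] * `|u x - u (x - w)|)%:E)%E.
have U0 : (0 <= U)%E by apply: integral_ge0 => x _; rewrite lee_fin mulr_ge0.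
have W0 : (0 <= W)%E by apply: integral_ge0 => x _; rewrite lee_fin mulr_ge0.
move=> H.
have KK : (((K%:R : R)^-1)%:E * K%:R%:E = 1 :> \bar R)%E.
  by rewrite -EFinM mulVf// gt_eqF// ltr0n.
have K0 : (0 <= ((K%:R : R)^-1)%:E)%E by rewrite lee_fin invr_ge0.
have := lee_wpmul2l K0 H.
rewrite muleA KK mul1e ge0_muleDr//; last by rewrite mule_ge0.
rewrite muleA KK mul1e => /le_trans; apply.
by rewrite leeD2r// lee_wpmul2r// lee_fin.
Qed.

End strip.

Section nneg_integrals.
Local Open Scope ereal_scope.
Context d (T : measurableType d) (R : realType).
Variable m : {measure set T -> \bar R}.

Lemma integralZl_EFin (c : R) (f : T -> R) : measurable_fun setT f ->
  (forall x, 0 <= f x)%R -> (0 <= c)%R ->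
  \int[m]_x (c * f x)%:E = c%:E * \int[m]_x (f x)%:E.
Proof.
move=> mf f0 c0; under eq_integral do rewrite EFinM.
rewrite ge0_integralZl//; first exact/measurable_EFinP.
by move=> x _; rewrite lee_fin.
Qed.

(** The inequality is averaged over B. The measure of B cancels in front of a and b and is only
    bounded below, by c, in front of W. *)
Lemma integral_average_le (B : set T) (a b : \bar R) (c : R) (W : T -> \bar R) :
  measurable B -> (0 < c)%R -> c%:E <= m B -> m B < +oo ->
  0 <= a -> 0 <= b -> measurable_fun setT W -> (forall v, 0 <= W v) ->
  (forall v, B v -> a <= b + W v) ->
  a <= b + (c^-1)%:E * \int[m]_(v in B) W v.
Proof.
move=> mB c0 cB Boo a0 b0 mW W0 H.
have mBf : m B \is a fin_num by rewrite ge0_fin_numE.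
have vE : m B = (fine (m B))%:E by rewrite fineK.
set v := fine (m B) in vE.
have cv : (c <= v)%R by rewrite -lee_fin -vE.
have v0 : (0 < v)%R by exact: lt_le_trans cv.
have : \int[m]_(x in B) a <= \int[m]_(x in B) (b + W x).
  by apply: nneg_le_integral.
have acst (k : \bar R) : 0 <= k -> \int[m]_(x in B) k = k * v%:E.
  by move=> k0; rewrite -vE integral_cst.
rewrite ge0_integralD//; last exact: measurable_funTS.
rewrite !acst// => H2.
have vv : v%:E * (v^-1)%:E = 1 :> \bar R by rewrite -EFinM mulfV// gt_eqF.
have I0 : 0 <= \int[m]_(x in B) W x by exact: integral_ge0.
have : a * v%:E * (v^-1)%:E <= (b * v%:E + \int[m]_(x in B) W x) * (v^-1)%:E.
  by apply: lee_wpmul2r => //; rewrite lee_fin invr_ge0 ltW.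
rewrite -muleA vv mule1 ge0_muleDl//; last by rewrite mule_ge0// lee_fin ltW.
rewrite -muleA vv mule1 => /le_trans; apply; apply: leeD2l.
rewrite muleC; apply: lee_wpmul2r => //; rewrite lee_fin lef_pV2//.
Qed.

End nneg_integrals.

Section functionals.
Context {R : realType} {n : nat}.
Variable Omega : set 'rV[R]_n.+1.
Local Notation leb := (@lebesgue_rV R n.+1).

Definition L1in (u : 'rV[R]_n.+1 -> R) : \bar R :=
  (\int[leb]_x ([?x \in Omega] * `|u x|)%:E)%E.

Definition energy (s : R) (u : 'rV[R]_n.+1 -> R) : \bar R :=
  (\int[leb]_x \int[leb]_y
    ([?x \in Omega] * (`|u x - u y| * enorm (x - y) `^ (- (n.+1%:R + s))))%:E)%E.

Lemma L1in_ge0 u : (0 <= L1in u)%E.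
Proof. by apply: integral_ge0 => x _; rewrite lee_fin mulr_ge0. Qed.

Lemma energy_ge0 s u : (0 <= energy s u)%E.
Proof.
apply: integral_ge0 => x _; apply: integral_ge0 => y _.
by rewrite lee_fin !mulr_ge0 ?powR_ge0.
Qed.

End functionals.

(** * The trace estimate close to one boundary point *)

Section trace_near.
Context {R : realType} {n : nat}.
Variables (Omega : set 'rV[R]_n.+1).
Hypotheses (oO : open Omega) (b0 : boundary Omega !=set0).
Variables (rho kappa N : R) (z e : 'rV[R]_n.+1).
Hypotheses (rho0 : 0 < rho) (rho1 : rho <= 1) (N4 : 4 < N) (kappaN : kappa * N = 4).
Hypothesis cone : cone_at Omega rho kappa z e.
Local Notation leb := (@lebesgue_rV R n.+1).
Local Notation lb := (@lebesgue_measure R).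
Local Notation d_ := (dist_boundary Omega).
Local Notation stripz := (strip Omega rho z).
Variable (u : 'rV[R]_n.+1 -> R).
Hypothesis mu : measurable_fun setT u.

Let mO : measurable Omega. Proof. exact: open_measurable_rV. Qed.
Let Np : 0 < N. Proof. exact: lt_trans N4. Qed.
Let h1 : R := rho / (2 * N).
Let h10 : 0 < h1. Proof. by rewrite divr_gt0// mulr_gt0. Qed.
Let h11 : h1 <= 1.
Proof.
rewrite ler_pdivrMr ?mulr_gt0// mul1r; apply: le_trans rho1 _.
by rewrite -[leLHS]mul1r ler_pM// ?ler1n// ltW// (lt_trans _ N4)// ltr1n.
Qed.
Let I1 : set (measurableTypeR R) := `]0, h1]%classic.

Let W (v : 'rV[R]_n.+1) : \bar R := (\int[leb]_x ([?x \in Omega] * `|u x - u (x + v)|)%:E)%E.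

Let mW : measurable_fun setT W.
Proof.
have mF : measurable_fun setT (fun p : 'rV[R]_n.+1 * 'rV[R]_n.+1 =>
    ([?p.2 \in Omega] * `|u p.2 - u (p.2 + p.1)|)%:E) by mea.
by apply: (measurable_fun_fubini_tonelli_F _ mF) => p; rewrite lee_fin mulr_ge0.
Qed.

Let W0 v : (0 <= W v)%E.
Proof. by apply: integral_ge0 => x _; rewrite lee_fin mulr_ge0. Qed.

Let vol (h : R) : R := (2 * (h / n.+2%:R)) ^+ n.+1.

(** Averages [strip_mass] over all admissible shifts w = -v. The sign turns u(x - w) into u(x + v),
    ready for the substitution y = x + v. *)
Lemma strip_average h : 0 < h -> h <= h1 ->
  (\int[leb]_y ([?stripz h y] * `|u y|)%:E <=
   (4 * N / rho * h)%:E * L1in Omega u +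
   ((vol h)^-1)%:E * \int[leb]_(v in eball (- ((h * N) *: e)) h) W v)%E.
Proof.
move=> h0 hh1.
have hN : 2 * h * N <= rho.
  by move: hh1; rewrite /h1 ler_pdivlMr ?mulr_gt0//; lra.
apply: integral_average_le => //.
- exact: measurable_eball.
- by rewrite exprn_gt0// mulr_gt0// divr_gt0.
- exact: lebesgue_rV_eball_ge.
- by apply: le_lt_trans (lebesgue_rV_eball_le _ h0) _; rewrite ltry.
- by apply: integral_ge0 => x _; rewrite lee_fin mulr_ge0.
- by rewrite mule_ge0 ?L1in_ge0// lee_fin !mulr_ge0 ?invr_ge0// ltW.
move=> v; rewrite /eball/= opprK => vh.
have wh : enorm (- v - (h * N) *: e) < h by rewrite -opprD enormN.
have := strip_mass oO b0 rho0 N4 kappaN cone h0 hN wh mu.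
by under [X in (_ <= _ + X)%E -> _]eq_integral do rewrite opprK.
Qed.

(** d^(-s) is at most 4 times the integral of h^(-s-1) over [d, 2d], because 2^(s+1) <= 4; the
    restriction d <= h1/2 keeps this interval inside [I1]. *)
Lemma strip_layer_cake s : 0 < s -> s < 1 ->
  (\int[leb]_y ([?(y \notin Omega) && (enorm (y - z) < rho / 2)%R && (d_ y <= h1 / 2)] *
      (`|u y| * d_ y `^ (- s)))%:E <=
   4%:E * \int[lb]_(h in I1) ((h `^ (- s - 1))%:E * \int[leb]_y ([?stripz h y] * `|u y|)%:E))%E.
Proof.
move=> s0 s1.
have mF : measurable_fun setT (fun p : 'rV[R]_n.+1 * measurableTypeR R =>
  ([?p.2 \in I1] * (p.2 `^ (- s - 1) * ([?stripz p.2 p.1] * `|u p.1|)))%:E).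
  by rewrite /strip; mea; exact: measurable_itv.
have F0 (p : 'rV[R]_n.+1 * measurableTypeR R) :
  (0 <= ([?p.2 \in I1] * (p.2 `^ (- s - 1) * ([?stripz p.2 p.1] * `|u p.1|)))%:E)%E.
  by rewrite lee_fin !mulr_ge0// powR_ge0.
rewrite [X in (4%:E * X)%E](_ : _ = (\int[lb]_h \int[leb]_y
   ([?h \in I1] * (h `^ (- s - 1) * ([?stripz h y] * `|u y|)))%:E)%E); last first.
  rewrite integral_mkcond; apply: eq_integral => h _; rewrite patchE; case: ifPn => hI; last first.
    by rewrite integral0_eq// => y _; rewrite mul0r.
  under [RHS]eq_integral do rewrite mul1r.
  by rewrite integralZl_EFin ?powR_ge0//; rewrite /strip; mea.
rewrite -(fubini_tonelli _ mF F0)/=.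
rewrite -ge0_integralZl//; last 2 first.
- exact: (measurable_fun_fubini_tonelli_F _ mF F0).
- by move=> x _; apply: integral_ge0 => h _; exact: (F0 (x, h)).
apply: nneg_le_integral => y _.
  by rewrite lee_fin !mulr_ge0// powR_ge0.
have R0 : (0 <= 4%:E * \int[lb]_h
    ([?h \in I1] * (h `^ (- s - 1) * ([?stripz h y] * `|u y|)))%:E)%E.
  by rewrite mule_ge0// integral_ge0// => h _; exact: (F0 (y, h)).
case: (boolP [&& y \notin Omega, enorm (y - z) < rho / 2 & d_ y <= h1 / 2]) => [/and3P[yO yz yd]|]; last first.
  by rewrite andbA => /negbTE ->; rewrite mul0r.
rewrite yO yz yd/= mul1r.
(* The dyadic interval needs d > 0; at d = 0 the left side vanishes by the convention for powers of
   0. *)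
have [d0|d0] := eqVneq (d_ y) 0.
  by rewrite d0 powR0 ?mulr0// oppr_eq0 gt_eqF.
have dp : 0 < d_ y by rewrite lt_neqAle eq_sym d0 dist_set_ge0.
apply: (@le_trans _ _ (4%:E * \int[lb]_h (`|u y| * ([?h \in `[d_ y, 2 * d_ y]%classic] * h `^ (- s - 1)))%:E)%E).
  rewrite integralZl_EFin//; last 2 first.
  - apply: measurable_funM; last exact: measurable_powR.
    by apply: measurable_natr; apply: measurable_mem => //; exact: measurable_itv.
  - by move=> h; rewrite mulr_ge0// powR_ge0.
  rewrite -integral_memE muleCA EFinM lee_wpmul2l ?lee_fin//.
  apply: (@le_trans _ _ (4%:E * (d_ y * (2 * d_ y) `^ (- s - 1))%:E)%E); last first.
    apply: lee_wpmul2l; first by rewrite lee_fin.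
    by apply: integral_powR_dyadic => //; lra.
  have -> : d_ y * (2 * d_ y) `^ (- s - 1) = 2 `^ (- s - 1) * d_ y `^ (- s).
    rewrite powRM ?(ltW dp)// mulrCA mulr_powR//.
    by congr (_ * _ `^ _); ring.
  rewrite -EFinM lee_fin mulrA ler_peMl ?powR_ge0//.
  have -> : 4 = 2 `^ 2 :> R by rewrite powR_mulrn// expr2 -natrM.
  rewrite -powRD_gt0// -[leLHS](powRr0 2); apply: ler_powR; first by rewrite ler1n.
  lra.
apply: lee_wpmul2l; first by rewrite lee_fin.
apply: nneg_le_integral => h _; first by rewrite lee_fin !mulr_ge0// powR_ge0.
have [hy|hy] := boolP (h \in `[d_ y, 2 * d_ y]%classic); last first.
  by rewrite mul0r mulr0; exact: (F0 (y, h)).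
move: hy; rewrite inE/= in_itv/= => /andP[hd1 hd2].
rewrite mem_set ?mul1r; last by rewrite /I1/= in_itv/=; apply/andP; split; lra.
by rewrite /strip yO yz hd1 mul1r mulrC.
Qed.

(** A shift v in the ball for the scale h satisfies |v| <= (N + 1) h, so for fixed v only h >=
    |v|/(N + 1) contributes. Integrating h^(-d-s-1) over these h gives a multiple of |v|^(-d-s), the
    kernel of the energy. *)
Lemma average_energy s : 0 < s -> s < 1 ->
  (\int[lb]_(h in I1) ((h `^ (- s - 1))%:E *
     (((vol h)^-1)%:E * \int[leb]_(v in eball (- ((h * N) *: e)) h) W v)) <=
   ((n.+2%:R / 2) ^+ n.+1 * (N + 1) ^+ n.+2)%:E * energy Omega s u)%E.
Proof.
move=> s0 s1.
set c1 := (n.+2%:R / 2) ^+ n.+1 : R.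
have c10 : 0 <= c1 by rewrite exprn_ge0// divr_ge0.
have ks : n.+1%:R + s > 0 by rewrite ltr_wpDl.
pose k (h : R) := h `^ (- (n.+1%:R + s) - 1).
have mF : measurable_fun setT (fun p : measurableTypeR R * 'rV[R]_n.+1 =>
   ((c1 * ([?p.1 \in I1] * ([?enorm p.2 <= (N + 1) * p.1] * k p.1)))%:E * W p.2)%E).
  apply: emeasurable_funM; last by apply: (measurableT_comp mW); exact: measurable_snd.
  by rewrite /k; mea; exact: measurable_itv.
have F0 (p : measurableTypeR R * 'rV[R]_n.+1) :
   (0 <= (c1 * ([?p.1 \in I1] * ([?enorm p.2 <= (N + 1) * p.1] * k p.1)))%:E * W p.2)%E.
  by rewrite mule_ge0// lee_fin !mulr_ge0// powR_ge0.
apply: (@le_trans _ _ (\int[lb]_h \int[leb]_v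
   ((c1 * ([?h \in I1] * ([?enorm v <= (N + 1) * h] * k h)))%:E * W v))%E).
  rewrite integral_mkcond; apply: nneg_le_integral => h _.
    rewrite patchE; case: ifPn => // hI; rewrite !mule_ge0 ?lee_fin ?powR_ge0//.
      rewrite invr_ge0 exprn_ge0// mulr_ge0// divr_ge0//.
      by move: hI; rewrite inE /I1/= in_itv/= => /andP[/ltW].
    by apply: integral_ge0.
  rewrite patchE; case: ifPn => hI; last first.
    by apply: integral_ge0 => v _; rewrite mul0r mulr0 mul0e.
  have h0 : 0 < h by move: hI; rewrite inE /I1/= in_itv/= => /andP[].
  rewrite muleA -EFinM.
  have v0 : 0 < vol h by rewrite exprn_gt0// mulr_gt0// divr_gt0.
  rewrite integral_mkcond -ge0_integralZl//; last 3 first.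
  - by apply/measurable_restrict => //; [exact: measurable_eball|rewrite setTI; exact: measurable_funTS].
  - by move=> v _; rewrite patchE; case: ifP.
  - by rewrite lee_fin mulr_ge0 ?powR_ge0// invr_ge0 ltW.
  apply: nneg_le_integral => v _.
    rewrite mule_ge0// ?lee_fin; last by rewrite patchE; case: ifP.
    by rewrite mulr_ge0 ?powR_ge0// invr_ge0 ltW.
  rewrite patchE; case: ifPn => vB; last first.
    by rewrite mule0 mule_ge0// lee_fin !mulr_ge0// powR_ge0.
  have vh : enorm v <= (N + 1) * h.
    move: vB; rewrite inE /eball/= opprK => vB.
    rewrite -[v](addrK ((h * N) *: e)); apply: le_trans (ler_enormD _ _) _.
    rewrite enormN enormZ gtr0_norm ?mulr_gt0//.
    have : h * N * enorm e <= h * N by rewrite ger_pMr ?mulr_gt0//; case: cone.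
    lra.
  rewrite vh !mul1r lee_wpmul2r// lee_fin /k.
  have -> : (vol h)^-1 = c1 * h `^ (- n.+1%:R).
    rewrite /vol /c1 powRN powR_mulrn ?(ltW h0)// -!exprVn -exprMn.
    congr (_ ^+ _); field; rewrite !gt_eqF//.
  rewrite mulrCA -powRD_gt0// le_eqVlt; apply/orP; left; apply/eqP.
  by congr (_ * _ `^ _); ring.
rewrite (fubini_tonelli _ mF F0)/=.
set C := (c1 * _).
apply: (@le_trans _ _ (\int[leb]_v ((C * enorm v `^ (- (n.+1%:R + s)))%:E * W v))%E).
  apply: nneg_le_integral => v _; first by apply: integral_ge0 => h _; exact: (F0 (h, v)).
  (* The tail integral needs |v| > 0; for v = 0 the difference in [W] vanishes. *)
  have [->|vn] := eqVneq v 0.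
    rewrite (_ : W 0 = 0%E); last first.
      by rewrite /W integral0_eq// => x _; rewrite addr0 subrr normr0 mulr0.
    by rewrite mule0 integral0_eq// => h _; rewrite mule0.
  have vp : 0 < enorm v.
    rewrite lt_neqAle enorm_ge0 andbT eq_sym; apply: contra vn => /eqP/enorm_eq0 ->.
    exact: eqxx.
  rewrite ge0_integralZr//; last 2 first.
  - by apply/measurable_EFinP; rewrite /k; mea; exact: measurable_itv.
  - by move=> h _; rewrite lee_fin !mulr_ge0// powR_ge0.
  apply: lee_wpmul2r => //.
  rewrite integralZl_EFin//; last 2 first.
  - by rewrite /k; mea; exact: measurable_itv.
  - by move=> h; rewrite !mulr_ge0// powR_ge0.
  rewrite /C -mulrA EFinM; apply: lee_wpmul2l; first by rewrite lee_fin.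
  have N1 : 0 < N + 1 by have N4' := N4; lra.
  have q0 : 0 < enorm v / (N + 1) by rewrite divr_gt0.
  apply: (@le_trans _ _ (((enorm v / (N + 1)) `^ (- (n.+1%:R + s)) / (n.+1%:R + s))%:E)).
    apply: le_trans (integral_powR_tail q0 ks).
    rewrite [leRHS]integral_memE; apply: nneg_le_integral => h _.
      by rewrite lee_fin !mulr_ge0// powR_ge0.
    rewrite lee_fin; case: (h \in I1); last by rewrite mul0r mulr_ge0// powR_ge0.
    rewrite mul1r; case: (leP (enorm v) _) => vh; last by rewrite mul0r mulr_ge0// powR_ge0.
    by rewrite mem_set//= in_itv/= andbT ler_pdivrMr// mulrC.
  rewrite lee_fin ler_pdivrMr//.
  have -> : (enorm v / (N + 1)) `^ (- (n.+1%:R + s)) =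
      (N + 1) `^ (n.+1%:R + s) * enorm v `^ (- (n.+1%:R + s)).
    rewrite powRM ?enorm_ge0 ?invr_ge0 ?(ltW N1)// mulrC; congr (_ * _).
    by rewrite -powR_inv1 ?(ltW N1)// -powRrM mulN1r opprK.
  rewrite mulrAC; apply: ler_wpM2r; first exact: powR_ge0.
  rewrite -powR_mulrn ?(ltW N1)//.
  apply: (@le_trans _ _ ((N + 1) `^ n.+2%:R)).
    apply: ler_powR; first by have N4' := N4; lra.
    by rewrite -[n.+2%:R]natr1; lra.
  rewrite ler_peMr ?powR_ge0//.
  have : 1 <= n.+1%:R :> R by rewrite ler1n.
  lra.
have C0 : 0 <= C by rewrite mulr_ge0// exprn_ge0//; have N4' := N4; lra.
under eq_integral do rewrite EFinM -muleA.
rewrite ge0_integralZl//; last 2 first.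
- by apply: emeasurable_funM => //; apply/measurable_EFinP; mea.
- by move=> v _; rewrite mule_ge0// lee_fin powR_ge0.
apply: lee_wpmul2l; first by rewrite lee_fin.
have mG : measurable_fun setT (fun p : 'rV[R]_n.+1 * 'rV[R]_n.+1 =>
    ([?p.2 \in Omega] * (`|u p.2 - u (p.2 + p.1)| * enorm p.1 `^ (- (n.+1%:R + s))))%:E) by mea.
have G0 (p : 'rV[R]_n.+1 * 'rV[R]_n.+1) :
    (0 <= ([?p.2 \in Omega] * (`|u p.2 - u (p.2 + p.1)| * enorm p.1 `^ (- (n.+1%:R + s))))%:E)%E.
  by rewrite lee_fin !mulr_ge0// powR_ge0.
rewrite [X in (X <= _)%E](_ : _ = (\int[leb]_v \int[leb]_x
   ([?x \in Omega] * (`|u x - u (x + v)| * enorm v `^ (- (n.+1%:R + s))))%:E)%E); last first.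
  apply: eq_integral => v _; rewrite /W.
  rewrite -integralZl_EFin ?powR_ge0//; last by mea.
  by apply: eq_integral => x _; congr EFin; ring.
rewrite (fubini_tonelli _ mG G0)/= le_eqVlt; apply/orP; left; apply/eqP.
apply: eq_integral => x _.
pose f y := ([?x \in Omega] * (`|u x - u y| * enorm (x - y) `^ (- (n.+1%:R + s))))%:E.
have mf : measurable_fun setT f by rewrite /f; mea.
have f0 y : (0 <= f y)%E by rewrite lee_fin !mulr_ge0// powR_ge0.
transitivity (\int[leb]_y f y)%E; last by [].
rewrite -(integral_lebesgue_rV_shift x mf f0).
apply: eq_integral => y _; rewrite /f (_ : x - (x + y) = - y) ?enormN//.
by rewrite opprD addrA subrr add0r.
Qed.

(** In the L^1 term the factor h of the strip estimate turns h^(-s-1) into h^(-s), whose integral up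
    to h1 is h1^(1-s)/(1 - s). The prefactor 1 - s cancels the denominator, and h1 <= 1 bounds the
    power. The energy keeps its own factor 1 - s. *)
Lemma trace_near s : 0 < s -> s < 1 ->
  ((1 - s)%:E * \int[leb]_y ([?(y \notin Omega) && (enorm (y - z) < rho / 2)%R && (d_ y <= h1 / 2)] *
      (`|u y| * d_ y `^ (- s)))%:E <=
   (16 * N / rho)%:E * L1in Omega u +
   (4 * ((n.+2%:R / 2) ^+ n.+1 * (N + 1) ^+ n.+2))%:E * ((1 - s)%:E * energy Omega s u))%E.
Proof.
move=> s0 s1.
have s10 : 0 < 1 - s by rewrite subr_gt0.
apply: (@le_trans _ _ ((1 - s)%:E * (4%:E * \int[lb]_(h in I1) ((h `^ (- s - 1))%:E *
   \int[leb]_y ([?stripz h y] * `|u y|)%:E)))%E).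
  by apply: lee_wpmul2l; [rewrite lee_fin ltW|exact: strip_layer_cake].
set G := fun h => (((vol h)^-1)%:E * \int[leb]_(v in eball (- ((h * N) *: e)) h) W v)%E.
have mI1 : measurable I1 by exact: measurable_itv.
have inI h : I1 h -> 0 < h /\ h <= h1.
  by rewrite /I1/= in_itv/= => /andP[].
have G0 h : I1 h -> (0 <= G h)%E.
  move=> /inI[h0 _]; rewrite mule_ge0 ?integral_ge0// lee_fin invr_ge0 exprn_ge0//.
  by rewrite mulr_ge0// divr_ge0// ltW.
have mG : measurable_fun setT (G : measurableTypeR R -> _).
  apply: emeasurable_funM; first by apply/measurable_EFinP; rewrite /vol; mea.
  have mF : measurable_fun setT (fun p : measurableTypeR R * 'rV[R]_n.+1 =>
     ([?enorm (p.2 - - ((p.1 * N) *: e)) < p.1])%:E * W p.2)%E.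
    apply: emeasurable_funM; last by apply: (measurableT_comp mW); exact: measurable_snd.
    by apply/measurable_EFinP; mea.
  have F0 (p : measurableTypeR R * 'rV[R]_n.+1) :
     (0 <= ([?enorm (p.2 - - ((p.1 * N) *: e)) < p.1])%:E * W p.2)%E.
    by rewrite mule_ge0// lee_fin.
  rewrite (_ : (fun h => _) = (fun h => \int[leb]_v
     (([?enorm (v - - ((h * N) *: e)) < h])%:E * W v))%E).
    exact: (measurable_fun_fubini_tonelli_F _ mF F0).
  apply/funext => h; rewrite integral_mkcond; apply: eq_integral => v _.
  rewrite patchE; case: ifPn => [|/negP vB]; first by rewrite inE /eball/= => ->; rewrite mul1e.
  case: (boolP (enorm (v - - ((h * N) *: e)) < h)) => vh; last by rewrite mul0e.
  exfalso; apply: vB.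
  exact/mem_set.
apply: (@le_trans _ _ ((1 - s)%:E * (4%:E * \int[lb]_(h in I1)
   ((h `^ (- s - 1) * (4 * N / rho * h))%:E * L1in Omega u + (h `^ (- s - 1))%:E * G h)))%E).
  apply: lee_wpmul2l; first by rewrite lee_fin ltW.
  apply: lee_wpmul2l; first by rewrite lee_fin.
  apply: nneg_le_integral => h /inI[h0 hh1].
    by rewrite mule_ge0 ?lee_fin ?powR_ge0// integral_ge0.
  rewrite EFinM -muleA -ge0_muleDr.
  - by apply: lee_wpmul2l; [rewrite lee_fin powR_ge0|exact: strip_average].
  - by rewrite mule_ge0 ?L1in_ge0// lee_fin !mulr_ge0 ?invr_ge0// ltW.
  - by apply: G0; rewrite /I1/= in_itv/= h0.
have A0 : 0 <= 4 * N / rho by rewrite !mulr_ge0 ?invr_ge0// ltW.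
rewrite ge0_integralD//; last 4 first.
- move=> h /inI[h0 _]; rewrite mule_ge0 ?L1in_ge0// lee_fin !mulr_ge0 ?powR_ge0// ltW//.
  by rewrite invr_gt0.
- apply: measurable_funTS; apply: emeasurable_funM => //.
  by apply/measurable_EFinP; mea.
- by move=> h Ih; rewrite mule_ge0 ?G0// lee_fin powR_ge0.
- apply: measurable_funTS; apply: emeasurable_funM => //.
  by apply/measurable_EFinP; mea.
rewrite ge0_integralZr//; last 3 first.
- by apply: measurable_funTS; apply/measurable_EFinP; mea.
- move=> h /inI[h0 _]; rewrite lee_fin !mulr_ge0 ?powR_ge0// ltW//.
  by rewrite invr_gt0.
- exact: L1in_ge0.
rewrite ge0_muleDr//; last 2 first.
- rewrite mule_ge0 ?L1in_ge0// integral_ge0// => h /inI[h0 _].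
  by rewrite lee_fin !mulr_ge0 ?powR_ge0 ?invr_ge0// ltW.
- by apply: integral_ge0 => h Ih; rewrite mule_ge0 ?G0// lee_fin powR_ge0.
rewrite ge0_muleDr//; last 2 first.
- rewrite !mule_ge0 ?L1in_ge0// integral_ge0// => h /inI[h0 _].
  by rewrite lee_fin !mulr_ge0 ?powR_ge0 ?invr_ge0// ltW.
- by rewrite mule_ge0// integral_ge0// => h Ih; rewrite mule_ge0 ?G0// lee_fin powR_ge0.
apply: leeD.
  rewrite muleA muleA; apply: lee_wpmul2r; first exact: L1in_ge0.
  rewrite [X in (_ * X)%E](_ : _ =
     (\int[lb]_(h in I1) ((4 * N / rho)%:E * (h `^ ((1 - s) - 1))%:E))%E); last first.
    apply: eq_integral => h; rewrite inE => /inI[h0 _]; rewrite -EFinM; congr EFin.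
    rewrite mulrCA; congr (_ * _); rewrite mulrC mulr_powR//; congr (_ `^ _); ring.
  rewrite ge0_integralZl//; last 2 first.
  - by apply: measurable_funTS; apply/measurable_EFinP; exact: measurable_powR.
  - by move=> h _; rewrite lee_fin powR_ge0.
  apply: (@le_trans _ _ ((1 - s)%:E * 4%:E * ((4 * N / rho)%:E * (h1 `^ (1 - s) / (1 - s))%:E))%E).
    apply: lee_wpmul2l; first by rewrite -EFinM lee_fin mulr_ge0// ltW.
    apply: lee_wpmul2l; first by rewrite lee_fin.
    exact: integral_powR_near.
  rewrite -!EFinM lee_fin.
  have -> : (1 - s) * 4 * (4 * N / rho * (h1 `^ (1 - s) / (1 - s))) =
     16 * N / rho * h1 `^ (1 - s) by field; rewrite !gt_eqF.
  rewrite ler_piMr//; first by rewrite !mulr_ge0 ?invr_ge0// ltW.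
  rewrite -[leRHS](powRr0 h1); apply: ger_powR; first by rewrite h10.
  exact: ltW.
have -> : ((4 * ((n.+2%:R / 2) ^+ n.+1 * (N + 1) ^+ n.+2))%:E * ((1 - s)%:E * energy Omega s u) =
   ((1 - s)%:E * 4%:E) * (((n.+2%:R / 2) ^+ n.+1 * (N + 1) ^+ n.+2)%:E * energy Omega s u))%E.
  by rewrite !muleA -!EFinM; congr (_%:E * _)%E; ring.
rewrite muleA; apply: lee_wpmul2l; first by rewrite -EFinM lee_fin mulr_ge0// ltW.
exact: average_energy.
Qed.

End trace_near.

(** Gathers the geometric constants of Omega. Every later constant is built from these and from
    bounds on s, which is how uniformity in s is tracked. *)
Record domain_data (R : realType) (n : nat) (Omega : set 'rV[R]_n.+1) := DomainData {
  dd_rho : R ; dd_kappa : R ; dd_N : R ; dd_D : R ;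
  dd_open : open Omega ;
  dd_bounded : bounded_set Omega ;
  dd_bnd0 : boundary Omega !=set0 ;
  dd_rho0 : 0 < dd_rho ;
  dd_rho1 : dd_rho <= 1 ;
  dd_N4 : 4 < dd_N ;
  dd_kappaN : dd_kappa * dd_N = 4 ;
  dd_cone : forall z, boundary Omega z -> exists e, cone_at Omega dd_rho dd_kappa z e ;
  dd_D0 : 0 < dd_D ;
  dd_diam : forall x y, (Omega x \/ boundary Omega x) -> (Omega y \/ boundary Omega y) ->
    enorm (x - y) <= dd_D }.

Lemma lipschitz_domain_data (R : realType) (n : nat) (Omega : set 'rV[R]_n.+1) :
  lipschitz_domain Omega -> bounded_set Omega -> inhabited (domain_data Omega).
Proof.
move=> lip bO; have [oO [b0 _]] := lip.
have [r [kappa [r0 /andP[k0 k1] C]]] := lipschitz_cone lip.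
have [D D0 HD] := boundary_diam oO bO.
have rho0 : 0 < Num.min r 1 by rewrite lt_min r0 ltr01.
have rho1 : Num.min r 1 <= 1 by rewrite ge_min lexx orbT.
have N4 : 4 < 4 / kappa by rewrite ltr_pdivlMr// gtr_pMr.
have kN : kappa * (4 / kappa) = 4 by field; rewrite gt_eqF.
have C' z : boundary Omega z -> exists e, cone_at Omega (Num.min r 1) kappa z e.
  move=> /C[e [e1 He]]; exists e; split => // p w t Op; rewrite !lt_min => /andP[pr _].
  by move=> /andP[t0 /andP[tr _]]; apply: He => //; rewrite t0.
by constructor; exact: (DomainData oO bO b0 rho0 rho1 N4 kN C' D0 HD).
Qed.

(** * The trace estimate away from the boundary *)

Section trace.
Context {R : realType} {n : nat} {Omega : set 'rV[R]_n.+1}.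
Variable dd : domain_data Omega.
Local Notation rho := (dd_rho dd).
Local Notation N := (dd_N dd).
Local Notation D := (dd_D dd).
Local Notation leb := (@lebesgue_rV R n.+1).
Local Notation d_ := (dist_boundary Omega).

Let oO := dd_open dd.
Let b0 := dd_bnd0 dd.

Lemma measurable_domain : measurable Omega.
Proof. exact: (open_measurable_rV (dd_open dd)). Qed.
Let mO := measurable_domain.

Lemma dd_N0 : 0 < N. Proof. exact: lt_trans (dd_N4 dd). Qed.

(** Half of the maximal strip width rho/(2N): the distance up to which the local trace estimates
    apply, beyond which the far estimate takes over. *)
Definition dd_h : R := rho / (4 * N).

Lemma dd_h0 : 0 < dd_h.
Proof. by rewrite divr_gt0 ?dd_rho0// mulr_gt0 ?dd_N0//. Qed.

Lemma dd_h_rho : 16 * dd_h < rho.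
Proof.
rewrite /dd_h mulrA ltr_pdivrMr ?mulr_gt0 ?dd_N0// mulrC ltr_pM2l ?dd_rho0//.
by have := dd_N4 dd; lra.
Qed.

Lemma dd_h1 : dd_h <= 1.
Proof. have := dd_h_rho; have := dd_rho1 dd; have := dd_h0; lra. Qed.

Lemma domain_nonempty : Omega !=set0.
Proof.
have [z bz] := b0; have [_ /(_ _ ltr01)[a Oa _]] := (boundary_openP z oO).1 bz.
by exists a.
Qed.

Lemma lebesgue_domain_gt0 : (0 < leb Omega)%E.
Proof.
have [a Oa] := domain_nonempty; have [r r0 rO] := open_eball oO Oa.
apply: (@lt_le_trans _ _ (((2 * (r / n.+2%:R)) ^+ n.+1)%:E)).
  by rewrite lte_fin exprn_gt0// mulr_gt0// divr_gt0.
apply: le_trans (lebesgue_rV_eball_ge a r0) _.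
by apply: le_measure; rewrite ?inE//; exact: measurable_eball.
Qed.

Lemma lebesgue_domain_lty : (leb Omega < +oo)%E.
Proof.
have [a Oa] := domain_nonempty; have D0 := dd_D0 dd.
have D2 : 0 < D + 1 by lra.
apply: le_lt_trans (_ : _ <= ((2 * (D + 1)) ^+ n.+1)%:E)%E _; last by rewrite ltry.
apply: le_trans (lebesgue_rV_eball_le a D2).
apply: le_measure; rewrite ?inE//; first exact: measurable_eball.
move=> x Ox; rewrite /eball/=; have := dd_diam dd (or_introl Ox) (or_introl Oa); lra.
Qed.

Lemma dist_inE x y : Omega x -> ~ Omega y -> enorm (x - y) <= D + 2 * d_ y.
Proof.
move=> Ox Oy; have [dy|dy] := ltP 0 (d_ y).
  have [q bq yq] : exists2 q, boundary Omega q & enorm (y - q) < 2 * d_ y.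
    by apply: dist_set_ltP => //; rewrite ltr_pMl// ltr1n.
  apply: le_trans (ler_enorm_dist x q y) _; rewrite (enormB q).
  by apply: lerD; [apply: dd_diam; [left|right]|exact: ltW].
(* With d_y = 0 the bound 2 d_y leaves no room for a near minimiser of the distance, hence the
   arbitrary eps. *)
have d0 : d_ y = 0 by apply/eqP; rewrite eq_le dy dist_set_ge0.
rewrite d0 mulr0 addr0; apply/ler_addgt0Pr => eps e0.
have [q bq yq] : exists2 q, boundary Omega q & enorm (y - q) < eps.
  by apply: dist_set_ltP => //; rewrite -/(d_ y) d0.
apply: le_trans (ler_enorm_dist x q y) _; rewrite (enormB q).
by apply: lerD; [apply: dd_diam; [left|right]|exact: ltW].
Qed.

Lemma mu_density_ge0 (s : R) y : s <= 1 -> 0 <= mu_density Omega s y.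
Proof.
move=> s1; rewrite /mu_density !mulr_ge0 ?subr_ge0 ?powR_ge0// invr_ge0 exprn_ge0//.
by rewrite addr_ge0// dist_set_ge0.
Qed.

Lemma measurable_mu_density (s : R) : measurable_fun setT (mu_density Omega s).
Proof. by rewrite /mu_density; mea. Qed.

Lemma mu_density_le (s : R) y : s <= 1 -> mu_density Omega s y <= (1 - s) * d_ y `^ (- s).
Proof.
move=> s1; rewrite /mu_density ler_piMr ?mulr_ge0 ?subr_ge0 ?powR_ge0//.
have d1 : 1 <= 1 + d_ y by rewrite lerDl dist_set_ge0.
by rewrite invf_le1 ?exprn_ege1// exprn_gt0// (lt_le_trans ltr01).
Qed.

Definition far_const : R := (D / dd_h + 2) * (D + 2) ^+ n.+1.

Lemma far_const_ge0 : 0 <= far_const.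
Proof.
have D0 := ltW (dd_D0 dd); have h0 := ltW dd_h0.
have A : 0 <= D / dd_h + 2 by rewrite addr_ge0// divr_ge0.
have B : 0 <= D + 2 by rewrite addr_ge0.
by rewrite /far_const mulr_ge0// exprn_ge0.
Qed.

(** Far from the boundary |x - y| is at most A d_y and at most (D + 2)(1 + d_y), for every x in
    Omega. The first bound converts d_y^(-s), where A^s <= A removes the dependence on s, and the
    second converts (1 + d_y)^(-d). *)
Lemma mu_density_far (s : R) x y : 0 < s -> s < 1 -> Omega x -> ~ Omega y -> dd_h <= d_ y ->
  mu_density Omega s y <= far_const * ((1 - s) * enorm (x - y) `^ (- (n.+1%:R + s))).
Proof.
move=> s0 s1 Ox Oy hy; have D0 := dd_D0 dd; have h0 := dd_h0.
have dy : 0 < d_ y by exact: lt_le_trans hy.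
have xy : 0 < enorm (x - y) by exact: lt_le_trans dy (dist_boundary_out_le oO Ox Oy).
have xyD := dist_inE Ox Oy.
rewrite /mu_density /far_const.
set A := D / dd_h + 2.
have A1 : 1 <= A by have := divr_ge0 (ltW D0) (ltW h0); rewrite /A; lra.
have xA : enorm (x - y) <= A * d_ y.
  have DA : D <= D / dd_h * d_ y by rewrite mulrAC ler_pdivlMr// ler_pM2l.
  by apply: le_trans xyD _; rewrite /A; lra.
have xA' : enorm (x - y) <= (D + 2) * (1 + d_ y).
  by apply: le_trans xyD _; nra.
set B := (D + 2) ^+ n.+1.
have -> : A * B * ((1 - s) * enorm (x - y) `^ (- (n.+1%:R + s))) =
   (1 - s) * ((A * enorm (x - y) `^ (- s)) * (B * enorm (x - y) `^ (- n.+1%:R))).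
  by rewrite opprD powRD_gt0//; ring.
rewrite -mulrA; apply: ler_wpM2l; first by rewrite subr_ge0 ltW.
apply: ler_pM.
- exact: powR_ge0.
- by rewrite invr_ge0 exprn_ge0//; lra.
- rewrite !powRN -[leLHS]div1r ler_pdivrMr ?powR_gt0// mulrAC ler_pdivlMr ?powR_gt0// mul1r.
  apply: (@le_trans _ _ ((A * d_ y) `^ s)).
    have Ad : 0 <= A * d_ y by rewrite mulr_ge0 ?(ltW dy)//; lra.
    by apply: ge0_ler_powR; rewrite ?nnegrE ?enorm_ge0 ?(ltW s0).
  rewrite powRM ?(ltW dy)//; last lra.
  rewrite ler_wpM2r ?powR_ge0// -[leRHS]powRr1; last lra.
  by apply: ler_powR => //; exact: ltW.
- rewrite powRN powR_mulrn ?enorm_ge0// -[leLHS]div1r ler_pdivrMr; last by rewrite exprn_gt0//; lra.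
  rewrite mulrAC ler_pdivlMr ?exprn_gt0// mul1r -exprMn.
  by rewrite lerXn2r ?nnegrE ?enorm_ge0//; nra.
Qed.

(** |u y| <= |u x - u y| + |u x| is integrated over x in Omega and divided by the volume of Omega.
    The first term is controlled by the energy through [mu_density_far], the second by the L^1 norm
    times the total far weight. *)
Lemma trace_far (s_lo s : R) (u : 'rV[R]_n.+1 -> R) :
  0 < s_lo -> s_lo <= s -> s < 1 -> measurable_fun setT u ->
  (\int[leb]_y ([?(y \notin Omega) && (dd_h < d_ y)] * (`|u y| * mu_density Omega s y))%:E <=
   (far_const * (1 + radialC (R:=R) (n:=n.+1) * (dd_h^-1 / s_lo)) / fine (leb Omega))%:E *
   (L1in Omega u + (1 - s)%:E * energy Omega s u))%E.
Proof.
move=> sl0 sls s1 mu.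
have s0 : 0 < s by exact: lt_le_trans sls.
have s10 : 0 < 1 - s by rewrite subr_gt0.
have s10' := ltW s10.
have h0 := dd_h0.
have F0 := far_const_ge0.
have md0 y := mu_density_ge0 y (ltW s1).
have md := measurable_mu_density s.
have mdf := fun x y => @mu_density_far s x y s0 s1.
move: far_const F0 mdf => F F0 mdf.
set V := fine (leb Omega).
have VE : leb Omega = V%:E by rewrite fineK// ge0_fin_numE// lebesgue_domain_lty.
have V0 : 0 < V by rewrite -lte_fin -VE lebesgue_domain_gt0.
have V0' := ltW V0.
have IV : (\int[leb]_x [?x \in Omega]%:E = V%:E)%E.
  rewrite -VE; transitivity (\int[leb]_x (\1_Omega x)%:E)%E; first exact: eq_integral.
  by rewrite integral_indic ?setIT.
pose far y := (y \notin Omega) && (dd_h < d_ y).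
pose k y := [?far y] * mu_density Omega s y.
have mk : measurable_fun setT k.
  by rewrite /k /far; mea.
have k0 y : 0 <= k y by rewrite mulr_ge0// mu_density_ge0// ltW.
set K := n.+1%:R + s.
have kle x y : Omega x -> k y <= F * ((1 - s) * enorm (x - y) `^ (- K)).
  move=> Ox; rewrite /k /far; case: (boolP (y \in Omega)) => /= yO.
    by rewrite mul0r !mulr_ge0 ?powR_ge0.
  case: ltP => /= hd; last by rewrite mul0r !mulr_ge0 ?powR_ge0.
  rewrite mul1r; apply: mdf => //; last exact: ltW.
  by move=> Oy; move/negP : yO; apply; exact/mem_set.
(* The total far weight is a tail integral around any fixed point a of Omega; here 1 - s <= 1 is
   enough. *)
have kint : (\int[leb]_y (k y)%:E <= (F * (radialC (R:=R) (n:=n.+1) * (dd_h^-1 / s_lo)))%:E)%E.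
  have [a Oa] := domain_nonempty.
  apply: (@le_trans _ _ (\int[leb]_y (F * ([?dd_h <= enorm (y - a)] * enorm (y - a) `^ (- s - n.+1%:R)))%:E)%E).
    apply: nneg_le_integral => y _; rewrite lee_fin//.
    have [fy|fy] := boolP (far y); last first.
      by rewrite /k (negbTE fy) mul0r !mulr_ge0 ?powR_ge0.
    have := fy => /andP[yO hd].
    have -> : dd_h <= enorm (y - a).
      have Oy : ~ Omega y by move=> Oy; move/negP : yO; apply; exact/mem_set.
      by rewrite enormB; exact: le_trans (ltW hd) (dist_boundary_out_le oO Oa Oy).
    rewrite mul1r; apply: le_trans (kle _ y Oa) _; rewrite ler_wpM2l//.
    rewrite enormB /K opprD (addrC (- _)) ler_piMl ?powR_ge0//; lra.
  rewrite integralZl_EFin; [|by mea|by nng|by []].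
  rewrite EFinM lee_wpmul2l ?lee_fin//.
  have sn : s <= n.+1%:R by apply: le_trans (ltW s1) _; rewrite ler1n.
  apply: le_trans (radial_tail a h0 s0 sn) _.
  rewrite lee_fin ler_wpM2l//; first by rewrite /radialC mulr_ge0// exprn_ge0.
  apply: ler_pM; rewrite ?powR_ge0 ?invr_ge0 ?(ltW s0)//.
    rewrite -[leRHS]powR_inv1 ?(ltW h0)//; apply: ger_powR; first by rewrite h0 dd_h1.
    by rewrite lerN2 ltW.
  by rewrite lef_pV2.
pose kxy (x y : 'rV[R]_n.+1) := [?x \in Omega] * (`|u x - u y| * enorm (x - y) `^ (- K)).
have mkxy : measurable_fun setT (fun p : 'rV[R]_n.+1 * 'rV[R]_n.+1 => (kxy p.2 p.1)%:E).
  by rewrite /kxy; mea.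
have kxy0 x y : 0 <= kxy x y by rewrite !mulr_ge0// powR_ge0.
have mL1 : measurable_fun setT (fun x => [?x \in Omega] * `|u x|) by mea.
have key : (V%:E * \int[leb]_y ([?far y] * (`|u y| * mu_density Omega s y))%:E <=
   F%:E * ((1 - s)%:E * energy Omega s u) +
   L1in Omega u * \int[leb]_y (k y)%:E)%E.
  rewrite -integralZl_EFin; [|by rewrite /far; mea|by nng|by []].
  apply: (@le_trans _ _ (\int[leb]_y ((F * (1 - s))%:E * \int[leb]_x (kxy x y)%:E +
     L1in Omega u * (k y)%:E))%E).
    apply: nneg_le_integral => y _.
      by nng.
    rewrite [leLHS](_ : _ = \int[leb]_x ([?x \in Omega] * (`|u y| * k y))%:E)%E; last first.
      under eq_integral do rewrite mulrC.
      rewrite integralZl_EFin; [|by mea|by nng|by nng].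
      by rewrite IV -EFinM; congr EFin; rewrite /k; ring.
    have mkx : measurable_fun setT (kxy ^~ y) by rewrite /kxy; mea.
    rewrite -integralZl_EFin; [|by []|by []|by nng].
    rewrite /L1in -ge0_integralZr//; [|by mea|by nng].
    rewrite -ge0_integralD//; try (by nng); try (by mea); last first.
      by apply: emeasurable_funM; mea.
    apply: nneg_le_integral => x _; first by nng.
    rewrite -EFinM -EFinD lee_fin /kxy.
    have [xO|xO] := boolP (x \in Omega); last by rewrite !mul0r mulr0 addr0.
    rewrite !mul1r.
    have H1 : `|u y| <= `|u x - u y| + `|u x|.
      have := ler_normD (u y - u x) (u x).
      by rewrite subrK distrC.
    have H2 := kle x y (set_mem xO).
    apply: le_trans (ler_wpM2r (k0 y) H1) _; rewrite mulrDl lerD2r.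
    apply: le_trans (ler_wpM2l (normr_ge0 (u x - u y)) H2) _.
    by rewrite le_eqVlt; apply/orP; left; apply/eqP; ring.
  rewrite ge0_integralD//; last 4 first.
  - by move=> y _; rewrite mule_ge0 ?integral_ge0// ?lee_fin ?mulr_ge0// => x _; rewrite lee_fin.
  - apply: emeasurable_funM => //.
    by apply: (measurable_fun_fubini_tonelli_F _ mkxy) => p; rewrite lee_fin.
  - by move=> y _; rewrite mule_ge0 ?L1in_ge0// lee_fin.
  - by apply: emeasurable_funM => //; exact/measurable_EFinP.
  rewrite ge0_integralZl//; last 3 first.
  - by apply: (measurable_fun_fubini_tonelli_F _ mkxy) => p; rewrite lee_fin.
  - by move=> y _; apply: integral_ge0 => x _; rewrite lee_fin.
  - by rewrite lee_fin mulr_ge0.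
  rewrite (fubini_tonelli _ mkxy)/=; last by move=> p; rewrite lee_fin.
  rewrite ge0_integralZl//; last 3 first.
  - exact/measurable_EFinP.
  - by move=> y _; rewrite lee_fin.
  - exact: L1in_ge0.
  by rewrite EFinM muleA.
have U0 := L1in_ge0 Omega u; have E0 := energy_ge0 Omega s u.
have E1 : (0 <= (1 - s)%:E * energy Omega s u)%E by rewrite mule_ge0// lee_fin ltW.
have H : (V%:E * \int[leb]_y ([?far y] * (`|u y| * mu_density Omega s y))%:E <=
   (F * (1 + radialC (R:=R) (n:=n.+1) * (dd_h^-1 / s_lo)))%:E *
   (L1in Omega u + (1 - s)%:E * energy Omega s u))%E.
  apply: le_trans key _.
  have r0 : 0 <= radialC (R:=R) (n:=n.+1) * (dd_h^-1 / s_lo).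
    by rewrite /radialC !mulr_ge0 ?exprn_ge0 ?invr_ge0// ltW.
  rewrite [leRHS]ge0_muleDr// [leLHS]addeC; apply: leeD.
    rewrite muleC; apply: lee_wpmul2r => //; apply: le_trans kint _.
    by rewrite lee_fin ler_wpM2l// lerDr.
  apply: lee_wpmul2r => //.
  by rewrite lee_fin ler_peMr// lerDl.
have := lee_wpmul2l (_ : 0 <= (V^-1)%:E)%E H.
rewrite lee_fin invr_ge0 (ltW V0) => /(_ isT).
rewrite muleA -EFinM mulVf ?gt_eqF// mul1e => /le_trans; apply.
by rewrite muleA -EFinM mulrC.
Qed.

End trace.

(** * The global trace inequality and the trace operator *)

Section mu_s_integrals.
Context {R : realType} {n : nat} {Omega : set 'rV[R]_n.+1}.
Variable dd : domain_data Omega.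
Local Notation leb := (@lebesgue_rV R n.+1).
Local Notation d_ := (dist_boundary Omega).

Let oO := dd_open dd.
Let mO := measurable_domain dd.

Lemma integral_mu_s (s : R) (f : 'rV[R]_n.+1 -> \bar R) : s <= 1 ->
  measurable_fun (~` Omega) f -> (forall x, (~` Omega) x -> (0 <= f x)%E) ->
  (\int[mu_s Omega s]_(x in ~` Omega) f x =
   \int[leb]_(x in ~` Omega) (f x * (mu_density Omega s x)%:E))%E.
Proof.
move=> s1 mf f0.
pose h x := \1_(~` Omega) x * mu_density Omega s x : R.
have mh : measurable_fun setT h.
  apply: measurable_funM; last exact: measurable_mu_density.
  by apply: measurable_indic; exact: measurableC.
have h0 x : 0 <= h x by rewrite mulr_ge0 ?mu_density_ge0.
(* The measure structure of [mu_s] depends on the openness of Omega and on s <= 1, so it is passed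
   explicitly. *)
have := @integral_density _ _ R leb (Defs_mu_s__canonical__measure_function_Measure oO s1)
  h (~` Omega) f mh h0 (fun A _ => erefl) (measurableC mO) mf f0.
move=> /= ->; apply: eq_integral => x xO; congr (_ * _%:E)%E.
by rewrite /h indicE xO mul1r.
Qed.

Lemma integral_mu_s_EFin (s : R) (f : 'rV[R]_n.+1 -> R) : s <= 1 ->
  measurable_fun (~` Omega) f -> (forall x, 0 <= f x) ->
  (\int[mu_s Omega s]_(x in ~` Omega) (f x)%:E =
   \int[leb]_x ([?x \notin Omega] * (f x * mu_density Omega s x))%:E)%E.
Proof.
move=> s1 mf f0; rewrite integral_mu_s; [|by []|exact/measurable_EFinP|by move=> x _; rewrite lee_fin].
under eq_integral do rewrite -EFinM.
rewrite integral_memE; apply: eq_integral => x _; congr (_%:R * _)%:E.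
by rewrite in_setC.
Qed.

Lemma V_seminormE (s : R) (u : 'rV[R]_n.+1 -> R) :
  V_seminorm Omega s u = ((1 - s)%:E * energy Omega s u)%E.
Proof.
rewrite /V_seminorm /energy; congr (_ * _)%E.
rewrite integral_mkcond; apply: eq_integral => x _; rewrite patchE.
case: ifPn => xO; last by rewrite integral0_eq// => y _; rewrite mul0r.
by apply: eq_integral => y _; rewrite mul1r powRN.
Qed.

Lemma L1inE (u : 'rV[R]_n.+1 -> R) : (\int[leb]_(x in Omega) `|u x|%:E)%E = L1in Omega u.
Proof. by rewrite integral_memE. Qed.

Lemma strip_covered (zs : seq 'rV[R]_n.+1) y :
  (forall z, boundary Omega z -> exists2 c, c \in zs & enorm (z - c) < dd_rho dd / 4) ->
  d_ y <= dd_h dd -> exists2 c, c \in zs & enorm (y - c) < dd_rho dd / 2.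
Proof.
move=> cov yd.
have h0 := dd_h0 dd.
have [q bq yq] : exists2 q, boundary Omega q & enorm (y - q) < 2 * dd_h dd.
  by apply: dist_set_ltP; [exact: dd_bnd0|apply: le_lt_trans yd _; lra].
have [c cz qc] := cov _ bq; exists c => //.
apply: le_lt_trans (ler_enorm_dist y q c) _.
by have := dd_h_rho dd; lra.
Qed.

Lemma boundary_null : leb (boundary Omega) = 0%E.
Proof.
have r4 : 0 < dd_rho dd / 4 by rewrite divr_gt0 ?dd_rho0.
have [zs zsb cov] := boundary_cover oO (dd_bounded dd) r4.
have mB := measurable_boundary Omega.
have bO y : boundary Omega y -> y \notin Omega.
  by move=> /(boundary_openP _ oO)[Oy _]; apply/negP; rewrite inE.
have bd y : boundary Omega y -> d_ y = 0.
  move=> by_; apply/eqP; rewrite eq_le dist_set_ge0 andbT.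
  by apply: le_trans (dist_set_le _ by_) _; rewrite subrr enorm0.
rewrite -[boundary Omega]setIT -integral_indic//.
have near0 c : c \in zs ->
    (\int[leb]_y ([?(y \in boundary Omega) && (enorm (y - c) < dd_rho dd / 2)%R])%:E <= 0)%E.
  move=> /zsb bc; have [e ce] := dd_cone dd bc.
  set V := fine (leb Omega).
  have VE : leb Omega = V%:E by rewrite fineK// ge0_fin_numE// (lebesgue_domain_lty dd).
  have V0 : 0 <= V by rewrite fine_ge0.
  have N0 := dd_N0 dd; have rho0 := dd_rho0 dd.
  pose A := 4 * dd_N dd / dd_rho dd * V.
  have A0 : 0 <= A by rewrite /A mulr_ge0// divr_ge0// ?(ltW rho0)// mulr_ge0// ltW.
  have IV : L1in Omega (fun=> 1) = V%:E.
    rewrite -VE; transitivity (\int[leb]_x (\1_Omega x)%:E)%E.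
      by apply: eq_integral => x _; rewrite normr1 mulr1.
    by rewrite integral_indic ?setIT.
  apply/lee_addgt0Pr => eps eps0; rewrite add0e.
  (* For u = 1 the difference term of [strip_mass] vanishes and a strip of width h has volume at
     most A h. This h makes that at most eps. *)
  pose h := Num.min (dd_h dd) (eps / (A + 1)).
  have h0 : 0 < h by rewrite lt_min (dd_h0 dd) divr_gt0//; lra.
  have hA : A * h <= eps.
    have : h <= eps / (A + 1) by rewrite ge_min lexx orbT.
    rewrite ler_pdivlMr; last lra.
    by have h0' := ltW h0; lra.
  have hN : 2 * h * dd_N dd <= dd_rho dd.
    have hd : h <= dd_h dd by rewrite ge_min lexx.
    have e1 : dd_h dd * dd_N dd = dd_rho dd / 4 by rewrite /dd_h; field; rewrite gt_eqF.
    have e2 := ler_wpM2r (ltW N0) hd; rewrite e1 in e2; lra.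
  have we : enorm ((h * dd_N dd) *: e - (h * dd_N dd) *: e) < h by rewrite subrr enorm0.
  have := strip_mass oO (dd_bnd0 dd) rho0 (dd_N4 dd) (dd_kappaN dd) ce h0 hN we
    (measurable_cst (1 : R) : measurable_fun [set: 'rV[R]_n.+1] (fun=> 1 : R)).
  rewrite -/(L1in Omega (fun=> 1)) IV [X in (_ + X)%E]integral0_eq; last first.
    by move=> x _; rewrite subrr normr0 mulr0.
  rewrite adde0 -EFinM => H.
  apply: le_trans (le_trans H _); last first.
    by rewrite lee_fin; apply: le_trans hA; rewrite /A mulrAC.
  apply: nneg_le_integral => y _; first by rewrite lee_fin.
  rewrite lee_fin normr1 mulr1 ler_nat.
  case: (boolP (y \in boundary Omega)) => //= /set_mem yb.
  by rewrite /strip (bO _ yb) (bd _ yb) (ltW h0) andbT /=.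
apply/eqP; rewrite eq_le; apply/andP; split; last by apply: integral_ge0 => x _; rewrite lee_fin.
apply: (@le_trans _ _ (\int[leb]_y (\sum_(c <- zs)
   ([?(y \in boundary Omega) && (enorm (y - c) < dd_rho dd / 2)%R])%:E))%E).
  apply: nneg_le_integral => y _; first by rewrite lee_fin.
  rewrite sumEFin lee_fin indicE.
  case: (boolP (y \in boundary Omega)) => [/set_mem yb|_]; last by rewrite sumr_ge0.
  have [|c cz yc] := strip_covered (y := y) cov; first by rewrite bd// ltW// dd_h0.
  by rewrite (big_rem c)//= yc lerDl sumr_ge0.
rewrite ge0_integral_sum//; last by move=> c; mea.
rewrite big_seq; apply: sume_le0 => c; exact: near0.
Qed.

Lemma trace_ineq (s_lo : R) : 0 < s_lo -> exists2 C : R, 0 <= C &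
  forall s (u : 'rV[R]_n.+1 -> R), s_lo <= s -> s < 1 -> measurable_fun setT u ->
  (\int[leb]_y ([?y \notin Omega] * (`|u y| * mu_density Omega s y))%:E <=
   C%:E * (L1in Omega u + (1 - s)%:E * energy Omega s u))%E.
Proof.
move=> sl0.
have N0 := dd_N0 dd; have rho0 := dd_rho0 dd; have h0 := dd_h0 dd.
have r4 : 0 < dd_rho dd / 4 by rewrite divr_gt0.
have [zs zsb cov] := boundary_cover oO (dd_bounded dd) r4.
set C1 := (far_const dd * (1 + radialC (R:=R) (n:=n.+1) * ((dd_h dd)^-1 / s_lo)) / fine (leb Omega)).
have C10 : 0 <= C1.
  have := far_const_ge0 dd; rewrite /C1 /radialC; move: (far_const dd) => F F0.
  by rewrite divr_ge0 ?fine_ge0// mulr_ge0// addr_ge0// !mulr_ge0 ?exprn_ge0 ?invr_ge0// ltW.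
set C2 := 16 * dd_N dd / dd_rho dd + 4 * ((n.+2%:R / 2) ^+ n.+1 * (dd_N dd + 1) ^+ n.+2).
have C21 : 0 <= 16 * dd_N dd / dd_rho dd by rewrite divr_ge0 ?(ltW rho0)// mulr_ge0// ltW.
have C22 : 0 <= 4 * ((n.+2%:R / 2) ^+ n.+1 * (dd_N dd + 1) ^+ n.+2).
  by have N0' := ltW N0; nng.
have C20 : 0 <= C2 by rewrite addr_ge0.
(* One local constant [C2] for each centre of the boundary cover, and [C1] for the far region. *)
exists (C2 *+ size zs + C1); first by rewrite addr_ge0// mulrn_wge0.
move=> s u sls s1 mu.
have s0 : 0 < s by exact: lt_le_trans sls.
have s10 : 0 <= 1 - s by rewrite subr_ge0 ltW.
have md := @measurable_mu_density R n Omega s.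
have md0 y := @mu_density_ge0 R n Omega s y (ltW s1).
set E := (L1in Omega u + (1 - s)%:E * energy Omega s u)%E.
have U0 := L1in_ge0 Omega u.
have E1 : (0 <= (1 - s)%:E * energy Omega s u)%E by rewrite mule_ge0 ?energy_ge0// lee_fin.
have E0 : (0 <= E)%E by rewrite adde_ge0.
pose near c y := (y \notin Omega) && (enorm (y - c) < dd_rho dd / 2) && (d_ y <= dd_h dd).
pose far y := (y \notin Omega) && (dd_h dd < d_ y).
apply: (@le_trans _ _ (\int[leb]_y (\sum_(c <- zs) ((1 - s) * ([?near c y] * (`|u y| * d_ y `^ (- s))))%:E
   + ([?far y] * (`|u y| * mu_density Omega s y))%:E))%E).
  apply: nneg_le_integral => y _; first by nng.
  rewrite sumEFin -EFinD lee_fin /far.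
  have S0 : 0 <= \sum_(c <- zs) (1 - s) * ([?near c y] * (`|u y| * d_ y `^ (- s))).
    by apply: sumr_ge0 => c _; nng.
  have [yO|yO] := boolP (y \in Omega); first by rewrite /= !mul0r addr0.
  rewrite /= mul1r; have [yd|yd] := leP (d_ y) (dd_h dd); last by rewrite mul1r lerDr.
  rewrite mul0r addr0; have [c cz yc] := strip_covered cov yd.
  rewrite (big_rem c)//= -[leLHS]addr0; apply: lerD; last by apply: sumr_ge0 => c' _; nng.
  rewrite /near yO yc yd/= mul1r.
  apply: le_trans (ler_wpM2l (normr_ge0 (u y)) (mu_density_le y (ltW s1))) _.
  by rewrite mulrCA.
rewrite ge0_integralD//; last 4 first.
- by move=> y _; apply: sume_ge0 => c _; nng.
- by apply: emeasurable_sum => c; rewrite /near; mea.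
- by nng.
- by rewrite /far; mea.
rewrite ge0_integral_sum//; last 2 first.
- by move=> c; rewrite /near; mea.
- by nng.
rewrite EFinD ge0_muleDl; last 2 first.
- by rewrite lee_fin mulrn_wge0.
- by rewrite lee_fin.
apply: leeD; last exact: trace_far.
have -> : ((C2 *+ size zs)%:E * E = \sum_(c <- zs) (C2%:E * E))%E.
  elim: (zs) => [|c zs' IH]; first by rewrite big_nil mul0e.
  rewrite big_cons -IH /= mulrS EFinD ge0_muleDl// lee_fin.
  by rewrite mulrn_wge0.
rewrite big_seq [leRHS]big_seq; apply: lee_sum => c /zsb bc.
rewrite integralZl_EFin; [|by rewrite /near; mea|by nng|by []].
have [e ce] := dd_cone dd bc.
have := trace_near oO (dd_bnd0 dd) rho0 (dd_rho1 dd) (dd_N4 dd) (dd_kappaN dd) ce mu s0 s1.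
have -> : dd_rho dd / (2 * dd_N dd) / 2 = dd_h dd.
  by rewrite /dd_h; field; rewrite gt_eqF.
move=> /le_trans; apply.
rewrite /E [leRHS]ge0_muleDr//; apply: leeD.
  by apply: lee_wpmul2r => //; rewrite lee_fin lerDl.
by apply: lee_wpmul2r => //; rewrite lee_fin lerDr.
Qed.

Lemma mu_s_finite (s : R) : 0 < s -> s < 1 ->
  (\int[leb]_y ([?y \notin Omega] * mu_density Omega s y)%:E < +oo)%E.
Proof.
move=> s0 s1; have [C C0 H] := trace_ineq s0.
have := H s (fun=> 1) (lexx s) s1 (measurable_cst (1 : R) : measurable_fun [set: 'rV[R]_n.+1] (fun=> 1 : R)).
have -> : energy Omega s (fun=> 1) = 0%E.
  rewrite /energy integral0_eq// => x _; rewrite integral0_eq// => y _.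
  by rewrite subrr normr0 mul0r mulr0.
rewrite mule0 adde0.
have -> : L1in Omega (fun=> 1) = leb Omega.
  transitivity (\int[leb]_x (\1_Omega x)%:E)%E.
    by apply: eq_integral => x _; rewrite normr1 mulr1.
  by rewrite integral_indic ?setIT.
under eq_integral do rewrite normr1 mul1r.
move=> /le_lt_trans; apply; rewrite lte_mul_pinfty ?lee_fin//.
exact: (lebesgue_domain_lty dd).
Qed.

(** Membership in [V_space] only asks for a finite seminorm. Integrability on Omega follows: fix x
    in Omega with finite inner integral, bound the kernel below on the bounded set Omega, and
    compare u y with u x. *)
Lemma energy_L1in (s : R) (u : 'rV[R]_n.+1 -> R) : 0 < s -> measurable_fun setT u ->
  (energy Omega s u < +oo)%E -> (L1in Omega u < +oo)%E.
Proof.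
move=> s0 mu Eoo.
pose F x := (\int[leb]_y ([?x \in Omega] * (`|u x - u y| * enorm (x - y) `^ (- (n.+1%:R + s))))%:E)%E.
have mK : measurable_fun setT (fun p : 'rV[R]_n.+1 * 'rV[R]_n.+1 =>
  ([?p.1 \in Omega] * (`|u p.1 - u p.2| * enorm (p.1 - p.2) `^ (- (n.+1%:R + s))))%:E) by mea.
have mF : measurable_fun setT F.
  by apply: (measurable_fun_fubini_tonelli_F _ mK) => p; nng.
have F0 x : (0 <= F x)%E by apply: integral_ge0 => y _; nng.
have [x [Ox Fx]] : exists x, Omega x /\ (F x < +oo)%E.
  (* Were the inner integral infinite at every x of Omega, the energy would be infinite, since Omega
     has positive volume. *)
  apply: contrapT => H.
  have H1 x : Omega x -> F x = +oo%E.
    move=> Ox; apply/eqP; rewrite -leye_eq leNgt; apply/negP => Fx; apply: H.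
    by exists x.
  move: Eoo; rewrite ltNge => /negP; apply.
  apply: (@le_trans _ _ (\int[leb]_(x in Omega) +oo)%E).
    rewrite integral_cst// gt0_mulye//; exact: (lebesgue_domain_gt0 dd).
  rewrite integral_mkcond; apply: nneg_le_integral => x _.
    by rewrite patchE; case: ifP.
  rewrite patchE; case: ifPn => xO; last by apply: integral_ge0 => y _; nng.
  by have := H1 x (set_mem xO); rewrite /F xO => ->.
pose D1 := dd_D dd + 1.
have D0 : 0 < D1 by have := dd_D0 dd; rewrite /D1; lra.
set K := n.+1%:R + s in F mK mF F0 Fx *.
have K0 : 0 < K by rewrite /K ltr_wpDl.
apply: (@le_lt_trans _ _ ((D1 `^ K)%:E * F x + `|u x|%:E * leb Omega)%E); last first.
  apply: lte_add_pinfty; first by rewrite lte_mul_pinfty ?lee_fin ?powR_ge0.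
  by rewrite lte_mul_pinfty ?lee_fin// (lebesgue_domain_lty dd).
have IV : leb Omega = (\int[leb]_y [?y \in Omega]%:E)%E.
  transitivity (\int[leb]_x (\1_Omega x)%:E)%E; last exact: eq_integral.
  by rewrite integral_indic ?setIT.
rewrite IV /F -integralZl_EFin; [|by mea|by nng|by nng].
rewrite -integralZl_EFin; [|by mea|by move=> z; exact: ler0n|exact: normr_ge0].
rewrite -ge0_integralD//; try (by nng); try (by mea).
apply: nneg_le_integral => y _; first by nng.
rewrite -EFinD lee_fin (mem_set Ox) mul1r.
have [yO|yO] := boolP (y \in Omega); last by rewrite mul0r; nng.
rewrite mul1r mulr1.
have H1 : `|u y| <= `|u x - u y| + `|u x|.
  by have := ler_normD (u y - u x) (u x); rewrite subrK distrC.
apply: le_trans H1 _; rewrite lerD2r.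
have [xy|xy] := eqVneq x y; first by rewrite xy subrr normr0; nng.
have xy0 : 0 < enorm (x - y).
  rewrite lt_neqAle enorm_ge0 andbT eq_sym; apply: contra xy => /eqP/enorm_eq0/eqP.
  by rewrite subr_eq0.
rewrite mulrCA ler_peMr// powRN ler_pdivlMr ?powR_gt0// mul1r.
apply: ge0_ler_powR; rewrite ?nnegrE ?enorm_ge0 ?(ltW K0) ?(ltW D0)//.
have := dd_diam dd (or_introl Ox) (or_introl (set_mem yO)); rewrite /D1; lra.
Qed.

Lemma L1_normE (s : R) (g : 'rV[R]_n.+1 -> R) : s <= 1 -> measurable_fun (~` Omega) g ->
  L1_norm Omega s g = (\int[leb]_y ([?y \notin Omega] * (`|g y| * mu_density Omega s y))%:E)%E.
Proof.
move=> s1 mg; rewrite /L1_norm integral_mu_s_EFin//.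
exact: measurableT_comp.
Qed.

Lemma L1_norm_Tr (s : R) (u : 'rV[R]_n.+1 -> R) :
  s <= 1 -> L1_norm Omega s (Tr Omega u) = L1_norm Omega s u.
Proof.
move=> s1; apply: (eq_integral (mu := Defs_mu_s__canonical__measure_function_Measure oO s1)).
by move=> x xO; rewrite /Tr patchE xO.
Qed.

Lemma measurable_Tr (u : 'rV[R]_n.+1 -> R) : measurable_fun setT u ->
  measurable_fun (~` Omega) (Tr Omega u).
Proof.
move=> mu; apply: (eq_measurable_fun u); last exact: measurable_funTS.
by move=> x xO; rewrite /Tr patchE xO.
Qed.

Lemma Tr_constant (s_lo : R) : 0 < s_lo -> exists2 C : R, 0 <= C &
  forall s, s_lo <= s < 1 ->
  continuity_constant (V_space Omega s) (L1_space Omega s) (Tr Omega) C.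
Proof.
move=> sl0; have [C C0 H] := trace_ineq sl0; exists C => // s /andP[sls s1] u [mu _] /=.
rewrite L1_norm_Tr ?(ltW s1)// L1_normE ?(ltW s1)//; last exact: measurable_funTS.
by rewrite V_seminormE L1inE; exact: H.
Qed.

Lemma Tr_linear (s : R) : 0 < s -> s < 1 ->
  linear_operator (V_space Omega s) (L1_space Omega s) (Tr Omega).
Proof.
move=> s0 s1; split => [u [mu Vu]|u v _ _ [A [mA A0 HA]]|a b u v _ _].
- split; first exact: measurable_Tr.
  have [C C0 H] := Tr_constant s0.
  have := H s; rewrite lexx s1 => /(_ isT u (conj mu Vu)) /le_lt_trans; apply.
  rewrite /= lte_mul_pinfty ?lee_fin//; apply: lte_add_pinfty => //.
  rewrite L1inE; apply: (energy_L1in s0 mu).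
  move: Vu; rewrite V_seminormE => Vu.
  have s10 : 0 < 1 - s by rewrite subr_gt0.
  rewrite ltey; apply/eqP => Eoo; move: Vu; rewrite Eoo gt0_muley ?lte_fin//.
- exists A; split => // x xn; apply: HA => /= uv; apply: xn => xO.
  by rewrite /Tr !patchE (mem_set (xO : (~` Omega) x)); exact: uv.
- exists set0; split => // x /=; apply; move=> xO.
  by rewrite /Tr !patchE (mem_set (xO : (~` Omega) x)).
Qed.

End mu_s_integrals.

Section continuity.
Context {R : realType} {X : Type}.
Variables (E F : function_space R X) (A : (X -> R) -> (X -> R)).

(** The usual argument for linear maps, from compatibility with differences alone. The constant C +
    1 is used as a divisor because C may be 0. *)
Lemma bounded_continuous (C : R) : 0 <= C -> continuity_constant E F A C ->
  (forall u v, fcarrier E u -> fcarrier E v -> (fnorm E (v \- u)%R < +oo)%E ->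
     fcarrier E (v \- u)) ->
  (forall u v, fcarrier E u -> fcarrier E v -> fcarrier E (v \- u) ->
     fnorm F (A v \- A u) = fnorm F (A (v \- u))) ->
  (forall u, (0 <= fnorm E u)%E) -> continuous_operator E F A.
Proof.
move=> C0 HC Hc HA n0 u Eu e e0.
have C1 : 0 < C + 1 by lra.
exists (e / (C + 1)); first by rewrite divr_gt0.
move=> v Ev uv.
have Evu : fcarrier E (v \- u) by apply: Hc => //; apply: lt_trans uv _; rewrite ltry.
rewrite HA//; apply: le_lt_trans (HC _ Evu) _.
apply: (@le_lt_trans _ _ ((C + 1)%:E * fnorm E (v \- u)%R)%E).
  by apply: lee_wpmul2r => //; rewrite lee_fin; lra.
apply: (@lt_le_trans _ _ ((C + 1)%:E * (e / (C + 1))%:E)%E).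
  by rewrite lte_pmul2l ?lte_fin.
by rewrite -EFinM lee_fin mulrC divfK// gt_eqF.
Qed.

End continuity.

(** * Volume of exterior strips *)

Section mass.
Context {R : realType} {n : nat} {Omega : set 'rV[R]_n.+1}.
Variable dd : domain_data Omega.
Local Notation leb := (@lebesgue_rV R n.+1).
Local Notation d_ := (dist_boundary Omega).
Local Notation kappa := (dd_kappa dd).
Local Notation rho := (dd_rho dd).

Let oO := dd_open dd.
Let b0 := dd_bnd0 dd.
Let mO := measurable_domain dd.

Lemma dd_kappa0 : 0 < kappa.
Proof.
have N0 := dd_N0 dd; rewrite -(pmulr_lgt0 _ N0) (dd_kappaN dd); lra.
Qed.

Lemma dd_kappa1 : kappa < 1.
Proof.
have N4 := dd_N4 dd; have N0 := dd_N0 dd.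
by rewrite -(ltr_pM2r N0) mul1r (dd_kappaN dd).
Qed.

Lemma boundary_notin p : boundary Omega p -> ~ Omega p.
Proof. by move=> /(boundary_openP _ oO)[]. Qed.

Lemma dist0_boundary z : ~ Omega z -> d_ z = 0 -> boundary Omega z.
Proof.
move=> Oz dz; apply/(boundary_openP _ oO); split => // r r0.
have r2 : 0 < r / 2 by rewrite divr_gt0.
have [q bq zq] : exists2 q, boundary Omega q & enorm (z - q) < r / 2.
  by apply: dist_set_ltP => //; rewrite -/(d_ z) dz.
have [a Oa aq] := ((boundary_openP _ oO).1 bq).2 _ r2.
exists a => //; apply: le_lt_trans (ler_enorm_dist a q z) _; rewrite (enormB q); lra.
Qed.

(** The exterior cone at p with parameter h0. The ball serves twice: as the set of starting points
    of walks into Omega, and as a supply of exterior points at a controlled distance from the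
    boundary. *)
Lemma cone_outer_ball p e h0 y : boundary Omega p -> cone_at Omega rho kappa p e ->
  0 < h0 -> h0 <= dd_h dd -> enorm (y - (p - h0 *: e)) < kappa * h0 -> ~ Omega y.
Proof.
move=> bp ce h00 h0h yq.
have rho0 := dd_rho0 dd; have hr := dd_h_rho dd.
rewrite -[y](subKr p); apply: (cone_exterior (t := h0) (ltW dd_kappa1) ce).
- exact: boundary_notin.
- by rewrite subrr enorm0 divr_gt0.
- by rewrite h00/=; lra.
- by rewrite (_ : p - y - h0 *: e = - (y - (p - h0 *: e))) ?enormN// !opprB addrAC addrC addrA.
Qed.

(** Seen from p, the displacement is (t - h0) e with t - h0 >= h0, up to an error below kappa h0 /
    2. As p is not in Omega, a point p' of Omega within kappa h0 / 2 of p takes its place in the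
    cone condition. *)
Lemma cone_inner p e h0 t y : boundary Omega p -> cone_at Omega rho kappa p e ->
  0 < h0 -> h0 <= dd_h dd -> 2 * h0 <= t -> t <= 3 * h0 ->
  enorm (y - (p - h0 *: e)) < kappa * h0 / 2 -> Omega (y + t *: e).
Proof.
move=> bp ce h00 h0h ht th yq.
have rho0 := dd_rho0 dd; have hr := dd_h_rho dd; have k0 := dd_kappa0; have k1 := dd_kappa1.
have kh : 0 < kappa * h0 by rewrite mulr_gt0.
have kh2 : 0 < kappa * h0 / 2 by rewrite divr_gt0.
have [p' Op' pp'] := ((boundary_openP _ oO).1 bp).2 _ kh2.
have khh : kappa * h0 <= h0 by rewrite ger_pMl// ltW.
have [_ C] := ce.
have := C p' (y + t *: e - p') (t - h0) Op'.
rewrite (_ : p' + (y + t *: e - p') = y + t *: e); last by rewrite addrC subrK.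
apply.
- by apply: lt_trans pp' _; lra.
- by apply/andP; split; lra.
have -> : y + t *: e - p' - (t - h0) *: e = (y - (p - h0 *: e)) + (p - p').
  rewrite scalerBl; apply/rowP => i; rewrite !mxE; ring.
apply: le_lt_trans (ler_enormD _ _) _; rewrite (enormB p).
have : kappa * h0 <= kappa * (t - h0) by rewrite ler_pM2l//; lra.
lra.
Qed.

(** From each y of the exterior ball one walks along e in steps of length at most h. The walk enters
    Omega within K steps, and its last point outside is within h of Omega, hence in the strip. So
    the ball is covered by K translates of the strip, where K is at most 3 h0 / h. *)
Lemma strip_volume p e h0 h : boundary Omega p -> cone_at Omega rho kappa p e ->
  0 < h0 -> h0 <= dd_h dd -> 0 < h -> h <= h0 ->
  (((kappa * h0 / n.+2%:R) ^+ n.+1 * (h / (3 * h0)))%:E <=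
   \int[leb]_z [?(z \notin Omega) && (enorm (z - p) <= 5 * h0)%R && (0 < d_ z <= h)]%:E)%E.
Proof.
move=> bp ce h00 h0h hp hh0.
have rho0 := dd_rho0 dd; have hr := dd_h_rho dd; have k0 := dd_kappa0; have k1 := dd_kappa1.
have e1 : enorm e <= 1 by case: ce.
pose S z := (z \notin Omega) && (enorm (z - p) <= 5 * h0) && (0 < d_ z <= h).
pose S' z := (z \notin Omega) && (enorm (z - p) <= 5 * h0) && (d_ z <= h).
have mS : measurable_fun setT (fun z => [?S z] : R) by rewrite /S; mea.
have mS' : measurable_fun setT (fun z => [?S' z] : R) by rewrite /S'; mea.
have -> : (\int[leb]_z [?(z \notin Omega) && (enorm (z - p) <= 5 * h0)%R && (0 < d_ z <= h)]%:E =
   \int[leb]_z [?S' z]%:E)%E.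
  (* The condition 0 < d_z only removes the boundary, a null set. *)
  apply: ge0_ae_eq_integral => //.
  - exact/measurable_EFinP.
  - exact/measurable_EFinP.
  exists (boundary Omega); split; [|exact: boundary_null|].
    by rewrite /boundary; apply: measurableD; [|apply: open_measurable_rV; exact: open_interior];
      rewrite -[closure _]setCK; apply: measurableC; apply: open_measurable_rV;
      apply: closed_openC; exact: closed_closure.
  move=> z /= /not_implyP[_ H]; apply: contrapT => bz; apply: H.
  rewrite /S'; case: (boolP (z \in Omega)) => //= zO.
  have -> : 0 < d_ z.
    rewrite lt_neqAle dist_set_ge0 andbT eq_sym; apply/eqP => dz; apply: bz.
    by apply: dist0_boundary => // Oz; move/negP : zO; apply; exact/mem_set.
  by [].
(* With K the first integer above t, the final displacement K h lies between 2 h0 and 3 h0, the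
   range of [cone_inner]. *)
pose t := 2 * h0 / h.
pose K := (Num.truncn t).+1.
have t2 : 2 <= t by rewrite ler_pdivlMr//; lra.
have tK : t < K%:R by exact: truncnS_gt.
have Kt : K%:R <= t + 1.
  by rewrite /K -natr1 lerD2r truncn_le; lra.
have th : t * h = 2 * h0 by rewrite /t divfK// gt_eqF.
have Kh2 : 2 * h0 <= K%:R * h by rewrite -th ler_pM2r// ltW.
have Kh3 : K%:R * h <= 3 * h0.
  by apply: le_trans (ler_wpM2r (ltW hp) Kt) _; rewrite mulrDl th; lra.
set q := p - h0 *: e.
have r0 : 0 < kappa * h0 / 2 by rewrite divr_gt0// mulr_gt0.
have main : (leb (eball q (kappa * h0 / 2)) <= K%:R%:E * \int[leb]_z [?S' z]%:E)%E.
  have -> : leb (eball q (kappa * h0 / 2)) = (\int[leb]_y (\1_(eball q (kappa * h0 / 2)) y)%:E)%E.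
    by rewrite integral_indic ?setIT//; exact: measurable_eball.
  apply: (@le_trans _ _ (\int[leb]_y (\sum_(k < K) ([?S' ((k%:R * h) *: e + y)])%:E))%E).
    apply: nneg_le_integral => y _; first by rewrite lee_fin.
    rewrite sumEFin lee_fin indicE.
    case: (boolP (y \in eball q (kappa * h0 / 2))) => [/set_mem/= yq|_]; last by rewrite sumr_ge0.
    have yq' : enorm (y - q) < kappa * h0 by apply: lt_trans yq _; rewrite ltr_pdivrMr// ltr_pMr ?mulr_gt0// ltr1n.
    (* The least index with [P] is positive because the ball is exterior; its predecessor is the
       last exterior point of the walk. *)
    pose P k := `[< Omega ((k%:R * h) *: e + y) >].
    have exP : exists k, P k.
      exists K; apply/asboolP; rewrite addrC; exact: (cone_inner bp ce h00 h0h Kh2 Kh3 yq).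
    case: (ex_minnP exP) => m /asboolP Pm mmin.
    case: m Pm mmin => [|m] Pm mmin.
      exfalso; move: Pm; rewrite mul0r scale0r add0r.
      exact: (cone_outer_ball bp ce h00 h0h yq').
    have mK : (m < K)%N.
      by apply: mmin; apply/asboolP; rewrite addrC; exact: (cone_inner bp ce h00 h0h Kh2 Kh3 yq).
    have nm : ~ Omega ((m%:R * h) *: e + y).
      by move=> Om; have := mmin m; rewrite ltnn => H; have /H : P m by exact/asboolP.
    have mh : m%:R * h <= 3 * h0.
      by apply: le_trans Kh3; rewrite ler_pM2r// ler_nat ltnW.
    rewrite (bigD1 (Ordinal mK))//= -[leLHS]addr0; apply: lerD; last by rewrite sumr_ge0.
    have -> : S' ((m%:R * h) *: e + y) => //.
    rewrite /S'; apply/andP; split; first (apply/andP; split).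
    - by apply/negP => /set_mem.
    - rewrite (_ : _ + y - p = (y - q) + (m%:R * h - h0) *: e); last first.
        by rewrite /q scalerBl; apply/rowP => i; rewrite !mxE; ring.
      apply: le_trans (ler_enormD _ _) _; rewrite enormZ.
      have khh : kappa * h0 <= h0 by rewrite ger_pMl// ltW.
      have : `|m%:R * h - h0| * enorm e <= 4 * h0.
        apply: (@le_trans _ _ (`|m%:R * h - h0| * 1)); first by rewrite ler_wpM2l.
        rewrite mulr1 ler_norml; have : 0 <= m%:R * h by rewrite mulr_ge0// ltW.
        by move=> ?; apply/andP; split; lra.
      lra.
    - apply: le_trans (dist_boundary_out_le oO Pm nm) _.
      rewrite (_ : _ - _ = h *: e); last first.
        by rewrite -natr1; apply/rowP => i; rewrite !mxE; ring.
      by rewrite enormZ gtr0_norm// ger_pMr.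
  rewrite ge0_integral_sum//; last first.
    by move=> k; rewrite /S'; mea.
  under eq_bigr => k _.
    rewrite (@integral_lebesgue_rV_shift _ _ _ (fun z => [?S' z]%:E)); first over.
    - exact/measurable_EFinP.
    - by nng.
  have IF0 : (0 <= \int[leb]_z [?S' z]%:E)%E by apply: integral_ge0 => z _; rewrite lee_fin.
  rewrite big_const_ord; elim: (K) => [|k IH]; first by rewrite mul0e.
  by rewrite iterS -natr1 EFinD ge0_muleDl// mul1e addeC; apply: leeD.
have K0 : 0 < K%:R :> R by rewrite ltr0n.
have B := le_trans (lebesgue_rV_eball_ge q r0) main.
have KI : (0 <= ((K%:R : R)^-1)%:E)%E by rewrite lee_fin invr_ge0.
have := lee_wpmul2l KI B.
have KK : (((K%:R : R)^-1)%:E * K%:R%:E = 1 :> \bar R)%E by rewrite -EFinM mulVf// gt_eqF.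
rewrite muleA KK mul1e; apply: le_trans.
rewrite -EFinM lee_fin.
have -> : 2 * (kappa * h0 / 2 / n.+2%:R) = kappa * h0 / n.+2%:R by field.
rewrite mulrC; apply: ler_wpM2r.
  by rewrite exprn_ge0// divr_ge0// mulr_ge0// ltW.
rewrite -[leRHS]div1r ler_pdivlMr// mulrAC ler_pdivrMr ?mulr_gt0// mul1r mulrC.
exact: Kh3.
Qed.

End mass.

(** * The averaging kernel *)

Section mass_lower.
Context {R : realType} {n : nat} {Omega : set 'rV[R]_n.+1}.
Variable dd : domain_data Omega.
Local Notation leb := (@lebesgue_rV R n.+1).
Local Notation lb := (@lebesgue_measure R).
Local Notation d_ := (dist_boundary Omega).
Local Notation kappa := (dd_kappa dd).

Let oO := dd_open dd.
Let mO := measurable_domain dd.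

Definition exterior_weight (s : R) (z : 'rV[R]_n.+1) : R := [?z \notin Omega] * mu_density Omega s z.

Definition exterior_mass (s : R) (x : 'rV[R]_n.+1) : \bar R :=
  (\int[leb]_z (enorm (x - z) `^ (- n.+1%:R) * exterior_weight s z)%:E)%E.

Local Notation wgt := exterior_weight.
Local Notation mass := exterior_mass.

Lemma wgt_ge0 s z : s <= 1 -> 0 <= wgt s z.
Proof. by move=> s1; rewrite mulr_ge0 ?mu_density_ge0. Qed.

Lemma measurable_wgt s : measurable_fun setT (wgt s).
Proof. by have md := @measurable_mu_density R n Omega s; rewrite /wgt; mea. Qed.

Lemma dist_in_gt0 x : Omega x -> 0 < d_ x.
Proof. exact: dist_boundary_gt0 oO (dd_bnd0 dd). Qed.

Lemma dist_in_leD x : Omega x -> d_ x <= dd_D dd.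
Proof.
move=> Ox; have [z bz] := dd_bnd0 dd; apply: le_trans (dist_set_le _ bz) _.
by apply: dd_diam; [left|right].
Qed.

(** Distances d_x go up to the diameter D, whereas the cone constructions need scales below [dd_h];
    theta d_x is always admissible. *)
Definition dd_theta : R := dd_h dd / (dd_D dd + 1).

Lemma dd_theta0 : 0 < dd_theta.
Proof. by rewrite /dd_theta divr_gt0 ?dd_h0// ltr_wpDl// ltW// dd_D0. Qed.

Lemma dd_theta1 : dd_theta <= 1.
Proof.
have D0 := dd_D0 dd; have h1 := dd_h1 dd.
by rewrite /dd_theta ler_pdivrMr; lra.
Qed.

Lemma dd_theta_le x : Omega x -> dd_theta * d_ x <= dd_h dd.
Proof.
move=> Ox; have D0 := dd_D0 dd; have h0 := dd_h0 dd.
have D1 : 0 < dd_D dd + 1 by lra.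
rewrite /dd_theta mulrAC ler_pdivrMr// ler_pM2l//.
by have := dist_in_leD Ox; lra.
Qed.

Lemma nearby_boundary x : Omega x -> exists p e, [/\ boundary Omega p,
  enorm (x - p) < 2 * d_ x & cone_at Omega (dd_rho dd) kappa p e].
Proof.
move=> Ox; have d0 := dist_in_gt0 Ox.
have [p bp xp] : exists2 p, boundary Omega p & enorm (x - p) < 2 * d_ x.
  by apply: dist_set_ltP; [exact: dd_bnd0|rewrite -/(d_ x); lra].
by have [e ce] := dd_cone dd bp; exists p, e.
Qed.

(** Layer cake from below: for d > 0, d^(-s) is at least s times the integral of h^(-s-1) over h in
    [d, h0]. Strip volumes proportional to h then leave the integral of h^(-s), whose size
    h0^(1-s)/(1 - s) later compensates the factor 1 - s of the density. *)
Lemma strip_weight (s : R) p e h0 : 0 < s -> s < 1 -> boundary Omega p ->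
  cone_at Omega (dd_rho dd) kappa p e -> 0 < h0 -> h0 <= dd_h dd ->
  ((s * ((kappa * h0 / n.+2%:R) ^+ n.+1 / (3 * h0)) * (h0 `^ (1 - s) / (2 * (1 - s))))%:E <=
   \int[leb]_z ([?(z \notin Omega) && (enorm (z - p) <= 5 * h0)%R && (0 < d_ z <= h0)] *
      d_ z `^ (- s))%:E)%E.
Proof.
move=> s0 s1 bp ce h00 h0h.
have s10 : 0 < 1 - s by rewrite subr_gt0.
have k0 := dd_kappa0 dd.
pose I1 : set (measurableTypeR R) := `]0, h0]%classic.
have mI1 : measurable I1 by exact: measurable_itv.
pose S h z := (z \notin Omega) && (enorm (z - p) <= 5 * h0) && (0 < d_ z <= h).
set cB := (kappa * h0 / n.+2%:R) ^+ n.+1 / (3 * h0).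
have cB0 : 0 <= cB.
  by rewrite divr_ge0 ?exprn_ge0 ?divr_ge0 ?mulr_ge0// ltW// mulr_gt0.
have mF : measurable_fun setT (fun q : 'rV[R]_n.+1 * measurableTypeR R =>
  ([?q.2 \in I1] * (q.2 `^ (- s - 1) * [?S q.2 q.1]))%:E) by rewrite /S; mea.
have F0 (q : 'rV[R]_n.+1 * measurableTypeR R) :
  (0 <= ([?q.2 \in I1] * (q.2 `^ (- s - 1) * [?S q.2 q.1]))%:E)%E by nng.
apply: (@le_trans _ _ (\int[leb]_z (s%:E * \int[lb]_h ([?h \in I1] * (h `^ (- s - 1) * [?S h z]))%:E))%E); last first.
  apply: nneg_le_integral => z _.
    by rewrite mule_ge0 ?lee_fin ?(ltW s0)// integral_ge0// => h _; exact: (F0 (z, h)).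
  have [Sz|Sz] := boolP (S h0 z); last first.
    rewrite integral0_eq ?mule0; first by nng.
    move=> h _; have [hI|_] := boolP (h \in I1); last by rewrite mul0r.
    have hh0 : h <= h0 by move: hI; rewrite inE /I1/= in_itv/= => /andP[].
    rewrite (_ : S h z = false) ?mulr0 ?mulr0//; apply/negbTE; apply: contra Sz.
    by rewrite /S => /andP[-> /andP[-> /= dh]]; exact: le_trans hh0.
  have /andP[_ /andP[dz _]] := Sz.
  rewrite -/(S h0 z) Sz mul1r.
  apply: (@le_trans _ _ (s%:E * (d_ z `^ (- s) / s)%:E)%E); last first.
    by rewrite -EFinM lee_fin mulrC divfK// gt_eqF.
  apply: lee_wpmul2l; first by rewrite lee_fin ltW.
  apply: le_trans (integral_powR_tail dz s0).
  rewrite [leRHS]integral_memE; apply: nneg_le_integral => h _; first by nng.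
  rewrite lee_fin; have [hI|_] := boolP (h \in I1); last by rewrite mul0r; nng.
  rewrite mul1r; have [Sh|_] := boolP (S h z); last by rewrite mulr0; nng.
  rewrite mulr1 mem_set ?mul1r//= in_itv/= andbT.
  by move: Sh => /andP[_ /andP[]].
rewrite ge0_integralZl//; [|exact: (measurable_fun_fubini_tonelli_F _ mF F0)| |by rewrite lee_fin ltW]; last first.
  by move=> z _; apply: integral_ge0 => h _; exact: (F0 (z, h)).
rewrite (fubini_tonelli _ mF F0)/= -[s * cB * _]mulrA EFinM.
apply: lee_wpmul2l; first by rewrite lee_fin ltW.
apply: (@le_trans _ _ (\int[lb]_h (cB * ([?h \in I1] * h `^ (1 - s - 1)))%:E)%E).
  rewrite integralZl_EFin; [|by mea|by nng|by []].
  rewrite -integral_memE EFinM; apply: lee_wpmul2l; first by rewrite lee_fin.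
  exact: integral_powR_near_ge.
apply: nneg_le_integral => h _; first by nng.
have [hI|_] := boolP (h \in I1); last first.
  by rewrite mul0r mulr0; apply: integral_ge0 => z _; nng.
have /andP[hp hh0] : (0 < h) && (h <= h0) by move: hI; rewrite inE /I1/= in_itv.
rewrite mul1r; under eq_integral do rewrite mul1r.
rewrite integralZl_EFin; [|by rewrite /S; mea|by nng|by nng].
have hs0 : (0 <= (h `^ (- s - 1))%:E)%E by nng.
apply: le_trans _ (lee_wpmul2l hs0 (strip_volume bp ce h00 h0h hp hh0)).
rewrite -EFinM lee_fin /cB le_eqVlt; apply/orP; left; apply/eqP.
have -> : h `^ (1 - s - 1) = h * h `^ (- s - 1).
  by rewrite mulr_powR//; congr (_ `^ _); ring.
by field; rewrite gt_eqF// pnatr_eq0.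
Qed.

(* The exterior strips of width h near a boundary point close to x have volume at
   least a multiple of h d_x^(d-1), which makes the mass of order d_x^(-s) without
   loss of the factor 1 - s. *)
Lemma mass_lower (s_lo : R) : 0 < s_lo -> exists2 c : R, 0 < c &
  forall s x, s_lo <= s -> s < 1 -> Omega x -> ((c * d_ x `^ (- s))%:E <= mass s x)%E.
Proof.
move=> sl0; have k0 := dd_kappa0 dd; have t0 := dd_theta0; have t1 := dd_theta1.
exists (s_lo * (kappa * dd_theta / (14 * n.+2%:R)) ^+ n.+1 / 6).
  by rewrite divr_gt0// mulr_gt0// exprn_gt0// divr_gt0// mulr_gt0.
move=> s x sls s1 Ox.
have s0 : 0 < s by exact: lt_le_trans sls.
have s10 : 0 < 1 - s by rewrite subr_gt0.
have d0 := dist_in_gt0 Ox.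
have [p [e [bp xp ce]]] := nearby_boundary Ox.
set delta := d_ x in d0 xp *.
pose h0 := dd_theta * delta.
have h00 : 0 < h0 by rewrite mulr_gt0.
have h0h : h0 <= dd_h dd by exact: dd_theta_le.
have h0d : h0 <= delta by rewrite ler_piMl// ltW.
(* On the strip |x - z| <= 2 delta + 5 h0 <= 7 delta and 1 + d_z <= 2. The product 14 delta bounds
   both dimensional factors of the integrand at once. *)
pose A := ((14 * delta) ^+ n.+1)^-1 * (1 - s).
have A0 : 0 <= A by rewrite mulr_ge0 ?invr_ge0 ?exprn_ge0 ?mulr_ge0// ltW.
have := strip_weight s0 s1 bp ce h00 h0h.
set S := fun z => (z \notin Omega) && (enorm (z - p) <= 5 * h0) && (0 < d_ z <= h0).
move=> H.
apply: (@le_trans _ _ (\int[leb]_z (A * ([?S z] * d_ z `^ (- s)))%:E)%E); last first.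
  apply: nneg_le_integral => z _; first by nng.
  rewrite lee_fin; have [Sz|_] := boolP (S z); last first.
    by rewrite mul0r mulr0; apply: mulr_ge0; [exact: powR_ge0|exact/wgt_ge0/ltW].
  have /andP[/andP[zO zp] /andP[dz dh]] := Sz.
  rewrite /wgt zO !mul1r /A /mu_density.
  have xz0 : 0 < enorm (x - z).
    apply: lt_le_trans dz (dist_boundary_out_le oO Ox _) => Oz.
    by move/negP : zO; apply; exact/mem_set.
  have xz : enorm (x - z) <= 7 * delta.
    by apply: le_trans (ler_enorm_dist x p z) _; rewrite (enormB p); lra.
  have dz1 : 1 + d_ z <= 2 by have := dd_h1 dd; lra.
  set a := _^-1; set b := (1 + _) ^- _.
  have -> : a * (1 - s) * d_ z `^ (- s) = (1 - s) * d_ z `^ (- s) * a by ring.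
  rewrite [leRHS](_ : _ = (1 - s) * d_ z `^ (- s) * (enorm (x - z) `^ (- n.+1%:R) * b)); last by ring.
  apply: ler_wpM2l; first by rewrite mulr_ge0 ?powR_ge0// ltW.
  rewrite /a /b.
  rewrite powRN powR_mulrn ?enorm_ge0// -invfM lef_pV2; last 2 first.
  - by rewrite posrE exprn_gt0// mulr_gt0.
  - by rewrite posrE mulr_gt0// exprn_gt0//; lra.
  rewrite -exprMn; apply: lerXn2r; rewrite ?nnegrE ?mulr_ge0 ?enorm_ge0//; [lra|lra|].
  apply: (@le_trans _ _ (7 * delta * 2)); last lra.
  by apply: ler_pM => //; [exact: enorm_ge0|lra].
rewrite integralZl_EFin; [|by rewrite /S; mea|by nng|by []].
have A0' : (0 <= A%:E)%E by rewrite lee_fin.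
apply: le_trans _ (lee_wpmul2l A0' H).
rewrite -EFinM lee_fin /A.
have -> : ((14 * delta) ^+ n.+1)^-1 * (1 - s) *
   (s * ((kappa * h0 / n.+2%:R) ^+ n.+1 / (3 * h0)) * (h0 `^ (1 - s) / (2 * (1 - s)))) =
   s / 6 * (((14 * delta)^-1 * (kappa * h0 / n.+2%:R)) ^+ n.+1) * (h0^-1 * h0 `^ (1 - s)).
  set X := kappa * h0 / _; rewrite [((14 * delta)^-1 * X) ^+ _]exprMn exprVn.
  have G0 : (14 * delta) ^+ n.+1 != 0 by rewrite gt_eqF// exprn_gt0// mulr_gt0.
  move: G0; set G := (14 * delta) ^+ _; set Y := X ^+ _ => G0; field.
  by rewrite ?G0 ?gt_eqF//=.
have -> : h0^-1 * h0 `^ (1 - s) = h0 `^ (- s).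
  by rewrite -powR_inv1 ?(ltW h00)// -powRD_gt0//; congr (_ `^ _); ring.
have -> : (14 * delta)^-1 * (kappa * h0 / n.+2%:R) = kappa * dd_theta / (14 * n.+2%:R).
  rewrite /h0; field. by rewrite ?gt_eqF//=.
set B := (_ / _) ^+ _.
have B0 : 0 <= B by rewrite exprn_ge0// divr_ge0// mulr_ge0// ltW.
apply: ler_pM.
- by rewrite divr_ge0// mulr_ge0// ltW.
- exact: powR_ge0.
- by rewrite mulrAC; apply: ler_wpM2r => //; rewrite ler_pM2r.
- rewrite !powRN lef_pV2 ?posrE ?powR_gt0//.
  by apply: ge0_ler_powR; rewrite ?nnegrE ?(ltW s0) ?(ltW h00) ?(ltW d0).
Qed.

Lemma mass_lty s x : 0 < s -> s < 1 -> Omega x -> (mass s x < +oo)%E.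
Proof.
move=> s0 s1 Ox; have d0 := dist_in_gt0 Ox.
have w0 z := wgt_ge0 z (ltW s1); have mw := measurable_wgt s.
apply: (@le_lt_trans _ _ (\int[leb]_z (d_ x `^ (- n.+1%:R) * wgt s z)%:E)%E); last first.
  rewrite integralZl_EFin; [|by []|by []|by nng].
  by rewrite lte_mul_pinfty ?lee_fin ?powR_ge0//; exact: (mu_s_finite dd s0 s1).
apply: nneg_le_integral => z _; first by nng.
rewrite lee_fin /wgt; have [zO|zO] := boolP (z \in Omega); first by rewrite mul0r !mulr0.
have Oz : ~ Omega z by move=> Oz; move/negP : zO; apply; exact/mem_set.
have xz := dist_boundary_in_le oO Ox Oz.
apply: ler_wpM2r; first by rewrite mul1r mu_density_ge0// ltW.
rewrite !powRN lef_pV2 ?posrE ?powR_gt0//; last exact: lt_le_trans xz.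
by apply: ge0_ler_powR; rewrite ?nnegrE ?enorm_ge0 ?(ltW d0).
Qed.

End mass_lower.

(** * Integrals of products of singular kernels over the domain *)

Section kernels.
Context {R : realType} {n : nat} {Omega : set 'rV[R]_n.+1}.
Variable dd : domain_data Omega.
Local Notation leb := (@lebesgue_rV R n.+1).
Local Notation d_ := (dist_boundary Omega).
Local Notation dim := (n.+1%:R : R).
Local Notation rC := (@radialC R n.+1).

Let oO := dd_open dd.
Let mO := measurable_domain dd.

Definition dom_vol : R := fine (leb Omega).

Lemma dom_volE : leb Omega = dom_vol%:E.
Proof. by rewrite /dom_vol fineK// ge0_fin_numE// (lebesgue_domain_lty dd). Qed.

Lemma dom_vol_ge0 : 0 <= dom_vol. Proof. by rewrite fine_ge0. Qed.

Lemma radialC_ge0 : 0 <= rC. Proof. by rewrite /radialC; nng. Qed.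

Lemma integral_domain1 : (\int[leb]_x [?x \in Omega]%:E = dom_vol%:E)%E.
Proof.
rewrite -dom_volE; transitivity (\int[leb]_x (\1_Omega x)%:E)%E; first exact: eq_integral.
by rewrite integral_indic ?setIT.
Qed.

Lemma powR_decr (a b c : R) : 0 < a -> a <= b -> 0 <= c -> b `^ (- c) <= a `^ (- c).
Proof.
move=> a0 ab c0; have b0 := lt_le_trans a0 ab.
rewrite !powRN lef_pV2 ?posrE ?powR_gt0//.
by apply: ge0_ler_powR; rewrite ?nnegrE ?(ltW a0) ?(ltW b0).
Qed.

Lemma kernel_L1 (s : R) z : 0 < s -> s < 1 ->
  (\int[leb]_x ([?x \in Omega] * enorm (x - z) `^ (s - dim))%:E <= (rC / s + dom_vol)%:E)%E.
Proof.
move=> s0 s1; have sd : s <= dim by apply: le_trans (ltW s1) _; rewrite ler1n.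
apply: (@le_trans _ _ (\int[leb]_x (([?enorm (x - z) <= 1] * enorm (x - z) `^ (s - dim))%:E + [?x \in Omega]%:E))%E).
  apply: nneg_le_integral => x _; first by nng.
  rewrite -EFinD lee_fin; have [_|_] := boolP (x \in Omega); last by rewrite mul0r; nng.
  rewrite mul1r; have [xz|xz] := leP (enorm (x - z)) 1; first by rewrite mul1r lerDl.
  have ds : 0 <= dim - s by rewrite subr_ge0.
  by have := powR_decr ltr01 (ltW xz) ds; rewrite opprB powR1 mul0r add0r.
rewrite ge0_integralD//; try (by nng); try (by mea).
rewrite EFinD integral_domain1; apply: leeD => //.
by have := @radial_near R n.+1 z 1 s ltr01 s0 s1; rewrite powR1 mul1r.
Qed.

Definition separation z y : R := enorm (z - y) + d_ z + d_ y.

Local Notation sep := separation.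

Lemma sepC z y : sep z y = sep y z.
Proof. by rewrite /sep enormB addrAC. Qed.

(** d_z and d_y are at most the distances from x. Consequently at least one of |x - z| and |x - y|
    is at least a quarter of the separation, which drives the case splits below. *)
Lemma sep_le x y z : Omega x -> ~ Omega z -> ~ Omega y ->
  sep z y <= 2 * (enorm (x - z) + enorm (x - y)).
Proof.
move=> Ox Oz Oy.
have h1 := dist_boundary_out_le oO Ox Oz; have h2 := dist_boundary_out_le oO Ox Oy.
have := ler_enorm_dist z x y; rewrite (enormB z x) /sep; lra.
Qed.

Lemma sep_min (s : R) z y : s <= dim -> 0 < sep z y ->
  sep z y `^ (s - dim) <= Num.min (sep z y) 1 `^ (s - dim).
Proof.
move=> sd S0; rewrite -opprB; apply: powR_decr.
- by rewrite lt_min S0 ltr01.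
- by rewrite ge_min lexx.
- by rewrite subr_ge0.
Qed.

Lemma sep_quarter (s : R) z y : 0 <= s -> s <= dim -> 0 < sep z y ->
  (sep z y / 4) `^ (s - dim) <= 4 ^+ n.+1 * Num.min (sep z y) 1 `^ (s - dim).
Proof.
move=> s0 sd S0.
rewrite powRM ?(ltW S0) ?invr_ge0// mulrC; apply: ler_pM; rewrite ?powR_ge0//.
  rewrite -powR_inv1// -powRrM mulN1r opprB -powR_mulrn//.
  by apply: ler_powR; [rewrite ler1n|lra].
exact: sep_min.
Qed.

Definition kernel_extC (s_lo : R) : R :=
  5 * 4 ^+ n.+1 * 2 ^+ n.+1 * (rC / s_lo) + 2 ^+ n.+1 * (rC / s_lo + dom_vol).

Lemma kernel_extC_ge0 (s_lo : R) : 0 < s_lo -> 0 <= kernel_extC s_lo.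
Proof.
move=> sl0; have q0 : 0 <= rC / s_lo by rewrite divr_ge0 ?radialC_ge0// ltW.
have v0 := dom_vol_ge0; rewrite /kernel_extC; move: (rC / s_lo) q0 => q q0.
by rewrite addr_ge0// !mulr_ge0// ?exprn_ge0// addr_ge0.
Qed.

(** Put q = [sep z y] / 4. Where |x - z| > q, the first kernel is at most q^(s-d) and the second is
    integrated as a tail beyond d_y. Where |x - z| <= q, the second is at most q^(-d-s) and the
    first is integrated on a ball. Both pieces are of order q^(s-d) d_y^(-s), since d_y <= 4q. *)
Lemma kernel_exterior (s_lo s : R) z y : 0 < s_lo -> s_lo <= s -> s < 1 ->
  ~ Omega z -> ~ Omega y -> 0 < d_ y ->
  (\int[leb]_x ([?x \in Omega] * (enorm (x - z) `^ (s - dim) * enorm (x - y) `^ (- (dim + s))))%:E <=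
   (kernel_extC s_lo * (Num.min (sep z y) 1 `^ (s - dim) * (d_ y `^ (- s) * (1 + d_ y) ^- n.+1)))%:E)%E.
Proof.
move=> sl0 sls s1 Oz Oy dy.
have s0 : 0 < s by exact: lt_le_trans sls.
have d1 : 1 <= dim by rewrite ler1n.
have sd : s <= dim by lra.
have rC0 := radialC_ge0; have V0 := dom_vol_ge0.
have rCs : rC / s <= rC / s_lo by rewrite ler_wpM2l// lef_pV2.
have rCs0 : 0 <= rC / s by rewrite divr_ge0// ltW.
have rCl0 := le_trans rCs0 rCs.
have dz0 : 0 <= d_ z by exact: dist_set_ge0.
have S0 : 0 < sep z y by rewrite /sep ltr_wpDl// addr_ge0// enorm_ge0.
have Sy : d_ y <= sep z y by rewrite /sep lerDr addr_ge0// enorm_ge0.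
set J := Num.min (sep z y) 1 `^ (s - dim).
have J0 : 0 <= J by exact: powR_ge0.
set Y := (1 + d_ y) ^- n.+1.
have Y0 : 0 <= Y by rewrite invr_ge0 exprn_ge0//; lra.
have Ds0 : 0 <= d_ y `^ (- s) by exact: powR_ge0.
have K1 : 0 <= 5 * 4 ^+ n.+1 * 2 ^+ n.+1 * (rC / s_lo).
  by apply: mulr_ge0 => //; nng.
have K2 : 0 <= 2 ^+ n.+1 * (rC / s_lo + dom_vol).
  by apply: mulr_ge0; [nng|exact: addr_ge0].
have Q0 : 0 <= J * (d_ y `^ (- s) * Y) by rewrite !mulr_ge0.
have [y1|y1] := leP (d_ y) 1.
(* For d_y <= 1 the factor (1 + d_y)^(-d) is at least 2^(-d) and may be inserted. *)
- have Y2 : 1 <= 2 ^+ n.+1 * Y.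
    rewrite /Y -exprVn -exprMn exprn_ege1// ler_pdivlMr; lra.
  have q0 : 0 < sep z y / 4 by rewrite divr_gt0.
  set q := sep z y / 4 in q0.
  apply: (@le_trans _ _ (\int[leb]_x ((q `^ (s - dim) * ([?d_ y <= enorm (x - y)] * enorm (x - y) `^ (- s - dim)))%:E +
    (q `^ (- (dim + s)) * ([?enorm (x - z) <= q] * enorm (x - z) `^ (s - dim)))%:E))%E).
    apply: nneg_le_integral => x _; first by nng.
    rewrite -EFinD lee_fin; have [xO|_] := boolP (x \in Omega); last by rewrite mul0r; nng.
    have Ox := set_mem xO; rewrite mul1r.
    have -> : - s - dim = - (dim + s) by ring.
    rewrite (dist_boundary_out_le oO Ox Oy) mul1r.
    have := sep_le Ox Oz Oy; have := q0; rewrite /q => q0' Hs.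
    have [xz|xz] := leP (enorm (x - z)) (sep z y / 4).
      rewrite mul1r -[leLHS]add0r; apply: lerD; first by nng.
      rewrite mulrC; apply: ler_wpM2r; first by nng.
      by apply: powR_decr; lra.
    rewrite mul0r mulr0 addr0; apply: ler_wpM2r; first by nng.
    by rewrite -(opprB dim s); apply: powR_decr; lra.
  rewrite ge0_integralD//; try (by nng); try (by mea).
  have E1 : (\int[leb]_x (q `^ (s - dim) * ([?d_ y <= enorm (x - y)] * enorm (x - y) `^ (- s - dim)))%:E <=
      (q `^ (s - dim))%:E * (rC * (d_ y `^ (- s) / s))%:E)%E.
    rewrite integralZl_EFin; [|by mea|by move=> x; rewrite mulr_ge0 ?powR_ge0|exact: powR_ge0].
    by apply: lee_wpmul2l; [rewrite lee_fin powR_ge0|exact: radial_tail].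
  have E2 : (\int[leb]_x (q `^ (- (dim + s)) * ([?enorm (x - z) <= q] * enorm (x - z) `^ (s - dim)))%:E <=
      (q `^ (- (dim + s)))%:E * (rC * (q `^ s / s))%:E)%E.
    rewrite integralZl_EFin; [|by mea|by move=> x; rewrite mulr_ge0 ?powR_ge0|exact: powR_ge0].
    by apply: lee_wpmul2l; [rewrite lee_fin powR_ge0|exact: radial_near].
  apply: (le_trans (leeD E1 E2)).
  rewrite -!EFinM -EFinD lee_fin.
  have qs : q `^ (- (dim + s)) * q `^ s = q `^ (s - dim) * q `^ (- s).
    by rewrite -!powRD_gt0//; congr (_ `^ _); ring.
  have qd : q `^ (- s) <= 4 * d_ y `^ (- s).
    have -> : q `^ (- s) = (sep z y) `^ (- s) * 4 `^ s.
      rewrite /q powRM ?(ltW S0) ?invr_ge0//; congr (_ * _).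
      by rewrite -powR_inv1// -powRrM mulN1r opprK.
    rewrite mulrC; apply: ler_pM; rewrite ?powR_ge0//.
      by rewrite -[leRHS]powRr1//; apply: ler_powR; [rewrite ler1n|exact: ltW].
    by apply: powR_decr => //; exact: ltW.
  (* The factor 5 is 1 + 4: the tail gives d_y^(-s) and the ball gives q^(-s) <= 4 d_y^(-s). *)
  apply: (@le_trans _ _ (q `^ (s - dim) * (rC / s) * (5 * d_ y `^ (- s)))).
    have -> : q `^ (s - dim) * (rC * (d_ y `^ (- s) / s)) + q `^ (- (dim + s)) * (rC * (q `^ s / s)) =
      q `^ (s - dim) * (rC / s) * (d_ y `^ (- s)) + (q `^ (- (dim + s)) * q `^ s) * (rC / s) by ring.
    rewrite qs.
    have -> : q `^ (s - dim) * (rC / s) * d_ y `^ (- s) + q `^ (s - dim) * q `^ (- s) * (rC / s) =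
      q `^ (s - dim) * (rC / s) * (d_ y `^ (- s) + q `^ (- s)) by ring.
    by apply: ler_wpM2l; [nng|lra].
  apply: (@le_trans _ _ ((4 ^+ n.+1 * J) * (rC / s_lo) * (5 * d_ y `^ (- s)) * (2 ^+ n.+1 * Y))).
    rewrite -[leLHS]mulr1; apply: ler_pM => //; first by nng.
    apply: ler_wpM2r; first by nng.
    by apply: ler_pM => //; [nng|apply: sep_quarter => //; exact: ltW].
  rewrite (_ : 4 ^+ n.+1 * J * (rC / s_lo) * (5 * d_ y `^ (- s)) * (2 ^+ n.+1 * Y) =
    (5 * 4 ^+ n.+1 * 2 ^+ n.+1 * (rC / s_lo)) * (J * (d_ y `^ (- s) * Y))); last by ring.
  by rewrite /kernel_extC; apply: ler_wpM2r => //; rewrite lerDl.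
(* For d_y > 1 the truncated separation is 1. All of Omega is far from y, so the second kernel is
   bounded by d_y^(-d-s), which also supplies the decay (1 + d_y)^(-d). *)
- have J1 : J = 1.
    rewrite /J (_ : Num.min _ _ = 1) ?powR1//; apply/min_idPr; lra.
  have y0 : d_ y `^ (- dim) <= 2 ^+ n.+1 * Y.
    rewrite powRN powR_mulrn ?dist_set_ge0// /Y -[leLHS]mul1r ler_pdivrMr ?exprn_gt0//.
    rewrite mulrAC ler_pdivlMr ?mul1r; last by rewrite exprn_gt0//; lra.
    by rewrite -exprMn; apply: lerXn2r; rewrite ?nnegrE; lra.
  apply: (@le_trans _ _ (\int[leb]_x ((d_ y `^ (- s) * (2 ^+ n.+1 * Y)) * ([?x \in Omega] * enorm (x - z) `^ (s - dim)))%:E)%E).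
    apply: nneg_le_integral => x _; first by nng.
    rewrite lee_fin; have [xO|_] := boolP (x \in Omega); last by rewrite !mul0r mulr0.
    rewrite !mul1r mulrC; apply: ler_wpM2r; first by nng.
    apply: (@le_trans _ _ (d_ y `^ (- (dim + s)))).
      by apply: powR_decr; [by []|exact: dist_boundary_out_le oO (set_mem xO) Oy|lra].
    rewrite opprD powRD_gt0// mulrC; apply: ler_wpM2l => //.
  rewrite integralZl_EFin; [|by mea|by nng|by nng].
  apply: (@le_trans _ _ ((d_ y `^ (- s) * (2 ^+ n.+1 * Y))%:E * (rC / s + dom_vol)%:E)%E).
    by apply: lee_wpmul2l; [nng|exact: kernel_L1].
  rewrite -EFinM lee_fin J1 mul1r.
  apply: (@le_trans _ _ ((2 ^+ n.+1 * (rC / s_lo + dom_vol)) * (d_ y `^ (- s) * Y))).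
    rewrite (_ : d_ y `^ (- s) * (2 ^+ n.+1 * Y) * (rC / s + dom_vol) =
      (2 ^+ n.+1 * (rC / s + dom_vol)) * (d_ y `^ (- s) * Y)); last by ring.
    apply: ler_wpM2r; first by nng.
    by apply: ler_wpM2l; [nng|rewrite lerD2r].
  by rewrite /kernel_extC; apply: ler_wpM2r; [nng|rewrite lerDr].
Qed.

End kernels.

Section kernel_interior.
Context {R : realType} {n : nat} {Omega : set 'rV[R]_n.+1}.
Variable dd : domain_data Omega.
Local Notation leb := (@lebesgue_rV R n.+1).
Local Notation d_ := (dist_boundary Omega).
Local Notation dim := (n.+1%:R : R).
Local Notation rC := (@radialC R n.+1).
Local Notation sep := (@separation R n Omega).

Let oO := dd_open dd.
Let mO := measurable_domain dd.

(* The only estimate that degenerates as s -> 1 in dimension one: the far part of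
   the integral decays like the power s - d of the distance. *)
Lemma kernel_interior (s_lo sigma s : R) z w : 0 < s_lo -> s_lo <= s -> s < 1 ->
  0 < sigma -> sigma <= dim - s -> ~ Omega z -> ~ Omega w -> 0 < d_ z ->
  (\int[leb]_x ([?x \in Omega] * (d_ x `^ s * (enorm (x - z) `^ (- dim) * enorm (x - w) `^ (- dim))))%:E <=
   (2 * 4 ^+ n.+1 * (rC / s_lo + rC / sigma) * Num.min (sep z w) 1 `^ (s - dim))%:E)%E.
Proof.
move=> sl0 sls s1 sg0 sgs Oz Ow dz.
have s0 : 0 < s by exact: lt_le_trans sls.
have d1 : 1 <= dim by rewrite ler1n.
have sd : s <= dim by lra.
have ds0 : 0 < dim - s by lra.
have rC0 : 0 <= rC by exact: radialC_ge0.
have rCs : rC / s <= rC / s_lo by rewrite ler_wpM2l// lef_pV2.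
have rCg : rC / (dim - s) <= rC / sigma by rewrite ler_wpM2l// lef_pV2.
have dw0 : 0 <= d_ w by exact: dist_set_ge0.
have S0 : 0 < sep z w.
  by have := enorm_ge0 (z - w); rewrite /sep; lra.
have q0 : 0 < sep z w / 4 by rewrite divr_gt0.
set q := sep z w / 4 in q0.
(* Majorant of the integrand where a is the closer of z and w, with d_x^s <= |x - a|^s absorbed.
   Within q of a the other factor is at most q^(-d); farther away it is at most |x - a|^(-d),
   leaving |x - a|^(s-2d). *)
pose F (a x : 'rV[R]_n.+1) : R := q `^ (- dim) * ([?enorm (x - a) <= q] * enorm (x - a) `^ (s - dim)) +
   [?q <= enorm (x - a)] * enorm (x - a) `^ (- (dim - s) - dim).
have F0 a x : 0 <= F a x by rewrite /F; nng.
have mF a : measurable_fun [set: 'rV[R]_n.+1] (F a) by rewrite /F; mea.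
have IF a : (\int[leb]_x (F a x)%:E <= ((rC / s_lo + rC / sigma) * q `^ (s - dim))%:E)%E.
  under eq_integral do rewrite /F EFinD.
  rewrite ge0_integralD//; try (by nng); try (by mea).
  rewrite integralZl_EFin; [|by mea|by nng|by nng].
  apply: (@le_trans _ _ ((q `^ (- dim))%:E * (rC * (q `^ s / s))%:E +
     (rC * (q `^ (- (dim - s)) / (dim - s)))%:E)%E).
    apply: leeD; first by apply: lee_wpmul2l; [nng|exact: radial_near].
    by apply: radial_tail => //; lra.
  rewrite -EFinM -EFinD lee_fin.
  have -> : q `^ (- dim) * (rC * (q `^ s / s)) = rC / s * q `^ (s - dim).
    by rewrite powRD_gt0//; ring.
  rewrite opprB mulrDl; apply: lerD; first by apply: ler_wpM2r => //; nng.
  by rewrite mulrA mulrAC; apply: ler_wpM2r => //; nng.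
have one a b x : Omega x -> ~ Omega a -> ~ Omega b -> sep a b = sep z w ->
    enorm (x - a) <= enorm (x - b) ->
    d_ x `^ s * (enorm (x - a) `^ (- dim) * enorm (x - b) `^ (- dim)) <= F a x.
  move=> Ox Oa Ob Sab ab.
  have xa := dist_boundary_in_le oO Ox Oa.
  have dx := dist_in_gt0 dd Ox.
  have a0 : 0 < enorm (x - a) by exact: lt_le_trans xa.
  have b0 : 0 < enorm (x - b) by exact: lt_le_trans ab.
  have H1 : d_ x `^ s * enorm (x - a) `^ (- dim) <= enorm (x - a) `^ (s - dim).
    rewrite powRD_gt0//; apply: ler_wpM2r; first by nng.
    by apply: ge0_ler_powR; rewrite ?nnegrE ?(ltW s0) ?(ltW dx) ?(ltW a0).
  have := sep_le dd Ox Oa Ob; rewrite Sab => Hs.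
  rewrite mulrA /F; have [aq|aq] := leP (enorm (x - a)) q.
    rewrite mul1r -[leLHS]addr0; apply: lerD; last by nng.
    rewrite [leRHS]mulrC; apply: (ler_pM _ _ H1); [by rewrite mulr_ge0 ?powR_ge0|exact: powR_ge0|].
    by apply: powR_decr; [exact: q0|rewrite /q; lra|exact: ler0n].
  rewrite (ltW aq) mul0r mulr0 add0r mul1r.
  have -> : - (dim - s) - dim = (s - dim) - dim by ring.
  rewrite [leRHS]powRD_gt0; last exact: a0.
  apply: (ler_pM _ _ H1); [by rewrite mulr_ge0 ?powR_ge0|exact: powR_ge0|].
  by apply: powR_decr; [exact: a0|exact: ab|exact: ler0n].
apply: (@le_trans _ _ (\int[leb]_x ((F z x)%:E + (F w x)%:E))%E).
  apply: nneg_le_integral => x _; first by nng.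
  rewrite -EFinD lee_fin; have [xO|_] := boolP (x \in Omega); last by rewrite mul0r addr_ge0.
  rewrite mul1r; have Ox := set_mem xO.
  have [zw|/ltW wz] := leP (enorm (x - z)) (enorm (x - w)).
    by apply: le_trans (one _ _ _ Ox Oz Ow erefl zw) _; rewrite lerDl.
  rewrite (mulrC (enorm (x - z) `^ _)).
  by apply: le_trans (one _ _ _ Ox Ow Oz (sepC _ _) wz) _; rewrite lerDr.
rewrite ge0_integralD//; try (by mea); try (by move=> x _; rewrite lee_fin).
apply: (le_trans (leeD (IF z) (IF w))).
rewrite -EFinD lee_fin.
have A0 : 0 <= rC / s_lo + rC / sigma by rewrite addr_ge0// divr_ge0// ltW.
move: (rC / s_lo + rC / sigma) A0 => A A0.
have := ler_wpM2l A0 (@sep_quarter R n Omega s z w (ltW s0) sd S0); rewrite -/q; lra.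
Qed.

End kernel_interior.

(** * Weighted averages and iterated integrals *)

Section averages.
Context {d : measure_display} {T : measurableType d} {R : realType}.
Variable m : {measure set T -> \bar R}.
Implicit Types (k l f : T -> R).

Definition average k f : R :=
  fine (\int[m]_z (k z * f z)%:E)%E / fine (\int[m]_z (k z)%:E)%E.

Section kernel.
Variables (k f : T -> R).
Hypotheses (mk : measurable_fun setT k) (k0 : forall z, 0 <= k z).
Hypotheses (mf : measurable_fun setT f).
Hypotheses (kpos : (0 < \int[m]_z (k z)%:E)%E) (klty : (\int[m]_z (k z)%:E < +oo)%E).
Hypotheses (kflty : (\int[m]_z (k z * `|f z|)%:E < +oo)%E).

Let M := fine (\int[m]_z (k z)%:E)%E.

Lemma kernel_mass : (\int[m]_z (k z)%:E)%E = M%:E.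
Proof. by rewrite fineK// ge0_fin_numE// ltW. Qed.

Lemma kernel_mass_gt0 : 0 < M.
Proof. by rewrite -lte_fin -kernel_mass. Qed.

Lemma integrable_kernel : m.-integrable setT (EFin \o k).
Proof.
apply/integrableP; split; first exact/measurable_EFinP.
by under eq_integral do rewrite /= ger0_norm//.
Qed.

Lemma integrable_kernelM : m.-integrable setT (EFin \o (fun z => k z * f z)).
Proof.
apply/integrableP; split; first by apply/measurable_EFinP; mea.
by under eq_integral do rewrite /= normrM ger0_norm//.
Qed.

Lemma integrable_kernelB c : m.-integrable setT (EFin \o (fun z => k z * (f z - c))).
Proof.
have ik : m.-integrable setT (EFin \o (fun z => c * k z)).
  by apply: (eq_integrable _ _ _ _ (integrableZl measurableT c integrable_kernel)).
apply: (eq_integrable _ _ _ _ (integrableB measurableT integrable_kernelM ik)) => //.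
by move=> z _ /=; rewrite -EFinB; congr EFin; ring.
Qed.

Lemma integral_kernelB c :
  (\int[m]_z (k z * (f z - c))%:E)%E = (fine (\int[m]_z (k z * f z)%:E)%E - c * M)%:E.
Proof.
have -> : (\int[m]_z (k z * (f z - c))%:E)%E =
    (\int[m]_z ((k z * f z)%:E - (c * k z)%:E))%E.
  by apply: eq_integral => z _; rewrite -EFinB; congr EFin; ring.
have ik : m.-integrable setT (EFin \o (fun z => c * k z)).
  by apply: (eq_integrable _ _ _ _ (integrableZl measurableT c integrable_kernel)).
rewrite (integralB_EFin measurableT integrable_kernelM ik).
under [X in (_ - X)%E]eq_integral do rewrite EFinM.
rewrite (integralZl measurableT integrable_kernel) kernel_mass EFinB EFinM.
by rewrite (fineK (integrable_fin_num measurableT integrable_kernelM)).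
Qed.

Lemma average_mass : fine (\int[m]_z (k z * f z)%:E)%E = average k f * M.
Proof. by rewrite /average divfK// gt_eqF// kernel_mass_gt0. Qed.

Lemma integral_kernel_average : (\int[m]_z (k z * (f z - average k f))%:E)%E = 0%E.
Proof. by rewrite integral_kernelB average_mass subrr. Qed.

(** Multiplying the deviation by the mass turns it into the absolute value of the integral of k (f -
    c), with no division left. *)
Lemma average_dev c : (`|average k f - c|%:E * M%:E <= \int[m]_z (k z * `|f z - c|)%:E)%E.
Proof.
have -> : (`|average k f - c|%:E * M%:E = `|\int[m]_z (k z * (f z - c))%:E|)%E.
  rewrite integral_kernelB average_mass -mulrBl /= normrM EFinM.
  by rewrite (ger0_norm (ltW kernel_mass_gt0)).
apply: le_trans (le_abse_integral m measurableT _) _.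
  by apply/measurable_EFinP; mea.
by apply: nneg_le_integral => z _; [exact: abse_ge0|rewrite abse_EFin lee_fin normrM ger0_norm].
Qed.

End kernel.

(* Since f - average k f has integral zero against k, only l - k contributes. *)
Lemma average_diff k l f (e : R) : measurable_fun setT k -> (forall z, 0 <= k z) ->
  measurable_fun setT l -> (forall z, 0 <= l z) -> measurable_fun setT f ->
  (0 < \int[m]_z (k z)%:E)%E -> (\int[m]_z (k z)%:E < +oo)%E ->
  (0 < \int[m]_z (l z)%:E)%E -> (\int[m]_z (k z * `|f z|)%:E < +oo)%E ->
  0 <= e -> (forall z, `|l z - k z| <= e * k z) ->
  (`|average l f - average k f|%:E * \int[m]_z (l z)%:E <=
   e%:E * \int[m]_z (k z * `|f z - average k f|)%:E)%E.
Proof.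
move=> mk k0 ml l0 mf kpos klty lpos kflty e0 lk.
have lek z : l z <= (1 + e) * k z.
  by have := lk z; rewrite ler_norml => /andP[_]; lra.
have e1 : 0 <= 1 + e by lra.
have scale (h : T -> R) : measurable_fun setT h -> (forall z, 0 <= h z) ->
    (\int[m]_z (k z * h z)%:E < +oo)%E -> (\int[m]_z (l z * h z)%:E < +oo)%E.
  move=> mh h0 kh; apply: (@le_lt_trans _ _ (\int[m]_z ((1 + e)%:E * (k z * h z)%:E))%E).
    apply: nneg_le_integral => z _; first by rewrite lee_fin mulr_ge0.
    by rewrite -EFinM lee_fin mulrA ler_wpM2r.
  rewrite ge0_integralZl//; last 2 first.
  - by apply/measurable_EFinP; mea.
  - by move=> z _; rewrite lee_fin mulr_ge0.
  by rewrite lte_mul_pinfty.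
have llty : (\int[m]_z (l z)%:E < +oo)%E.
  have := scale (cst 1) (measurable_cst _) (fun=> ler01).
  rewrite (_ : (fun z => (k z * _)%:E) = EFin \o k); last by apply/funext => z /=; rewrite mulr1.
  rewrite (_ : (fun z => (l z * _)%:E) = EFin \o l); last by apply/funext => z /=; rewrite mulr1.
  exact.
have lflty : (\int[m]_z (l z * `|f z|)%:E < +oo)%E by apply: scale => //; mea.
set c := average k f.
have -> : (`|average l f - c|%:E * \int[m]_z (l z)%:E = `|\int[m]_z (l z * (f z - c))%:E|)%E.
  rewrite integral_kernelB// average_mass// -mulrBl /= normrM EFinM kernel_mass//.
  by rewrite (ger0_norm (ltW (kernel_mass_gt0 lpos llty))).
have -> : (\int[m]_z (l z * (f z - c))%:E = \int[m]_z ((l z - k z) * (f z - c))%:E)%E.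
  have := integral_kernel_average mk k0 mf kpos klty kflty; rewrite -/c => K0.
  rewrite -[LHS]sube0 -K0 -(integralB_EFin measurableT)//; try exact: integrable_kernelB.
  by apply: eq_integral => z _; rewrite -EFinB; congr EFin; ring.
apply: le_trans (le_abse_integral m measurableT _) _.
  by apply/measurable_EFinP; mea.
rewrite -ge0_integralZl//; last 2 first.
- by apply/measurable_EFinP; mea.
- by move=> z _; rewrite lee_fin mulr_ge0.
apply: nneg_le_integral => z _; first exact: abse_ge0.
by rewrite abse_EFin -EFinM lee_fin normrM mulrA ler_wpM2r.
Qed.

End averages.

Lemma tonelli3 {d : measure_display} {T : measurableType d} {R : realType}
    (m : {sigma_finite_measure set T -> \bar R}) (F : T -> T -> T -> R) :
  measurable_fun setT (fun w : T * (T * T) => F w.1 w.2.1 w.2.2) ->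
  (forall x y z, 0 <= F x y z) ->
  (\int[m]_x \int[m]_y \int[m]_z (F x y z)%:E =
   \int[m]_y \int[m]_z \int[m]_x (F x y z)%:E)%E.
Proof.
move=> mF F0.
pose G (p : T * T) := (\int[m]_z (F p.1 p.2 z)%:E)%E.
have G0 p : (0 <= G p)%E by apply: integral_ge0 => z _; rewrite lee_fin.
have mF' : measurable_fun setT (fun p : (T * T) * T => (F p.1.1 p.1.2 p.2)%:E).
  apply/measurable_EFinP; pose h (p : (T * T) * T) := (p.1.1, (p.1.2, p.2)).
  have mh : measurable_fun setT h by do ?apply: measurable_fun_pair; mea.
  exact: (measurableT_comp mF mh).
have mG : measurable_fun setT G.
  by apply: (measurable_fun_fubini_tonelli_F _ mF') => p; rewrite lee_fin.
transitivity (\int[m]_y \int[m]_x G (x, y))%E; first exact: (fubini_tonelli G mG G0).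
apply: eq_integral => y _.
pose H (p : T * T) := (F p.1 y p.2)%:E.
have mH : measurable_fun setT H.
  apply/measurable_EFinP; pose h (p : T * T) := (p.1, (y, p.2)).
  have mh : measurable_fun setT h by do ?apply: measurable_fun_pair; mea.
  exact: (measurableT_comp mF mh).
have H0 p : (0 <= H p)%E by rewrite lee_fin.
exact: (fubini_tonelli H mH H0).
Qed.

(** * The extension *)

Section extension_kernel.
Context {R : realType} {n : nat} {Omega : set 'rV[R]_n.+1}.
Variable dd : domain_data Omega.
Local Notation leb := (@lebesgue_rV R n.+1).
Local Notation d_ := (dist_boundary Omega).
Local Notation dim := (n.+1%:R : R).
Local Notation wgt := (@exterior_weight R n Omega).
Local Notation mass := (@exterior_mass R n Omega).

Let oO := dd_open dd.
Let mO := measurable_domain dd.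

Variable s : R.
Hypotheses (s0 : 0 < s) (s1 : s < 1).

Definition ext_ker (x z : 'rV[R]_n.+1) : R := enorm (x - z) `^ (- dim) * wgt s z.

Let w0 z : 0 <= wgt s z. Proof. exact: wgt_ge0 (ltW s1). Qed.
Let mw : measurable_fun setT (wgt s). Proof. exact: measurable_wgt dd s. Qed.

Lemma ext_ker_ge0 x z : 0 <= ext_ker x z.
Proof. by rewrite mulr_ge0 ?powR_ge0. Qed.

Lemma measurable_ext_ker x : measurable_fun setT (ext_ker x).
Proof. by rewrite /ext_ker; mea. Qed.

Lemma wgt_dom z : z \in Omega -> wgt s z = 0.
Proof. by move=> zO; rewrite /exterior_weight zO mul0r. Qed.

Lemma ext_ker_le x z : Omega x -> ext_ker x z <= d_ x `^ (- dim) * wgt s z.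
Proof.
move=> Ox; rewrite /ext_ker; have [/wgt_dom ->|zO] := boolP (z \in Omega).
  by rewrite !mulr0.
apply: ler_wpM2r => //; apply: powR_decr; [exact: dist_in_gt0 dd _ Ox| |exact: ler0n].
by apply: dist_boundary_in_le => //; move/negP : zO => zO Oz; apply: zO; exact/mem_set.
Qed.

Variables (c : R).
Hypotheses (c0 : 0 < c)
  (Hc : forall x, Omega x -> ((c * d_ x `^ (- s))%:E <= mass s x)%E).

Lemma mass_gt0 x : Omega x -> (0 < mass s x)%E.
Proof.
move=> Ox; apply: lt_le_trans (Hc Ox).
by rewrite lte_fin mulr_gt0// powR_gt0// (dist_in_gt0 dd).
Qed.

Variables (f : 'rV[R]_n.+1 -> R).
Hypothesis mf : measurable_fun setT f.
Hypothesis fint : (\int[leb]_z (wgt s z * `|f z|)%:E < +oo)%E.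

Local Notation A := (fun x => average leb (ext_ker x) f).

Lemma ext_ker_lty x : Omega x -> (\int[leb]_z (ext_ker x z * `|f z|)%:E < +oo)%E.
Proof.
move=> Ox; apply: (@le_lt_trans _ _ (\int[leb]_z (d_ x `^ (- dim) * (wgt s z * `|f z|))%:E)%E).
  apply: nneg_le_integral => z _; first by rewrite lee_fin mulr_ge0// ext_ker_ge0.
  by rewrite lee_fin mulrA ler_wpM2r// ext_ker_le.
rewrite integralZl_EFin; [|by mea|by move=> z; rewrite mulr_ge0|exact: powR_ge0].
by rewrite lte_mul_pinfty// lee_fin powR_ge0.
Qed.

(** The lower bound on the mass in the form used later: dividing by the mass costs d_x^s / c. *)
Lemma average_mass_le x (a : R) : Omega x -> 0 <= a ->
  ((c * a)%:E <= (d_ x `^ s)%:E * (a%:E * mass s x))%E.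
Proof.
move=> Ox a0; have dx := dist_in_gt0 dd Ox.
apply: (@le_trans _ _ ((d_ x `^ s)%:E * (a%:E * (c * d_ x `^ (- s))%:E))%E); last first.
  by rewrite !lee_wpmul2l ?lee_fin ?powR_ge0//; exact: Hc.
rewrite -!EFinM lee_fin.
have -> : d_ x `^ s * (a * (c * d_ x `^ (- s))) = (c * a) * (d_ x `^ s * d_ x `^ (- s)) by ring.
by rewrite -powRD_gt0// subrr powRr0 mulr1.
Qed.

Lemma extension_dev x (g : R) : Omega x ->
  ((c * `|A x - g|)%:E <=
   \int[leb]_z (d_ x `^ s * (enorm (x - z) `^ (- dim) * (wgt s z * `|f z - g|)))%:E)%E.
Proof.
move=> Ox; apply: (le_trans (average_mass_le Ox (normr_ge0 _))).
have := @average_dev _ _ _ leb (ext_ker x) f (measurable_ext_ker x) (ext_ker_ge0 x) mf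
  (mass_gt0 Ox) (mass_lty dd s0 s1 Ox) (ext_ker_lty Ox) g.
rewrite -kernel_mass; [|exact: mass_gt0 Ox|exact: (mass_lty dd s0 s1 Ox)].
move=> H; rewrite integralZl_EFin; [|by mea|by nng; exact: w0|exact: powR_ge0].
apply: lee_wpmul2l; first by rewrite lee_fin powR_ge0.
apply: (le_trans H); rewrite le_eqVlt; apply/orP; left; apply/eqP.
by apply: eq_integral => z _; rewrite /ext_ker mulrA.
Qed.

(** d_x <= |x - z| for exterior z absorbs the factor d_x^s into the kernel, which suits the
    estimates where the other point lies outside Omega. *)
Lemma extension_dev_sup x (g : R) : Omega x ->
  ((c * `|A x - g|)%:E <=
   \int[leb]_z (enorm (x - z) `^ (s - dim) * (wgt s z * `|f z - g|))%:E)%E.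
Proof.
move=> Ox; apply: (le_trans (extension_dev _ Ox)).
apply: nneg_le_integral => z _; first by nng; exact: w0.
rewrite lee_fin mulrA; have [/wgt_dom ->|zO] := boolP (z \in Omega).
  by rewrite mul0r !mulr0.
have Oz : ~ Omega z by move/negP : zO => zO Oz; apply: zO; exact/mem_set.
have dx := dist_in_gt0 dd Ox.
have xz := dist_boundary_in_le oO Ox Oz.
apply: ler_wpM2r; first by rewrite mulr_ge0.
rewrite powRD_gt0; last exact: lt_le_trans xz.
apply: ler_wpM2r; first exact: powR_ge0.
by apply: ge0_ler_powR => //; rewrite ?nnegrE ?enorm_ge0// ltW.
Qed.

Lemma powerB_le (a b r : R) : 0 < a -> 0 < b -> b <= 2 * a -> `|b - a| <= 2 * r * a ->
  `|b ^+ n.+1 - a ^+ n.+1| <= (dim * 2 ^+ n.+1 * r) * a ^+ n.+1.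
Proof.
move=> a0 b0 ba bar.
rewrite subrXX normrM.
have S : `|\sum_(i < n.+1) b ^+ (n.+1.-1 - i) * a ^+ i| <= dim * (2 * a) ^+ n.
  apply: (le_trans (ler_norm_sum _ _ _)).
  apply: (@le_trans _ _ (\sum_(i < n.+1) (2 * a) ^+ n)); last first.
    by rewrite sumr_const card_ord -[leLHS]mulr_natl.
  apply: ler_sum => i _; have ik : (i <= n)%N by rewrite -ltnS.
  rewrite ger0_norm; last by rewrite mulr_ge0 ?exprn_ge0 ?ltW.
  rewrite /= -[X in _ <= _ ^+ X](subnK ik) exprD; apply: ler_pM; rewrite ?exprn_ge0 ?(ltW a0) ?(ltW b0)//.
    by apply: lerXn2r; rewrite ?nnegrE ?(ltW b0)//; lra.
  by apply: lerXn2r; rewrite ?nnegrE ?(ltW a0)//; lra.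
apply: (le_trans (ler_pM (normr_ge0 _) (normr_ge0 _) bar S)).
by rewrite exprMn !exprS; rewrite le_eqVlt; apply/orP; left; apply/eqP; ring.
Qed.

(** |x - z| >= d_x and |x - y| < d_x/2 give 1/|y - z| <= 2/|x - z|, and the two inverses differ by
    at most |x - y| times their product. Factoring the difference of d-th powers finishes. *)
Lemma ext_ker_near x y z : Omega x -> enorm (x - y) < d_ x / 2 ->
  `|ext_ker y z - ext_ker x z| <= (dim * 2 ^+ n.+1 * (enorm (x - y) / d_ x)) * ext_ker x z.
Proof.
move=> Ox xy; rewrite /ext_ker; have [/wgt_dom ->|zO] := boolP (z \in Omega).
  by rewrite !mulr0 subrr normr0.
have Oz : ~ Omega z by move/negP : zO => zO Oz; apply: zO; exact/mem_set.
have dx := dist_in_gt0 dd Ox.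
have xz := dist_boundary_in_le oO Ox Oz.
have a0 : 0 < enorm (x - z) by exact: lt_le_trans xz.
have h1 := ler_enorm_dist x y z.
have h2 := ler_enorm_dist y x z; rewrite (enormB y x) in h2.
have b0 : 0 < enorm (y - z) by lra.
rewrite -mulrBl normrM (ger0_norm (w0 z)) mulrA; apply: ler_wpM2r => //.
rewrite !powRN !powR_mulrn ?enorm_ge0// -!exprVn.
set a := enorm (x - z) in a0 xz h1 h2 *; set b := enorm (y - z) in b0 h1 h2 *.
have ab2 : b^-1 <= 2 * a^-1.
  rewrite -[2]invrK -invfM lef_pV2 ?posrE ?mulr_gt0 ?invr_gt0//; lra.
apply: powerB_le; rewrite ?invr_gt0//.
have -> : b^-1 - a^-1 = (a - b) * (a^-1 * b^-1).
  by field; rewrite !gt_eqF.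
rewrite normrM (ger0_norm (_ : 0 <= a^-1 * b^-1)); last first.
  by rewrite mulr_ge0// invr_ge0 ltW.
have -> : 2 * (enorm (x - y) / d_ x) * a^-1 = enorm (x - y) * ((d_ x)^-1 * (2 * a^-1)) by ring.
apply: ler_pM; rewrite ?normr_ge0 ?mulr_ge0 ?invr_ge0 ?(ltW a0) ?(ltW b0)//.
  by rewrite ler_norml; apply/andP; split; lra.
by apply: ler_pM; rewrite ?invr_ge0 ?(ltW a0) ?(ltW b0)// lef_pV2.
Qed.

(** Used to replace the mass at y, by which [average_diff] divides, by the mass at x. *)
Lemma ext_ker_half x y z : Omega x -> enorm (x - y) < d_ x / 2 ->
  ext_ker x z <= 2 ^+ n.+1 * ext_ker y z.
Proof.
move=> Ox xy; rewrite /ext_ker; have [/wgt_dom ->|zO] := boolP (z \in Omega).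
  by rewrite !mulr0.
have Oz : ~ Omega z by move/negP : zO => zO Oz; apply: zO; exact/mem_set.
have dx := dist_in_gt0 dd Ox.
have xz := dist_boundary_in_le oO Ox Oz.
have a0 : 0 < enorm (x - z) by exact: lt_le_trans xz.
have h1 := ler_enorm_dist x y z.
have h2 := ler_enorm_dist y x z; rewrite (enormB y x) in h2.
have b0 : 0 < enorm (y - z) by lra.
rewrite mulrA; apply: ler_wpM2r => //.
rewrite !powRN !powR_mulrn ?enorm_ge0// -!exprVn -exprMn; apply: lerXn2r.
- by rewrite nnegrE invr_ge0 ltW.
- by rewrite nnegrE mulr_ge0// invr_ge0 ltW.
by rewrite -[2]invrK -invfM lef_pV2 ?posrE ?mulr_gt0 ?invr_gt0//; lra.
Qed.

Lemma extension_near x y : Omega x -> enorm (x - y) < d_ x / 2 ->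
  ((c * `|A y - A x|)%:E <=
   (dim * (2 ^+ n.+1) ^+ 2 * (enorm (x - y) / d_ x))%:E *
   \int[leb]_z (d_ x `^ s * (enorm (x - z) `^ (- dim) * (wgt s z * `|f z - A x|)))%:E)%E.
Proof.
move=> Ox xy; have dx := dist_in_gt0 dd Ox.
have Oy : Omega y.
  by apply/not_notP => Oy; have := dist_boundary_in_le oO Ox Oy; lra.
set e := dim * 2 ^+ n.+1 * (enorm (x - y) / d_ x).
have e0 : 0 <= e by rewrite mulr_ge0 ?divr_ge0 ?enorm_ge0 ?(ltW dx)// mulr_ge0// exprn_ge0.
have mxy : (mass s x <= (2 ^+ n.+1)%:E * mass s y)%E.
  rewrite /exterior_mass -integralZl_EFin; [|exact: measurable_ext_ker|exact: ext_ker_ge0|exact: exprn_ge0].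
  apply: nneg_le_integral => z _; first by rewrite lee_fin; exact: ext_ker_ge0.
  by rewrite lee_fin; exact: ext_ker_half.
have D := @average_diff _ _ _ leb (ext_ker x) (ext_ker y) f e (measurable_ext_ker x)
  (ext_ker_ge0 x) (measurable_ext_ker y) (ext_ker_ge0 y) mf (mass_gt0 Ox)
  (mass_lty dd s0 s1 Ox) (mass_gt0 Oy) (ext_ker_lty Ox) e0 (fun z => ext_ker_near z Ox xy).
apply: (le_trans (average_mass_le Ox (normr_ge0 _))).
apply: (@le_trans _ _ ((d_ x `^ s)%:E * ((2 ^+ n.+1)%:E * (e%:E * \int[leb]_z (ext_ker x z * `|f z - A x|)%:E)))%E).
  apply: lee_wpmul2l; first by rewrite lee_fin powR_ge0.
  apply: (@le_trans _ _ (`|A y - A x|%:E * ((2 ^+ n.+1)%:E * mass s y))%E).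
    exact: lee_wpmul2l.
  by rewrite muleCA; apply: lee_wpmul2l => //; rewrite lee_fin exprn_ge0.
rewrite [in leRHS]integralZl_EFin; [|by mea|by nng; exact: w0|exact: powR_ge0].
under [in leRHS]eq_integral do rewrite mulrA.
rewrite !muleA -!EFinM le_eqVlt; apply/orP; left; apply/eqP; congr (_%:E * _)%E.
by rewrite /e; ring.
Qed.

(** The deviation |f z - A x| is estimated once more by averaging, which produces the differences |f
    q - f z| of the norm of [T_space], at the price of a second factor c. *)
Lemma extension_near2 x y : Omega x -> enorm (x - y) < d_ x / 2 ->
  ((c ^+ 2 * `|A y - A x|)%:E <=
   (dim * (2 ^+ n.+1) ^+ 2 * (enorm (x - y) / d_ x))%:E *
   \int[leb]_z \int[leb]_q
     ((d_ x `^ s * (enorm (x - z) `^ (- dim) * wgt s z)) *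
      (d_ x `^ s * (enorm (x - q) `^ (- dim) * (wgt s q * `|f q - f z|))))%:E)%E.
Proof.
move=> Ox xy; have dx := dist_in_gt0 dd Ox.
rewrite expr2 -mulrA EFinM.
apply: (le_trans (lee_wpmul2l _ (extension_near Ox xy))); first by rewrite lee_fin ltW.
rewrite muleCA; apply: lee_wpmul2l.
  by rewrite lee_fin mulr_ge0 ?divr_ge0 ?enorm_ge0 ?(ltW dx)// mulr_ge0// exprn_ge0// exprn_ge0.
rewrite -integralZl_EFin; [|by mea|by nng; exact: w0|exact: ltW].
apply: nneg_le_integral => z _; first by rewrite lee_fin mulr_ge0 ?(ltW c0)//; nng; exact: w0.
rewrite integralZl_EFin; [|by mea|by nng; exact: w0|by nng; exact: w0].
apply: (@le_trans _ _ ((d_ x `^ s * (enorm (x - z) `^ (- dim) * wgt s z))%:E * (c * `|A x - f z|)%:E)%E).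
  by rewrite -EFinM lee_fin distrC; rewrite le_eqVlt; apply/orP; left; apply/eqP; ring.
by apply: lee_wpmul2l; [rewrite lee_fin; nng; exact: w0|exact: extension_dev].
Qed.

End extension_kernel.

Section swap.
Context {d : measure_display} {T : measurableType d} {R : realType}.
Variable m : {sigma_finite_measure set T -> \bar R}.

(** Tonelli with the bound on the integral of k asked only where h is nonzero: the kernel estimates
    hold for exterior points only, and weights vanish elsewhere. *)
Lemma integral_swap_le (k : T -> T -> R) (h C : T -> R) :
  measurable_fun setT (fun p : T * T => k p.1 p.2) -> (forall x z, 0 <= k x z) ->
  measurable_fun setT h -> (forall z, 0 <= h z) ->
  (forall z, h z != 0 -> (\int[m]_x (k x z)%:E <= (C z)%:E)%E) ->
  (\int[m]_x \int[m]_z (k x z * h z)%:E <= \int[m]_z (C z * h z)%:E)%E.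
Proof.
move=> mk k0 mh h0 kC.
pose F (p : T * T) := (k p.1 p.2 * h p.2)%:E.
have mF : measurable_fun setT F by rewrite /F; mea.
have F0 p : (0 <= F p)%E by rewrite lee_fin mulr_ge0.
rewrite (_ : (\int[m]_x _)%E = (\int[m]_z \int[m]_x F (x, z))%E); last exact: (fubini_tonelli F mF F0).
apply: nneg_le_integral => z _; first by apply: integral_ge0 => x _; exact: F0.
have mkz : measurable_fun setT (k ^~ z).
  exact: (measurableT_comp mk (measurable_pair2 z)).
rewrite (_ : (\int[m]_x _)%E = (\int[m]_x (h z * k x z)%:E)%E); last first.
  by apply: eq_integral => x _; rewrite /F/= mulrC.
rewrite integralZl_EFin//; have [->|hz] := eqVneq (h z) 0.
  by rewrite mul0e mulr0.
by rewrite (mulrC (C z)) EFinM; apply: lee_wpmul2l; [rewrite lee_fin|exact: kC].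
Qed.

Lemma integral_swap3_le (k : T -> T -> T -> R) (h C : T -> T -> R) :
  measurable_fun setT (fun p : T * (T * T) => k p.1 p.2.1 p.2.2) -> (forall x y z, 0 <= k x y z) ->
  measurable_fun setT (fun p : T * T => h p.1 p.2) -> (forall y z, 0 <= h y z) ->
  (forall y z, h y z != 0 -> (\int[m]_x (k x y z)%:E <= (C y z)%:E)%E) ->
  (\int[m]_x \int[m]_y \int[m]_z (k x y z * h y z)%:E <=
   \int[m]_y \int[m]_z (C y z * h y z)%:E)%E.
Proof.
move=> mk k0 mh h0 kC.
rewrite (tonelli3 m (F := fun x y z => k x y z * h y z)); last 2 first.
- apply: measurable_funM => //.
  exact: (measurableT_comp mh (measurable_snd : measurable_fun setT (@snd T (T * T)))).
- by move=> x y z; rewrite mulr_ge0.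
apply: nneg_le_integral => y _.
  by apply: integral_ge0 => z _; apply: integral_ge0 => x _; rewrite lee_fin mulr_ge0.
apply: nneg_le_integral => z _.
  by apply: integral_ge0 => x _; rewrite lee_fin mulr_ge0.
have mkz : measurable_fun setT (fun x => k x y z).
  pose g (x : T) := (x, (y, z)).
  have mg : measurable_fun setT g by do ?apply: measurable_fun_pair; mea.
  exact: (measurableT_comp mk mg).
rewrite (_ : (\int[m]_x _)%E = (\int[m]_x (h y z * k x y z)%:E)%E); last first.
  by apply: eq_integral => x _; rewrite mulrC.
rewrite integralZl_EFin//; have [->|hz] := eqVneq (h y z) 0.
  by rewrite mul0e mulr0.
by rewrite (mulrC (C y z)) EFinM; apply: lee_wpmul2l; [rewrite lee_fin|exact: kC].
Qed.

Lemma integral2Zl_EFin (K : R) (G : T -> T -> R) : 0 <= K ->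
  measurable_fun setT (fun p : T * T => G p.1 p.2) -> (forall x y, 0 <= G x y) ->
  (K%:E * \int[m]_x \int[m]_y (G x y)%:E = \int[m]_x \int[m]_y (K * G x y)%:E)%E.
Proof.
move=> K0 mG G0.
have mG2 x : measurable_fun setT (G x) by exact: (measurableT_comp mG (measurable_pair1 x)).
pose GE (p : T * T) := (G p.1 p.2)%:E.
have mGE : measurable_fun setT GE by exact/measurable_EFinP.
have GE0 p : (0 <= GE p)%E by rewrite lee_fin.
rewrite -ge0_integralZl//.
- by apply: eq_integral => x _; rewrite integralZl_EFin.
- exact: (measurable_fun_fubini_tonelli_F GE mGE GE0).
- by move=> x _; apply: integral_ge0 => y _; rewrite lee_fin.
Qed.

End swap.

(** * The extension in L^1 and its interaction with the complement *)

Section extension_estimates.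
Context {R : realType} {n : nat} {Omega : set 'rV[R]_n.+1}.
Variable dd : domain_data Omega.
Local Notation leb := (@lebesgue_rV R n.+1).
Local Notation d_ := (dist_boundary Omega).
Local Notation dim := (n.+1%:R : R).
Local Notation wgt := (@exterior_weight R n Omega).
Local Notation mass := (@exterior_mass R n Omega).
Local Notation sep := (@separation R n Omega).
Local Notation rC := (@radialC R n.+1).

Let mO := measurable_domain dd.

Variables s_lo s : R.
Hypotheses (sl0 : 0 < s_lo) (sls : s_lo <= s) (s1 : s < 1).

Let s0 : 0 < s. Proof. exact: lt_le_trans sls. Qed.
Let w0 z : 0 <= wgt s z. Proof. exact: wgt_ge0 (ltW s1). Qed.
Let mw : measurable_fun setT (wgt s). Proof. exact: measurable_wgt dd s. Qed.

Variables (c : R).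
Hypotheses (c0 : 0 < c)
  (Hc : forall x, Omega x -> ((c * d_ x `^ (- s))%:E <= mass s x)%E).

Variables (f : 'rV[R]_n.+1 -> R).
Hypothesis mf : measurable_fun setT f.
Hypothesis fO : forall x, Omega x -> f x = 0.

Definition ext_T1 : \bar R := (\int[leb]_z (wgt s z * `|f z|)%:E)%E.

Definition T2_kernel y z : R :=
  Num.min (sep z y) 1 `^ (s - dim) * (wgt s y * (wgt s z * `|f z - f y|)).

Definition ext_T2 : \bar R := (\int[leb]_y \int[leb]_z (T2_kernel y z)%:E)%E.

Lemma T2_kernel_ge0 y z : 0 <= T2_kernel y z.
Proof. by rewrite /T2_kernel; nng; exact: w0. Qed.

Lemma measurable_T2_kernel :
  measurable_fun setT (fun p : 'rV[R]_n.+1 * 'rV[R]_n.+1 => T2_kernel p.1 p.2).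
Proof. by rewrite /T2_kernel /separation; mea. Qed.

Hypothesis fint : (ext_T1 < +oo)%E.

Definition ext_avg x : R := average leb (@ext_ker R n Omega s x) f.
Local Notation A := ext_avg.

(** The numerator has a signed integrand, so it is split into positive and negative parts before
    Tonelli applies. *)
Lemma measurable_ext_avg : measurable_fun setT A.
Proof.
pose G (p : 'rV[R]_n.+1 * 'rV[R]_n.+1) := (@ext_ker R n Omega s p.1 p.2 * f p.2)%:E.
have mG : measurable_fun setT G by rewrite /G /ext_ker; mea.
pose H (p : 'rV[R]_n.+1 * 'rV[R]_n.+1) := (@ext_ker R n Omega s p.1 p.2)%:E.
have mH : measurable_fun setT H by rewrite /H /ext_ker; mea.
have fm (g : 'rV[R]_n.+1 -> \bar R) : measurable_fun setT g -> measurable_fun setT (fun x => fine (g x)).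
  by move=> mg; apply: (measurableT_comp (@fine_measurable R setT measurableT) mg).
rewrite /ext_avg /average; apply: measurable_funM.
  apply: fm.
  rewrite (_ : (fun x => _) = (fun x => (\int[leb]_z G^\+ (x, z) - \int[leb]_z G^\- (x, z))%E)).
    apply: emeasurable_funB.
    - by apply: (measurable_fun_fubini_tonelli_F (G^\+)%E); [exact: measurable_funepos|move=> p; exact: funepos_ge0].
    - by apply: (measurable_fun_fubini_tonelli_F (G^\-)%E); [exact: measurable_funeneg|move=> p; exact: funeneg_ge0].
  by apply/funext => x; rewrite [LHS]integralE; congr (_ - _)%E; apply: eq_integral => z _; rewrite ?funeposE ?funenegE.
apply: measurable_fun_inv; apply: fm.
by apply: (measurable_fun_fubini_tonelli_F H mH) => p; rewrite lee_fin (ext_ker_ge0 s1).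
Qed.

Lemma ext_L1in : (c%:E * \int[leb]_x ([?x \in Omega] * `|A x|)%:E <=
  (rC / s_lo + @dom_vol R n Omega)%:E * ext_T1)%E.
Proof.
have mA := measurable_ext_avg.
rewrite -integralZl_EFin; [|by mea|by nng|exact: ltW].
apply: (@le_trans _ _ (\int[leb]_x \int[leb]_z
    (([?x \in Omega] * enorm (x - z) `^ (s - dim)) * (wgt s z * `|f z|))%:E)%E).
  apply: nneg_le_integral => x _; first by rewrite lee_fin; nng; exact: ltW.
  have [xO|_] := boolP (x \in Omega); last first.
    by rewrite mul0r mulr0; apply: integral_ge0 => z _; nng; exact: w0.
  have := extension_dev_sup dd s0 s1 c0 Hc mf fint 0 (set_mem xO).
  rewrite subr0 mul1r => /le_trans; apply; rewrite le_eqVlt; apply/orP; left; apply/eqP.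
  by apply: eq_integral => z _; rewrite mul1r subr0.
apply: (le_trans (integral_swap_le (m := leb)
    (k := fun x z => [?x \in Omega] * enorm (x - z) `^ (s - dim))
    (h := fun z => wgt s z * `|f z|) (C := fun=> rC / s_lo + @dom_vol R n Omega) _ _ _ _ _)).
- by mea.
- by move=> *; nng.
- by mea.
- by move=> *; nng; exact: w0.
- move=> z _; apply: (le_trans (kernel_L1 dd z s0 s1)); rewrite lee_fin lerD2r.
  by rewrite ler_wpM2l ?radialC_ge0// lef_pV2.
rewrite integralZl_EFin//; [by mea|by move=> *; nng; exact: w0|].
by rewrite addr_ge0 ?dom_vol_ge0// divr_ge0 ?radialC_ge0// ltW.
Qed.

(** The condition 0 < d_y is what [kernel_exterior] needs; the boundary points it drops form a null
    set. *)
Definition cross_kernel (v : 'rV[R]_n.+1 -> R) x y : R := [?x \in Omega] * ([?y \notin Omega] *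
  ([?0 < d_ y] * (`|v x - f y| * enorm (x - y) `^ (- (dim + s))))).

Definition cross_energy v : \bar R := (\int[leb]_x \int[leb]_y (cross_kernel v x y)%:E)%E.

Lemma cross_kernel_ge0 v x y : 0 <= cross_kernel v x y.
Proof. by rewrite /cross_kernel; nng. Qed.

Lemma measurable_cross_kernel v : measurable_fun setT v ->
  measurable_fun setT (fun p : 'rV[R]_n.+1 * 'rV[R]_n.+1 => cross_kernel v p.1 p.2).
Proof. by move=> mv; rewrite /cross_kernel; mea. Qed.

(** After integration over x, the factor (1 - s) d_y^(-s) (1 + d_y)^(-d) is exactly the density of
    [mu_s] at y, so the factor 1 - s of the seminorm is used up here. *)
Lemma ext_cross_le : (((1 - s) * c)%:E * cross_energy A <= (@kernel_extC R n Omega s_lo)%:E * ext_T2)%E.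
Proof.
have mA := measurable_ext_avg.
have s1' : 0 <= 1 - s by rewrite subr_ge0 ltW.
have KC0 := @kernel_extC_ge0 R n Omega s_lo sl0.
rewrite EFinM -muleA /cross_energy (integral2Zl_EFin leb (ltW c0) (measurable_cross_kernel mA) (cross_kernel_ge0 A)).
pose k (x y z : 'rV[R]_n.+1) : R :=
  [?x \in Omega] * (enorm (x - z) `^ (s - dim) * enorm (x - y) `^ (- (dim + s))).
pose h (y z : 'rV[R]_n.+1) : R :=
  [?y \notin Omega] * ([?0 < d_ y] * (wgt s z * `|f z - f y|)).
pose C (y z : 'rV[R]_n.+1) : R := @kernel_extC R n Omega s_lo *
  (Num.min (sep z y) 1 `^ (s - dim) * (d_ y `^ (- s) * (1 + d_ y) ^- n.+1)).
have h0 y z : 0 <= h y z by rewrite /h; nng; exact: w0.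
apply: (@le_trans _ _ ((1 - s)%:E * \int[leb]_x \int[leb]_y \int[leb]_z (k x y z * h y z)%:E)%E).
  apply: lee_wpmul2l; first by rewrite lee_fin.
  apply: nneg_le_integral => x _.
    by apply: integral_ge0 => y _; rewrite lee_fin mulr_ge0 ?cross_kernel_ge0 ?(ltW c0).
  apply: nneg_le_integral => y _; first by rewrite lee_fin mulr_ge0 ?cross_kernel_ge0 ?(ltW c0).
  rewrite /cross_kernel.
  have [xO|_] := boolP (x \in Omega); last first.
    rewrite mul0r mulr0; apply: integral_ge0 => z _; rewrite lee_fin /k.
    by apply: mulr_ge0 => //; nng.
  rewrite mul1r (_ : (c * _)%:E = ([?y \notin Omega] * ([?0 < d_ y] * enorm (x - y) `^ (- (dim + s))))%:E * (c * `|A x - f y|)%:E)%E; last first.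
    by rewrite -EFinM; congr EFin; ring.
  apply: (@le_trans _ _ (([?y \notin Omega] * ([?0 < d_ y] * enorm (x - y) `^ (- (dim + s))))%:E *
    \int[leb]_z (enorm (x - z) `^ (s - dim) * (wgt s z * `|f z - f y|))%:E)%E).
    apply: lee_wpmul2l; first by nng.
    have H := extension_dev_sup dd s0 s1 c0 Hc mf fint (f y) (set_mem xO).
    exact: H.
  rewrite -integralZl_EFin; [|by mea|by move=> z; nng; exact: w0|by nng].
  rewrite le_eqVlt; apply/orP; left; apply/eqP; apply: eq_integral => z _.
  congr EFin; rewrite /k /h.
  have E (t a b k1 k2 w D : R) : t = 1 ->
    a * (b * k2) * (k1 * (w * D)) = t * (k1 * k2) * (a * (b * (w * D))) by move=> ->; ring.
  by apply: E; rewrite xO.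
have mk : measurable_fun setT (fun p : 'rV[R]_n.+1 * ('rV[R]_n.+1 * 'rV[R]_n.+1) => k p.1 p.2.1 p.2.2).
  by rewrite /k; mea.
have mh : measurable_fun setT (fun p : 'rV[R]_n.+1 * 'rV[R]_n.+1 => h p.1 p.2).
  by rewrite /h; mea.
have k0 x y z : 0 <= k x y z by rewrite /k; nng.
apply: (@le_trans _ _ ((1 - s)%:E * \int[leb]_y \int[leb]_z (C y z * h y z)%:E)%E).
  apply: lee_wpmul2l; first by rewrite lee_fin.
  apply: integral_swap3_le => // y z; rewrite /h.
  have [yO|yO] := boolP (y \in Omega); first by rewrite mul0r eqxx.
  have [dy|dy] := boolP (0 < d_ y); last by rewrite mul0r mulr0 eqxx.
  have [/wgt_dom ->|zO _] := boolP (z \in Omega); first by rewrite mul0r !mulr0 eqxx.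
  rewrite /k /C; apply: kernel_exterior => //.
    by move/negP : zO => zO Oz; apply: zO; exact/mem_set.
  by move/negP : yO => yO Oy; apply: yO; exact/mem_set.
have Y0 y : 0 <= (1 + d_ y) ^- n.+1.
  by rewrite invr_ge0 exprn_ge0// addr_ge0// dist_set_ge0.
have mC : measurable_fun setT (fun p : 'rV[R]_n.+1 * 'rV[R]_n.+1 => C p.1 p.2).
  by rewrite /C /separation; mea.
have C0 y z : 0 <= C y z.
  by rewrite /C mulr_ge0// mulr_ge0 ?powR_ge0// mulr_ge0 ?powR_ge0.
pose Ch y z := C y z * h y z.
have mCh : measurable_fun setT (fun p : 'rV[R]_n.+1 * 'rV[R]_n.+1 => Ch p.1 p.2) by exact: measurable_funM.
have Ch0 y z : 0 <= Ch y z by rewrite mulr_ge0.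
rewrite (integral2Zl_EFin leb s1' mCh Ch0).
rewrite /ext_T2 (integral2Zl_EFin leb KC0 measurable_T2_kernel T2_kernel_ge0).
apply: nneg_le_integral => y _.
  by apply: integral_ge0 => z _; rewrite lee_fin mulr_ge0.
apply: nneg_le_integral => z _; first by rewrite lee_fin mulr_ge0.
rewrite lee_fin /Ch /C /h /T2_kernel.
set K := @kernel_extC R n Omega s_lo; set J := _ `^ (s - dim).
have -> : (1 - s) * (K * (J * (d_ y `^ (- s) * (1 + d_ y) ^- n.+1)) *
     ([?y \notin Omega] * ([?0 < d_ y] * (wgt s z * `|f z - f y|)))) =
  [?0 < d_ y] * (K * (J * (wgt s y * (wgt s z * `|f z - f y|)))).
  have -> : wgt s y = [?y \notin Omega] * ((1 - s) * d_ y `^ (- s) * (1 + d_ y) ^- n.+1) by [].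
  ring.
rewrite -[leRHS]mul1r; apply: ler_wpM2r; first by rewrite mulr_ge0//; nng; exact: w0.
by case: (0 < d_ y).
Qed.

End extension_estimates.

Lemma integral3D {d : measure_display} {T : measurableType d} {R : realType}
    (m : {sigma_finite_measure set T -> \bar R}) (F G : T -> T -> T -> R) :
  measurable_fun setT (fun w : T * (T * T) => F w.1 w.2.1 w.2.2) ->
  measurable_fun setT (fun w : T * (T * T) => G w.1 w.2.1 w.2.2) ->
  (forall x y z, 0 <= F x y z) -> (forall x y z, 0 <= G x y z) ->
  (\int[m]_x \int[m]_y \int[m]_z (F x y z + G x y z)%:E =
   \int[m]_x \int[m]_y \int[m]_z (F x y z)%:E + \int[m]_x \int[m]_y \int[m]_z (G x y z)%:E)%E.
Proof.
move=> mF mG F0 G0.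
have sec1 (H : T -> T -> T -> R) x y :
    measurable_fun setT (fun w : T * (T * T) => H w.1 w.2.1 w.2.2) -> measurable_fun setT (H x y).
  move=> mH; pose g (z : T) := (x, (y, z)).
  have mg : measurable_fun setT g by do ?apply: measurable_fun_pair; mea.
  exact: (measurableT_comp mH mg).
have sec2 (H : T -> T -> T -> R) : (forall x y z, 0 <= H x y z) ->
    measurable_fun setT (fun w : T * (T * T) => H w.1 w.2.1 w.2.2) ->
    measurable_fun setT (fun p : T * T => (\int[m]_z (H p.1 p.2 z)%:E)%E).
  move=> H0 mH; pose h (p : (T * T) * T) := (p.1.1, (p.1.2, p.2)).
  have mh : measurable_fun setT h by do ?apply: measurable_fun_pair; mea.
  pose K (p : (T * T) * T) := (H p.1.1 p.1.2 p.2)%:E.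
  have mK : measurable_fun setT K by apply/measurable_EFinP; exact: (measurableT_comp mH mh).
  by apply: (measurable_fun_fubini_tonelli_F K mK) => p; rewrite lee_fin.
have sec3 (H : T -> T -> T -> R) x : (forall x y z, 0 <= H x y z) ->
    measurable_fun setT (fun w : T * (T * T) => H w.1 w.2.1 w.2.2) ->
    measurable_fun setT (fun y => (\int[m]_z (H x y z)%:E)%E).
  move=> H0 mH; exact: (measurableT_comp (sec2 H H0 mH) (measurable_pair1 x)).
have sec4 (H : T -> T -> T -> R) : (forall x y z, 0 <= H x y z) ->
    measurable_fun setT (fun w : T * (T * T) => H w.1 w.2.1 w.2.2) ->
    measurable_fun setT (fun x => (\int[m]_y \int[m]_z (H x y z)%:E)%E).
  move=> H0 mH; apply: (measurable_fun_fubini_tonelli_F _ (sec2 H H0 mH)) => p.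
  by apply: integral_ge0 => z _; rewrite lee_fin.
have i0 (H : T -> T -> T -> R) x y : (forall x y z, 0 <= H x y z) -> (0 <= \int[m]_z (H x y z)%:E)%E.
  by move=> H0; apply: integral_ge0 => z _; rewrite lee_fin.
rewrite -ge0_integralD//; last 4 first.
- by move=> x _; apply: integral_ge0 => y _; exact: i0.
- exact: sec4.
- by move=> x _; apply: integral_ge0 => y _; exact: i0.
- exact: sec4.
apply: eq_integral => x _.
rewrite -ge0_integralD//; last 4 first.
- by move=> y _; exact: i0.
- exact: sec3.
- by move=> y _; exact: i0.
- exact: sec3.
apply: eq_integral => y _.
rewrite -ge0_integralD//.
- by move=> z _; rewrite lee_fin.
- by apply/measurable_EFinP; exact: sec1.
- by move=> z _; rewrite lee_fin.
- by apply/measurable_EFinP; exact: sec1.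
Qed.

(** * Pairs of interior points far from each other *)

Section far_energy.
Context {R : realType} {n : nat} {Omega : set 'rV[R]_n.+1}.
Variable dd : domain_data Omega.
Local Notation leb := (@lebesgue_rV R n.+1).
Local Notation d_ := (dist_boundary Omega).
Local Notation dim := (n.+1%:R : R).
Local Notation rC := (@radialC R n.+1).
Local Notation kappa := (dd_kappa dd).
Local Notation theta := (dd_theta dd).

Let oO := dd_open dd.
Let mO := measurable_domain dd.

(** outer_c d_x is half the radius of the exterior ball obtained from the cone at the scale theta
    d_x. *)
Definition outer_c : R := kappa * theta / 2.

Lemma outer_c0 : 0 < outer_c.
Proof. by rewrite divr_gt0// mulr_gt0 ?dd_kappa0 ?dd_theta0. Qed.

Definition outer_vol : R := (kappa * theta / n.+2%:R) ^+ n.+1.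

Lemma outer_vol0 : 0 < outer_vol.
Proof. by rewrite exprn_gt0// divr_gt0// mulr_gt0 ?dd_kappa0 ?dd_theta0. Qed.

(* The exterior points used to compare the values of a function at two points of
   Omega far from each other. *)
Definition outer (x q : 'rV[R]_n.+1) : R :=
  [?q \notin Omega] * ([?enorm (x - q) <= 5 * d_ x] * [?outer_c * d_ x <= d_ q]).

Lemma outer_ge0 x q : 0 <= outer x q. Proof. by rewrite /outer; nng. Qed.

Lemma outer_le1 x q : outer x q <= 1.
Proof.
have b1 (b : bool) : [?b] <= 1 :> R by case: b.
by rewrite /outer !mulr_ile1//; nng.
Qed.

Lemma measurable_outer :
  measurable_fun setT (fun p : 'rV[R]_n.+1 * 'rV[R]_n.+1 => outer p.1 p.2).
Proof. by rewrite /outer; mea. Qed.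

(** The exterior ball of radius kappa h0 contains the concentric ball of half that radius, whose
    points are therefore at distance at least half from the boundary. *)
Lemma outer_volume x : Omega x ->
  ((outer_vol * d_ x ^+ n.+1)%:E <= \int[leb]_q (outer x q)%:E)%E.
Proof.
move=> Ox; have dx := dist_in_gt0 dd Ox.
have k0 := dd_kappa0 dd; have k1 := dd_kappa1 dd.
have t0 := dd_theta0 dd; have t1 := dd_theta1 dd.
have [p [e [bp xp ce]]] := nearby_boundary dd Ox.
set h0 := theta * d_ x; have h00 : 0 < h0 by rewrite mulr_gt0.
have h0h : h0 <= dd_h dd by exact: dd_theta_le.
have h0d : h0 <= d_ x by rewrite /h0 ler_piMl// ltW.
have kh0 : 0 < kappa * h0 by rewrite mulr_gt0.
set r := kappa * h0 / 2; have r0 : 0 < r by rewrite divr_gt0// mulr_gt0.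
have kh : kappa * h0 <= h0 by rewrite ler_piMl// ltW.
have rh : r <= h0 by rewrite /r; lra.
set q0 := p - h0 *: e.
have -> : outer_vol * d_ x ^+ n.+1 = (2 * (r / n.+2%:R)) ^+ n.+1.
  by rewrite /outer_vol -exprMn; congr (_ ^+ _); rewrite /r /h0; field.
apply: (le_trans (lebesgue_rV_eball_ge q0 r0)).
rewrite -[eball q0 r]setIT -integral_indic//; last exact: measurable_eball.
apply: nneg_le_integral => q _; first by rewrite lee_fin.
rewrite lee_fin indicE; have [qB|_] := boolP (q \in eball q0 r); last exact: outer_ge0.
have {}qB : enorm (q - q0) < r := set_mem qB.
have out y : enorm (y - q0) < kappa * h0 -> ~ Omega y.
  exact: cone_outer_ball bp ce h00 h0h.
have rE : 2 * r = kappa * h0 by rewrite /r; field.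
have Oq : ~ Omega q by apply: out; rewrite -rE; lra.
have dq : r <= d_ q.
  apply: (dist_boundary_out_ge oO (dd_bnd0 dd)) => y yq; apply: out.
  by have := ler_enorm_dist y q q0; rewrite -rE; lra.
have qO : q \notin Omega by apply/negP => qO; exact: Oq (set_mem qO).
have dqc : outer_c * d_ x <= d_ q.
  by rewrite (_ : outer_c * d_ x = r)// /outer_c /r /h0; ring.
have xq : enorm (x - q) <= 5 * d_ x.
  have e1 : enorm e <= 1 by case: ce.
  have := ler_enorm_dist x p q; have := ler_enorm_dist p q0 q.
  rewrite (enormB q0 q) (_ : p - q0 = h0 *: e); last by rewrite /q0 subKr.
  rewrite enormZ (gtr0_norm h00).
  have : h0 * enorm e <= h0 by rewrite ler_piMr// ltW.
  by lra.
by rewrite /outer qO xq dqc !mulr1.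
Qed.

Variables s_lo s : R.
Hypotheses (sl0 : 0 < s_lo) (sls : s_lo <= s) (s1 : s < 1).

Let s0 : 0 < s. Proof. exact: lt_le_trans sls. Qed.

Variables (v f : 'rV[R]_n.+1 -> R).
Hypotheses (mv : measurable_fun setT v) (mf : measurable_fun setT f).

Local Notation cross := (@cross_kernel R n Omega s f v).

Definition far_kernel x y : R := [?x \in Omega] * ([?y \in Omega] *
  ([?d_ x / 2 <= enorm (x - y)] * (`|v x - v y| * enorm (x - y) `^ (- (dim + s))))).

Lemma far_kernel_ge0 x y : 0 <= far_kernel x y.
Proof. by rewrite /far_kernel; nng. Qed.

Lemma measurable_far_kernel :
  measurable_fun setT (fun p : 'rV[R]_n.+1 * 'rV[R]_n.+1 => far_kernel p.1 p.2).
Proof. by rewrite /far_kernel; mea. Qed.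

(** The tail over y from d_x/2 gives 2 (rC / s_lo) d_x^(-s), and |x - q| <= 5 d_x trades d_x^(-d-s)
    for |x - q|^(-d-s) with a factor at most 5^(d+1). *)
Definition farC1 : R := 2 * (rC / s_lo) * 5 ^+ n.+2.
(** 100 = 5 * 4 * 5: the inverse of d_x is at most 5 / d_q, and x ranges over a ball about q of
    radius 5 d_q / outer_c, with volume at most (4 r)^d. The 11 comes from |y - q| <= |x - y| + 5
    d_x <= 11 |x - y|. *)
Definition farC2 : R := (100 / outer_c) ^+ n.+1 * 11 ^+ n.+2.

Lemma farC1_ge0 : 0 <= farC1.
Proof.
have q0 : 0 <= rC / s_lo by rewrite divr_ge0 ?radialC_ge0// ltW.
by rewrite /farC1 mulr_ge0 ?exprn_ge0// mulr_ge0.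
Qed.

Lemma farC2_ge0 : 0 <= farC2.
Proof. by rewrite /farC2 mulr_ge0 ?exprn_ge0// divr_ge0// ltW// outer_c0. Qed.

Let a1 x y q : R :=
  ([?d_ x / 2 <= enorm (x - y)] * enorm (x - y) `^ (- (dim + s))) *
  ([?x \in Omega] * (d_ x `^ (- dim) * (outer x q * `|v x - f q|))).

Let k2 x y q : R := [?x \in Omega] * ([?d_ x / 2 <= enorm (x - y)] *
  (enorm (x - y) `^ (- (dim + s)) * (d_ x `^ (- dim) * outer x q))).
Let h2 y q : R := [?y \in Omega] * ([?q \notin Omega] * ([?0 < d_ q] * `|v y - f q|)).

Let mo3 : measurable_fun setT (fun p : 'rV[R]_n.+1 * ('rV[R]_n.+1 * 'rV[R]_n.+1) => outer p.1 p.2.2).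
Proof. by rewrite /outer; mea. Qed.

Lemma outerP x q : outer x q != 0 ->
  [/\ ~ Omega q, enorm (x - q) <= 5 * d_ x & outer_c * d_ x <= d_ q].
Proof.
rewrite /outer; have [qO|qO] := boolP (q \in Omega); first by rewrite mul0r eqxx.
case: (boolP (_ <= 5 * d_ x)) => [xq|_]; last by rewrite mul0r mulr0 eqxx.
case: (boolP (outer_c * d_ x <= _)) => [dq _|_]; last by rewrite !mulr0 eqxx.
by split => //; move/negP : qO => qO Oq; apply: qO; exact/mem_set.
Qed.

(** f q is inserted between v x and v y and averaged over the exterior points q of [outer x], with
    normalisation d_x^(-d). *)
Lemma far_outer x y : ((outer_vol * far_kernel x y)%:E <=
  \int[leb]_q (a1 x y q + k2 x y q * h2 y q)%:E)%E.
Proof.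
have s0' : forall q, 0 <= a1 x y q + k2 x y q * h2 y q.
  by move=> q; rewrite /a1 /k2 /h2; have := outer_ge0 x q; move: (outer x q) => o o0; nng.
rewrite /far_kernel; have [xO|_] := boolP (x \in Omega); last first.
  by rewrite mul0r mulr0; apply: integral_ge0 => q _; rewrite lee_fin.
have [yO|_] := boolP (y \in Omega); last first.
  by rewrite mul0r !mulr0; apply: integral_ge0 => q _; rewrite lee_fin.
have [xy|_] := boolP (d_ x / 2 <= enorm (x - y)); last first.
  by rewrite mul0r !mulr0; apply: integral_ge0 => q _; rewrite lee_fin.
have Ox := set_mem xO; have dx := dist_in_gt0 dd Ox.
set K := enorm (x - y) `^ (- (dim + s)); have K0 : 0 <= K by exact: powR_ge0.
rewrite !mul1r.
apply: (@le_trans _ _ ((d_ x `^ (- dim) * (`|v x - v y| * K))%:E * \int[leb]_q (outer x q)%:E)%E).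
  apply: (@le_trans _ _ ((d_ x `^ (- dim) * (`|v x - v y| * K))%:E * (outer_vol * d_ x ^+ n.+1)%:E)%E).
    rewrite -EFinM lee_fin powRN powR_mulrn ?(ltW dx)//.
    have -> : (d_ x ^+ n.+1)^-1 * (`|v x - v y| * K) * (outer_vol * d_ x ^+ n.+1) =
       outer_vol * (`|v x - v y| * K) * ((d_ x ^+ n.+1)^-1 * d_ x ^+ n.+1) by ring.
    by rewrite mulVf ?mulr1// expf_neq0// gt_eqF.
  apply: lee_wpmul2l; last exact: outer_volume.
  by rewrite lee_fin mulr_ge0 ?powR_ge0// mulr_ge0.
rewrite -integralZl_EFin; last 3 first.
- exact: (measurableT_comp measurable_outer (measurable_pair1 x)).
- exact: outer_ge0.
- by rewrite mulr_ge0 ?powR_ge0// mulr_ge0.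
apply: nneg_le_integral => q _.
  by rewrite lee_fin !mulr_ge0 ?powR_ge0 ?outer_ge0.
rewrite lee_fin /a1 /k2 /h2 xO xy yO -/K !mul1r.
have [->|/outerP[Oq _ cq]] := eqVneq (outer x q) 0.
  by rewrite !(mulr0, mul0r) addr0.
have qO : q \notin Omega by apply/negP => qO; exact: Oq (set_mem qO).
have dq : 0 < d_ q by apply: lt_le_trans cq; rewrite mulr_gt0 ?outer_c0.
rewrite qO dq !mul1r.
have -> : K * (d_ x `^ (- dim) * (outer x q * `|v x - f q|)) +
   K * (d_ x `^ (- dim) * outer x q) * `|v y - f q| =
   d_ x `^ (- dim) * K * outer x q * (`|v x - f q| + `|v y - f q|) by ring.
have -> : d_ x `^ (- dim) * (`|v x - v y| * K) * outer x q =
  d_ x `^ (- dim) * K * outer x q * `|v x - v y| by ring.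
apply: ler_wpM2l; first by rewrite !mulr_ge0 ?powR_ge0 ?outer_ge0.
by rewrite (distrC (v y)); apply: le_trans (ler_normD _ _); rewrite addrA subrK.
Qed.

(** Neither v x - f q nor the set of q involves y, so y is integrated first. *)
Lemma far_first : (\int[leb]_x \int[leb]_y \int[leb]_q (a1 x y q)%:E <=
  farC1%:E * \int[leb]_x \int[leb]_q (cross x q)%:E)%E.
Proof.
rewrite (integral2Zl_EFin leb farC1_ge0 (measurable_cross_kernel dd s mf mv) (cross_kernel_ge0 s f v)).
apply: nneg_le_integral => x _.
  apply: integral_ge0 => y _; apply: integral_ge0 => q _; rewrite lee_fin /a1.
  by have := outer_ge0 x q; move: (outer x q) => o o0; nng.
have mox : measurable_fun setT (outer x) by exact: (measurableT_comp measurable_outer (measurable_pair1 x)).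
have q0 : 0 <= rC / s_lo by rewrite divr_ge0 ?radialC_ge0// ltW.
apply: (le_trans (integral_swap_le (m := leb)
    (k := fun y q => [?d_ x / 2 <= enorm (x - y)] * enorm (x - y) `^ (- (dim + s)))
    (h := fun q => [?x \in Omega] * (d_ x `^ (- dim) * (outer x q * `|v x - f q|)))
    (C := fun=> 2 * (rC / s_lo) * d_ x `^ (- s)) _ _ _ _ _)).
- by mea.
- by move=> *; nng.
- by mea.
- by move=> q; have := outer_ge0 x q; move: (outer x q) => o o0; nng.
- move=> q; have [xO _|_] := boolP (x \in Omega); last by rewrite mul0r eqxx.
  have dx := dist_in_gt0 dd (set_mem xO).
  have dx2 : 0 < d_ x / 2 by rewrite divr_gt0.
  have sd : s <= dim by apply: le_trans (ltW s1) _; rewrite ler1n.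
  have tail := @radial_tail R n.+1 x (d_ x / 2) s dx2 s0 sd.
  apply: (@le_trans _ _ (\int[leb]_y ([?d_ x / 2 <= enorm (y - x)] * enorm (y - x) `^ (- s - dim))%:E)%E).
    rewrite le_eqVlt; apply/orP; left; apply/eqP.
    by apply: eq_integral => y _; rewrite (enormB y x) opprD (addrC (- s)).
  apply: (le_trans tail); rewrite lee_fin.
  have d2 : (d_ x / 2) `^ (- s) <= 2 * d_ x `^ (- s).
    rewrite powRM ?(ltW dx)// mulrC; apply: ler_wpM2r; first exact: powR_ge0.
    rewrite -powR_inv1// -powRrM mulN1r opprK -[leRHS]powRr1//.
    by apply: ler_powR; [rewrite ler1n|exact: ltW].
  rewrite (_ : rC * ((d_ x / 2) `^ (- s) / s) = rC / s * (d_ x / 2) `^ (- s)); last by ring.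
  rewrite (_ : 2 * (rC / s_lo) * d_ x `^ (- s) = rC / s_lo * (2 * d_ x `^ (- s))); last by ring.
  apply: ler_pM => //; rewrite ?powR_ge0//.
    by rewrite divr_ge0 ?radialC_ge0// ltW.
  by rewrite ler_wpM2l ?radialC_ge0// lef_pV2.
apply: nneg_le_integral => q _.
  by rewrite lee_fin; have := outer_ge0 x q; move: (outer x q) => o o0; rewrite mulr_ge0//; [rewrite mulr_ge0 ?powR_ge0// mulr_ge0|nng].
rewrite lee_fin /cross_kernel.
have [xO|_] := boolP (x \in Omega); last by rewrite !mul0r !mulr0.
have [->|oq] := eqVneq (outer x q) 0.
  by rewrite mul0r !mulr0 mulr_ge0 ?farC1_ge0//; nng.
have o1 := outer_le1 x q.
have [Oq xq cq] := outerP oq.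
have Ox := set_mem xO; have dx := dist_in_gt0 dd Ox.
have qO : q \notin Omega by apply/negP => qO; exact: Oq (set_mem qO).
have dq : 0 < d_ q by apply: lt_le_trans cq; rewrite mulr_gt0 ?outer_c0.
have xq0 : 0 < enorm (x - q) by apply: lt_le_trans dx (dist_boundary_in_le oO Ox Oq).
have E : d_ x `^ (- s) * d_ x `^ (- dim) <= 5 ^+ n.+2 * enorm (x - q) `^ (- (dim + s)).
  rewrite -powRD_gt0// (_ : - s - dim = - (dim + s)); last by ring.
  have x5 : 0 < enorm (x - q) / 5 by rewrite divr_gt0.
  apply: (@le_trans _ _ ((enorm (x - q) / 5) `^ (- (dim + s)))).
    apply: powR_decr => //; first by lra.
    by rewrite addr_ge0// ltW.
  rewrite powRM ?(ltW xq0)// mulrC; apply: ler_wpM2r; first exact: powR_ge0.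
  rewrite -powR_inv1// -powRrM mulN1r opprK -powR_mulrn//.
  by apply: ler_powR; [rewrite ler1n|rewrite [leRHS]mulrS addrC lerD2l ltW].
rewrite qO dq !mul1r.
set N := `|v x - f q|; have N0 : 0 <= N by exact: normr_ge0.
apply: (@le_trans _ _ (2 * (rC / s_lo) * (d_ x `^ (- s) * d_ x `^ (- dim)) * N)).
  rewrite (_ : 2 * (rC / s_lo) * d_ x `^ (- s) * (d_ x `^ (- dim) * (outer x q * N)) =
     (2 * (rC / s_lo) * (d_ x `^ (- s) * d_ x `^ (- dim)) * N) * outer x q); last by ring.
  apply: ler_piMr => //; apply: mulr_ge0 => //.
  by apply: mulr_ge0; [exact: mulr_ge0|rewrite mulr_ge0 ?powR_ge0].
rewrite /farC1 (_ : 2 * (rC / s_lo) * 5 ^+ n.+2 * (N * enorm (x - q) `^ (- (dim + s))) =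
  2 * (rC / s_lo) * (5 ^+ n.+2 * enorm (x - q) `^ (- (dim + s))) * N); last by ring.
by apply: ler_wpM2r => //; apply: ler_wpM2l => //; exact: mulr_ge0.
Qed.

(** Here x is the free variable. For given y and q it is confined to a ball about q of radius
    comparable to d_q, and d_x is comparable to d_q. *)
Lemma far_second : (\int[leb]_x \int[leb]_y \int[leb]_q (k2 x y q * h2 y q)%:E <=
  farC2%:E * \int[leb]_x \int[leb]_q (cross x q)%:E)%E.
Proof.
rewrite (integral2Zl_EFin leb farC2_ge0 (measurable_cross_kernel dd s mf mv) (cross_kernel_ge0 s f v)).
have mk2 : measurable_fun setT (fun p : 'rV[R]_n.+1 * ('rV[R]_n.+1 * 'rV[R]_n.+1) => k2 p.1 p.2.1 p.2.2).
  by rewrite /k2; mea.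
have mh2 : measurable_fun setT (fun p : 'rV[R]_n.+1 * 'rV[R]_n.+1 => h2 p.1 p.2).
  by rewrite /h2; mea.
have k20 x y q : 0 <= k2 x y q.
  by rewrite /k2; have := outer_ge0 x q; move: (outer x q) => o o0; nng.
have h20 y q : 0 <= h2 y q by rewrite /h2; nng.
apply: (le_trans (integral_swap3_le (m := leb) (k := k2) (h := h2)
  (C := fun y q => farC2 * enorm (y - q) `^ (- (dim + s))) mk2 k20 mh2 h20 _)); last first.
  apply: nneg_le_integral => y _.
    by apply: integral_ge0 => q _; rewrite lee_fin mulr_ge0// mulr_ge0 ?farC2_ge0 ?powR_ge0.
  apply: nneg_le_integral => q _.
    by rewrite lee_fin mulr_ge0// mulr_ge0 ?farC2_ge0 ?powR_ge0.
  rewrite lee_fin /h2 /cross_kernel le_eqVlt; apply/orP; left; apply/eqP.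
  by move: farC2 => F; ring.
move=> y q; rewrite /h2.
have [yO|_] := boolP (y \in Omega); last by rewrite mul0r eqxx.
have [qO|qO] := boolP (q \in Omega); first by rewrite mul0r mulr0 eqxx.
case: (boolP (0 < d_ q)) => [dq _|_]; last by rewrite mul0r !mulr0 eqxx.
have Oy := set_mem yO.
have Oq : ~ Omega q by move/negP : qO => qO Oq; apply: qO; exact/mem_set.
have c0 := outer_c0.
set K := enorm (y - q) `^ (- (dim + s)); have K0 : 0 <= K by exact: powR_ge0.
set r := 5 * d_ q / outer_c; have r0 : 0 < r by rewrite divr_gt0// mulr_gt0.
pose M := 5 ^+ n.+1 * d_ q ^- n.+1 * (11 ^+ n.+2 * K).
have M0 : 0 <= M.
  apply: mulr_ge0; last by apply: mulr_ge0 => //; exact: exprn_ge0.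
  by apply: mulr_ge0; [exact: exprn_ge0|rewrite invr_ge0 exprn_ge0// ltW].
apply: (@le_trans _ _ (\int[leb]_x (M * [?enorm (x - q) <= r])%:E)%E).
  apply: nneg_le_integral => x _; first by rewrite lee_fin.
  rewrite lee_fin /k2; have [xO|_] := boolP (x \in Omega); last by rewrite mul0r mulr_ge0.
  case: (boolP (d_ x / 2 <= _)) => [xy|_]; last by rewrite mul0r mulr0 mulr_ge0.
  have [->|oq] := eqVneq (outer x q) 0; first by rewrite !mulr0 mulr_ge0.
  have [_ xq cq] := outerP oq.
  have o1 := outer_le1 x q.
  have Ox := set_mem xO; have dx := dist_in_gt0 dd Ox.
  have dqx := dist_boundary_out_le oO Ox Oq.
  have xr : enorm (x - q) <= r.
    rewrite /r ler_pdivlMr//; apply: (@le_trans _ _ (5 * d_ x * outer_c)).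
      by apply: ler_wpM2r => //; exact: ltW.
    by rewrite -mulrA; apply: ler_wpM2l => //; rewrite mulrC.
  have G (t1 t2 t3 P D o M1 M2 : R) : t1 = 1 -> t2 = 1 -> t3 = 1 -> 0 <= P -> 0 <= D -> 0 <= o ->
      D * o <= M1 -> P <= M2 -> t1 * (t2 * (P * (D * o))) <= M1 * M2 * t3.
    move=> -> -> -> P0 D0 p0 DM PM; rewrite !mul1r mulr1 [leRHS]mulrC; apply: ler_pM => //.
    exact: mulr_ge0.
  apply: G; [by []|by []|by rewrite xr|exact: powR_ge0|exact: powR_ge0|exact: outer_ge0| |].
  - rewrite -[leRHS]mulr1; apply: ler_pM; rewrite ?powR_ge0 ?outer_ge0//.
    rewrite powRN powR_mulrn ?(ltW dx)// -exprVn -[in leRHS]exprVn -exprMn; apply: lerXn2r.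
    + by rewrite nnegrE invr_ge0 ltW.
    + by rewrite nnegrE mulr_ge0// invr_ge0 ltW.
    rewrite -[5]invrK -invfM lef_pV2 ?posrE// ?mulr_gt0 ?invr_gt0//; lra.
  - have yq0 : 0 < enorm (y - q) by apply: lt_le_trans (dist_in_gt0 dd Oy) (dist_boundary_in_le oO Oy Oq).
    have xy0 : 0 < enorm (x - y) by apply: lt_le_trans xy; rewrite divr_gt0.
    have y11 : 0 < enorm (y - q) / 11 by rewrite divr_gt0.
    apply: (@le_trans _ _ ((enorm (y - q) / 11) `^ (- (dim + s)))).
      apply: powR_decr => //; last by rewrite addr_ge0// ltW.
      have := ler_enorm_dist y x q; rewrite (enormB y x); lra.
    rewrite powRM ?(ltW yq0)// mulrC; apply: ler_wpM2r; first exact: powR_ge0.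
    rewrite -powR_inv1// -powRrM mulN1r opprK -powR_mulrn//.
    by apply: ler_powR; [rewrite ler1n|rewrite [leRHS]mulrS addrC lerD2l ltW].
rewrite integralZl_EFin; [|by mea|by move=> x; nng|exact: M0].
apply: (@le_trans _ _ (M%:E * ((4 * r) ^+ n.+1)%:E)%E).
  by apply: lee_wpmul2l; [rewrite lee_fin|exact: lebesgue_rV_ball_le].
rewrite -EFinM lee_fin le_eqVlt; apply/orP; left; apply/eqP.
rewrite /M /farC2 -exprVn.
have -> : 5 ^+ n.+1 * (d_ q)^-1 ^+ n.+1 * (11 ^+ n.+2 * K) * (4 * r) ^+ n.+1 =
  (5 * (d_ q)^-1 * (4 * r)) ^+ n.+1 * (11 ^+ n.+2 * K) by rewrite !exprMn; ring.
rewrite (_ : 5 * (d_ q)^-1 * (4 * r) = 100 / outer_c) ?mulrA//.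
by rewrite /r; field; rewrite !gt_eqF.
Qed.

Lemma far_energy_le : (outer_vol%:E * \int[leb]_x \int[leb]_y (far_kernel x y)%:E <=
  (farC1 + farC2)%:E * cross_energy s f v (Omega := Omega))%E.
Proof.
rewrite (integral2Zl_EFin leb (ltW outer_vol0) measurable_far_kernel far_kernel_ge0).
apply: (@le_trans _ _ (\int[leb]_x \int[leb]_y \int[leb]_q (a1 x y q + k2 x y q * h2 y q)%:E)%E).
  apply: nneg_le_integral => x _.
    by apply: integral_ge0 => y _; rewrite lee_fin mulr_ge0 ?far_kernel_ge0// ltW// outer_vol0.
  apply: nneg_le_integral => y _; last exact: far_outer.
  by rewrite lee_fin mulr_ge0 ?far_kernel_ge0// ltW// outer_vol0.
rewrite (@integral3D _ _ _ leb a1 (fun x y q => k2 x y q * h2 y q)).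
- rewrite EFinD ge0_muleDl ?lee_fin ?farC1_ge0 ?farC2_ge0//.
  by apply: leeD; [exact: far_first|exact: far_second].
- by rewrite /a1; mea.
- by rewrite /k2 /h2; mea.
- by move=> x y q; rewrite /a1; have := outer_ge0 x q; move: (outer x q) => o o0; nng.
- by move=> x y q; rewrite /k2 /h2; have := outer_ge0 x q; move: (outer x q) => o o0; nng.
Qed.

End far_energy.

Lemma lee_pdivlM {R : realType} (c K : R) (x y : \bar R) : 0 < c ->
  (c%:E * x <= K%:E * y)%E -> (x <= (K / c)%:E * y)%E.
Proof.
move=> c0 h.
have -> : x = ((c^-1)%:E * (c%:E * x))%E by rewrite muleA -EFinM mulVf ?mul1e// gt_eqF.
have -> : ((K / c)%:E * y = (c^-1)%:E * (K%:E * y))%E by rewrite muleA -EFinM (mulrC K).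
by apply: lee_wpmul2l h; rewrite lee_fin invr_ge0 ltW.
Qed.

Lemma integral2D {d : measure_display} {T : measurableType d} {R : realType}
    (m : {sigma_finite_measure set T -> \bar R}) (F G : T -> T -> R) :
  measurable_fun setT (fun p : T * T => F p.1 p.2) ->
  measurable_fun setT (fun p : T * T => G p.1 p.2) ->
  (forall x y, 0 <= F x y) -> (forall x y, 0 <= G x y) ->
  (\int[m]_x \int[m]_y (F x y + G x y)%:E =
   \int[m]_x \int[m]_y (F x y)%:E + \int[m]_x \int[m]_y (G x y)%:E)%E.
Proof.
move=> mF mG F0 G0.
have sec (H : T -> T -> R) x : measurable_fun setT (fun p : T * T => H p.1 p.2) ->
    measurable_fun setT (fun y => (H x y)%:E).
  move=> mH; apply/measurable_EFinP; exact: (measurableT_comp mH (measurable_pair1 x)).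
have out (H : T -> T -> R) : (forall x y, 0 <= H x y) ->
    measurable_fun setT (fun p : T * T => H p.1 p.2) ->
    measurable_fun setT (fun x => (\int[m]_y (H x y)%:E)%E).
  move=> H0 mH; pose K (p : T * T) := (H p.1 p.2)%:E.
  have mK : measurable_fun setT K by exact/measurable_EFinP.
  by apply: (measurable_fun_fubini_tonelli_F K mK) => p; rewrite lee_fin.
rewrite -ge0_integralD//; last 4 first.
- by move=> x _; apply: integral_ge0 => y _; rewrite lee_fin.
- exact: out.
- by move=> x _; apply: integral_ge0 => y _; rewrite lee_fin.
- exact: out.
apply: eq_integral => x _; rewrite -ge0_integralD//.
- by move=> z _; rewrite lee_fin.
- exact: sec.
- by move=> z _; rewrite lee_fin.
- exact: sec.
Qed.

Lemma energy_sum_bound {R : realType} (a K C q : R) (E X F N T : \bar R) :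
  0 <= a -> 0 <= K -> 0 <= C -> 0 <= q ->
  (0 <= X)%E -> (0 <= F)%E -> (0 <= N)%E -> (0 <= T)%E ->
  (E <= X + (F + N))%E -> (a%:E * X <= K%:E * T)%E -> (F <= C%:E * X)%E ->
  (a%:E * N <= q%:E * T)%E ->
  (a%:E * E <= (K * (1 + C) + q)%:E * T)%E.
Proof.
move=> a0 K0 C0 q0 X0 F0 N0 T0 EE EX EF EN.
have D (x y : R) (t : \bar R) : 0 <= x -> 0 <= y -> ((x + y)%:E * t = x%:E * t + y%:E * t)%E.
  by move=> x0 y0; rewrite EFinD ge0_muleDl.
apply: (le_trans (lee_wpmul2l _ EE)); first by rewrite lee_fin.
rewrite !ge0_muleDr ?adde_ge0// addeA D ?mulr_ge0 ?addr_ge0//; apply: leeD => //.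
apply: (@le_trans _ _ ((1 + C)%:E * (a%:E * X))%E).
  rewrite D// mul1e leeD2l// [leRHS]muleCA.
  by apply: lee_wpmul2l; rewrite ?lee_fin.
rewrite (mulrC K) EFinM -muleA; apply: lee_wpmul2l => //.
by rewrite lee_fin addr_ge0.
Qed.

Lemma lee_addM_bound {R : realType} (a b : R) (x y : \bar R) : 0 <= a -> 0 <= b ->
  (0 <= x)%E -> (0 <= y)%E -> (a%:E * x + b%:E * y <= (a + b)%:E * (x + y))%E.
Proof.
move=> a0 b0 x0 y0; rewrite ge0_muleDr//.
by apply: leeD; apply: lee_wpmul2r => //; rewrite lee_fin ?lerDl ?lerDr.
Qed.

(** * Pairs of nearby points, and the total bound *)

Section extension_bound.
Context {R : realType} {n : nat} {Omega : set 'rV[R]_n.+1}.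
Variable dd : domain_data Omega.
Local Notation leb := (@lebesgue_rV R n.+1).
Local Notation d_ := (dist_boundary Omega).
Local Notation dim := (n.+1%:R : R).
Local Notation wgt := (@exterior_weight R n Omega).
Local Notation mass := (@exterior_mass R n Omega).
Local Notation sep := (@separation R n Omega).
Local Notation rC := (@radialC R n.+1).

Let mO := measurable_domain dd.

Variables s_lo sigma s : R.
Hypotheses (sl0 : 0 < s_lo) (sls : s_lo <= s) (s1 : s < 1).
Hypotheses (sg0 : 0 < sigma) (sgs : sigma <= dim - s).

Let s0 : 0 < s. Proof. exact: lt_le_trans sls. Qed.
Let w0 z : 0 <= wgt s z. Proof. exact: wgt_ge0 (ltW s1). Qed.
Let mw : measurable_fun setT (wgt s). Proof. exact: measurable_wgt dd s. Qed.

Variables (c : R).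
Hypotheses (c0 : 0 < c)
  (Hc : forall x, Omega x -> ((c * d_ x `^ (- s))%:E <= mass s x)%E).

Variables (f : 'rV[R]_n.+1 -> R).
Hypothesis mf : measurable_fun setT f.
Hypothesis fint : (@ext_T1 R n Omega s f < +oo)%E.

Definition near_kernel (v : 'rV[R]_n.+1 -> R) x y : R := [?x \in Omega] *
  ([?enorm (x - y) < d_ x / 2] * (`|v x - v y| * enorm (x - y) `^ (- (dim + s)))).

Lemma near_kernel_ge0 v x y : 0 <= near_kernel v x y.
Proof. by rewrite /near_kernel; nng. Qed.

Lemma measurable_near_kernel v : measurable_fun setT v ->
  measurable_fun setT (fun p : 'rV[R]_n.+1 * 'rV[R]_n.+1 => near_kernel v p.1 p.2).
Proof. by move=> mv; rewrite /near_kernel; mea. Qed.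

Local Notation A := (@ext_avg R n Omega s f).

Definition nearL : R := dim * (2 ^+ n.+1) ^+ 2.
Definition nearC : R := nearL * rC * (2 * 4 ^+ n.+1 * (rC / s_lo + rC / sigma)).

Lemma nearL_ge0 : 0 <= nearL.
Proof. by rewrite /nearL mulr_ge0// exprn_ge0// exprn_ge0. Qed.

Let kI : 0 <= 2 * 4 ^+ n.+1 * (rC / s_lo + rC / sigma).
Proof.
have q1 : 0 <= rC / s_lo by rewrite divr_ge0 ?radialC_ge0// ltW.
have q2 : 0 <= rC / sigma by rewrite divr_ge0 ?radialC_ge0// ltW.
by apply: mulr_ge0; [rewrite mulr_ge0// exprn_ge0|exact: addr_ge0].
Qed.

Lemma nearC_ge0 : 0 <= nearC.
Proof. by rewrite /nearC mulr_ge0 ?kI// mulr_ge0 ?nearL_ge0// radialC_ge0. Qed.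

Let k x z q : R := [?x \in Omega] * (nearL * rC * (d_ x `^ s *
  (enorm (x - z) `^ (- dim) * enorm (x - q) `^ (- dim)))).
Let h z q : R := wgt s z * (wgt s q * `|f q - f z|).
Let g2 x z q : R := (d_ x `^ s * (enorm (x - z) `^ (- dim) * wgt s z)) *
  (d_ x `^ s * (enorm (x - q) `^ (- dim) * (wgt s q * `|f q - f z|))).

Let h0 z q : 0 <= h z q. Proof. by rewrite /h; nng; exact: w0. Qed.
Let g20 x z q : 0 <= g2 x z q. Proof. by rewrite /g2; nng; exact: w0. Qed.
Let k0 x z q : 0 <= k x z q.
Proof.
have L0 := nearL_ge0; have r0 := @radialC_ge0 R n.
rewrite /k; apply: mulr_ge0; first exact: ler0n.
by apply: mulr_ge0; [exact: mulr_ge0|rewrite mulr_ge0 ?powR_ge0// mulr_ge0 ?powR_ge0].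
Qed.

(** The factor |x - y|/d_x of [extension_near2] lowers the singularity to |x - y|^(1-s-d). Its
    integral over the ball of radius d_x/2 is of order d_x^(1-s)/(1 - s), and the denominator
    cancels against 1 - s. *)
Lemma near_section x : Omega x ->
  (\int[leb]_y (((1 - s) * c ^+ 2) * near_kernel A x y)%:E <=
   (nearL * rC * d_ x `^ (- s))%:E * \int[leb]_z \int[leb]_q (g2 x z q)%:E)%E.
Proof.
move=> Ox; have dx := dist_in_gt0 dd Ox.
have L0 := nearL_ge0; have r0 := @radialC_ge0 R n.
have s1' : 0 < 1 - s by rewrite subr_gt0.
set G := (\int[leb]_z \int[leb]_q (g2 x z q)%:E)%E.
have G0 : (0 <= G)%E.
  by apply: integral_ge0 => z _; apply: integral_ge0 => q _; rewrite lee_fin.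
pose H y : R := ((1 - s) * (nearL / d_ x)) *
  ([?enorm (y - x) <= d_ x / 2] * enorm (y - x) `^ ((1 - s) - dim)).
have M0 : 0 <= (1 - s) * (nearL / d_ x) by rewrite mulr_ge0 ?(ltW s1')// divr_ge0// ltW.
have H0 y : 0 <= H y by rewrite /H; apply: mulr_ge0 => //; nng.
have mH : measurable_fun setT H by rewrite /H; mea.
apply: (@le_trans _ _ (\int[leb]_y ((H y)%:E * G))%E).
  apply: nneg_le_integral => y _.
    by rewrite lee_fin mulr_ge0 ?near_kernel_ge0// mulr_ge0 ?(ltW s1')// sqr_ge0.
  rewrite /near_kernel; case: (boolP (enorm (x - y) < d_ x / 2)) => [xy|_]; last first.
    by rewrite mul0r !mulr0 mule_ge0// lee_fin.
  have [xy0|xy0] := eqVneq (enorm (x - y)) 0.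
    have -> : x = y by apply/eqP; rewrite -subr_eq0; apply/eqP/enorm_eq0.
    by rewrite subrr normr0 mul0r !mulr0 mule_ge0// lee_fin.
  have xyp : 0 < enorm (x - y) by rewrite lt_neqAle eq_sym xy0 enorm_ge0.
  have E := extension_near2 dd s0 s1 c0 Hc mf fint Ox xy.
  set K := enorm (x - y) `^ (- (dim + s)); have K0 : 0 <= K by exact: powR_ge0.
  apply: (@le_trans _ _ (((1 - s) * K)%:E * ((nearL * (enorm (x - y) / d_ x))%:E * G))%E).
    apply: (@le_trans _ _ (((1 - s) * K)%:E * (c ^+ 2 * `|A y - A x|)%:E)%E); last first.
      by apply: lee_wpmul2l; [rewrite lee_fin mulr_ge0// ltW|exact: E].
    have E' (a b e e' t t' w : R) : t = 1 -> t' = 1 -> e = e' ->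
        ((a * b * (t * (t' * (e * w))))%:E <= (a * w)%:E * (b * e')%:E)%E.
      move=> -> -> ->; rewrite -EFinM lee_fin.
      by rewrite (_ : a * b * (1 * (1 * (e' * w))) = a * w * (b * e'))//; ring.
    by apply: E'; [rewrite (mem_set Ox)|by []|exact: distrC].
  have E' (a l e r K' t b : R) (g : \bar R) : (0 <= g)%E -> t = 1 -> b = r * K' ->
      ((a * K')%:E * ((l * (r / e))%:E * g) <= (a * (l / e) * (t * b))%:E * g)%E.
    move=> g0 -> ->; rewrite muleA -EFinM; apply: lee_wpmul2r => //; rewrite lee_fin.
    by rewrite (_ : a * K' * (l * (r / e)) = a * (l / e) * (1 * (r * K')))//; ring.
  apply: E' => //; first by rewrite enormB (ltW xy).
  by rewrite (enormB y x) /K (mulr_powR _ xyp); congr (_ `^ _); ring.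
rewrite ge0_integralZr//; last 2 first.
- exact/measurable_EFinP.
- by move=> y _; rewrite lee_fin.
apply: lee_wpmul2r => //.
rewrite integralZl_EFin; [|by mea|by move=> y; nng|exact: M0].
have d2 : 0 < d_ x / 2 by rewrite divr_gt0.
have b1 : 1 - s < 1 by rewrite ltrBlDr ltrDl.
apply: (le_trans (lee_wpmul2l _ (@radial_near R n.+1 x (d_ x / 2) (1 - s) d2 s1' b1))).
  by rewrite lee_fin.
rewrite -EFinM lee_fin.
have -> : (1 - s) * (nearL / d_ x) * (rC * ((d_ x / 2) `^ (1 - s) / (1 - s))) =
   nearL * rC * ((d_ x)^-1 * (d_ x / 2) `^ (1 - s)) by field; rewrite !gt_eqF.
apply: ler_wpM2l; first exact: mulr_ge0.
apply: (@le_trans _ _ ((d_ x)^-1 * d_ x `^ (1 - s))).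
  rewrite ler_pM2l ?invr_gt0//; apply: ge0_ler_powR; rewrite ?nnegrE ?(ltW s1') ?(ltW dx) ?(ltW d2)//.
  by lra.
by rewrite -mulr_powR// mulrA mulVf ?mul1r// gt_eqF.
Qed.

Lemma near_energy_le :
  (((1 - s) * c ^+ 2)%:E * \int[leb]_x \int[leb]_y (near_kernel A x y)%:E <=
   nearC%:E * @ext_T2 R n Omega s f)%E.
Proof.
have mA : measurable_fun setT A by exact: (measurable_ext_avg dd s1 mf).
have L0 := nearL_ge0; have r0 := @radialC_ge0 R n.
have s1' : 0 <= 1 - s by rewrite subr_ge0 ltW.
have sc0 : 0 <= (1 - s) * c ^+ 2 by rewrite mulr_ge0// sqr_ge0.
rewrite (integral2Zl_EFin leb sc0 (measurable_near_kernel mA) (near_kernel_ge0 A)).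
have mk : measurable_fun setT (fun p : 'rV[R]_n.+1 * ('rV[R]_n.+1 * 'rV[R]_n.+1) => k p.1 p.2.1 p.2.2).
  by rewrite /k; mea.
have mh : measurable_fun setT (fun p : 'rV[R]_n.+1 * 'rV[R]_n.+1 => h p.1 p.2).
  by rewrite /h; mea.
apply: (@le_trans _ _ (\int[leb]_x \int[leb]_z \int[leb]_q (k x z q * h z q)%:E)%E).
  apply: nneg_le_integral => x _.
    by apply: integral_ge0 => y _; rewrite lee_fin mulr_ge0// near_kernel_ge0.
  have [xO|xO] := boolP (x \in Omega); last first.
    rewrite integral0_eq.
      by apply: integral_ge0 => z _; apply: integral_ge0 => q _; rewrite lee_fin mulr_ge0.
    by move=> y _; rewrite /near_kernel (negbTE xO) mul0r mulr0.
  have Ox := set_mem xO; have dx := dist_in_gt0 dd Ox.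
  apply: (le_trans (near_section Ox)).
  have mg2 : measurable_fun setT (fun p : 'rV[R]_n.+1 * 'rV[R]_n.+1 => g2 x p.1 p.2).
    by rewrite /g2; mea.
  have L00 : 0 <= nearL * rC * d_ x `^ (- s) by rewrite mulr_ge0 ?powR_ge0// mulr_ge0.
  rewrite (integral2Zl_EFin leb L00 mg2 (g20 x)).
  rewrite le_eqVlt; apply/orP; left; apply/eqP.
  apply: eq_integral => z _; apply: eq_integral => q _; congr EFin.
  rewrite /g2 /k /h.
  (* Of the two factors d_x^s from the two averages, one cancels d_x^(-s); the other remains for
     [kernel_interior]. *)
  have E (t L ds d wz wq K1 K2 D : R) : t = 1 -> ds * d = 1 ->
      L * ds * ((d * (K1 * wz)) * (d * (K2 * (wq * D)))) =
      t * (L * (d * (K1 * K2))) * (wz * (wq * D)).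
    move=> -> e; transitivity ((ds * d) * (L * (d * (K1 * K2)) * (wz * (wq * D)))).
      ring.
    by rewrite e; ring.
  apply: E; first by rewrite xO.
  by rewrite -powRD_gt0// addNr powRr0.
apply: (le_trans (integral_swap3_le (m := leb) (k := k) (h := h)
  (C := fun z q => nearC * Num.min (sep z q) 1 `^ (s - dim)) mk k0 mh h0 _)); last first.
  rewrite /ext_T2 (integral2Zl_EFin leb nearC_ge0 (measurable_T2_kernel dd s mf) (T2_kernel_ge0 s1 f)).
  rewrite le_eqVlt; apply/orP; left; apply/eqP.
  apply: eq_integral => z _; apply: eq_integral => q _; congr EFin.
  by rewrite /T2_kernel /h (sepC q z) -mulrA.
move=> z q hz.
have Wz : wgt s z != 0 by apply: contra_neq hz => e; rewrite /h e mul0r.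
have Wq : wgt s q != 0 by apply: contra_neq hz => e; rewrite /h e mul0r mulr0.
have Oz : ~ Omega z by move=> Oz; move: Wz; rewrite wgt_dom ?eqxx//; exact: mem_set.
have Oq : ~ Omega q by move=> Oq; move: Wq; rewrite wgt_dom ?eqxx//; exact: mem_set.
(* the weight vanishes on the boundary because 0 `^ (- s) = 0 *)
have dz : 0 < d_ z.
  rewrite lt_neqAle dist_set_ge0 andbT; apply: contra_neq Wz => dz.
  by rewrite /exterior_weight /mu_density -dz powR0 ?oppr_eq0 ?gt_eqF// mulr0 mul0r mulr0.
have sgs' := sgs.
rewrite (_ : (\int[leb]_x (k x z q)%:E)%E = (\int[leb]_x ((nearL * rC) * ([?x \in Omega] *
    (d_ x `^ s * (enorm (x - z) `^ (- dim) * enorm (x - q) `^ (- dim)))))%:E)%E); last first.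
  by apply: eq_integral => x _; congr EFin; rewrite /k mulrCA.
rewrite integralZl_EFin; [|by mea|by move=> x; nng|exact: mulr_ge0].
apply: (le_trans (lee_wpmul2l _ (kernel_interior dd sl0 sls s1 sg0 sgs' Oz Oq dz))).
  by rewrite lee_fin mulr_ge0.
by rewrite -EFinM mulrA.
Qed.

Hypothesis fO : forall x, Omega x -> f x = 0.

Definition extension x : R := [?x \in Omega] * A x + f x.

Lemma extension_in x : Omega x -> extension x = A x.
Proof. by move=> Ox; rewrite /extension (mem_set Ox) mul1r fO// addr0. Qed.

Lemma extension_out x : x \notin Omega -> extension x = f x.
Proof. by move=> xO; rewrite /extension (negbTE xO) mul0r add0r. Qed.

Lemma measurable_extension : measurable_fun setT extension.
Proof.
have mA : measurable_fun setT A by exact: (measurable_ext_avg dd s1 mf).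
by rewrite /extension; move: (ext_avg _ _) mA => v mv; mea.
Qed.

Local Notation cross := (@cross_kernel R n Omega s f A).
Local Notation far := (@far_kernel R n Omega s A).

(** For fixed x the integrands compare only for y off the boundary, because the cross kernel is 0 at
    boundary points; the boundary being null, this suffices. *)
Lemma energy_extension_le : (energy Omega s extension <=
  cross_energy s f A (Omega := Omega) + (\int[leb]_x \int[leb]_y (far x y)%:E +
  \int[leb]_x \int[leb]_y (near_kernel A x y)%:E))%E.
Proof.
have mA : measurable_fun setT A by exact: (measurable_ext_avg dd s1 mf).
have mu := measurable_extension.
have mc := measurable_cross_kernel dd s mf mA; have cc0 := @cross_kernel_ge0 R n Omega s f A.
have mfa := measurable_far_kernel dd s mA; have f0 := @far_kernel_ge0 R n Omega s A.
have mn := measurable_near_kernel mA; have n0 := near_kernel_ge0 A.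
pose FN x y := far x y + near_kernel A x y.
have FN0 x y : 0 <= FN x y by exact: addr_ge0.
have mFN : measurable_fun setT (fun p : 'rV[R]_n.+1 * 'rV[R]_n.+1 => FN p.1 p.2) by exact: measurable_funD.
apply: (@le_trans _ _ (\int[leb]_x \int[leb]_y (cross x y + FN x y)%:E)%E); last first.
  rewrite le_eqVlt; apply/orP; left; apply/eqP.
  apply: (etrans (integral2D leb mc mFN cc0 FN0)); congr (_ + _)%E.
  exact: (integral2D leb mfa mn f0 n0).
rewrite /energy.
apply: nneg_le_integral => x _.
  by apply: integral_ge0 => y _; rewrite lee_fin; nng.
apply: ae_ge0_le_integral => //.
- by move=> y _; rewrite lee_fin; nng.
- by apply/measurable_EFinP; move: extension mu => u mu; mea.
- by move=> y _; rewrite lee_fin addr_ge0.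
- apply/measurable_EFinP; apply: measurable_funD.
    exact: (measurableT_comp mc (measurable_pair1 x)).
  exact: (measurableT_comp mFN (measurable_pair1 x)).
exists (boundary Omega); split; [exact: measurable_boundary|exact: boundary_null|].
move=> y /= ny; apply/not_notP => by_; apply: ny => _.
rewrite lee_fin; set K := enorm (x - y) `^ (- (dim + s)).
have [xO|xO] := boolP (x \in Omega); last by rewrite mul0r addr_ge0.
have Ox := set_mem xO; rewrite mul1r (extension_in Ox).
have [yO|yO] := boolP (y \in Omega).
  rewrite (extension_in (set_mem yO)).
  have [xy|xy] := leP (d_ x / 2) (enorm (x - y)).
    apply: (@le_trans _ _ (far x y)); first by rewrite /far_kernel xO yO xy !mul1r.
    by rewrite /FN addrA -addrA addrCA lerDl addr_ge0.
  apply: (@le_trans _ _ (near_kernel A x y)); first by rewrite /near_kernel xO xy !mul1r.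
  by rewrite /FN addrA lerDr addr_ge0.
rewrite (extension_out yO).
have Oy : ~ Omega y by move/negP : yO => yO Oy; apply: yO; exact/mem_set.
have dy : 0 < d_ y.
  rewrite lt_neqAle dist_set_ge0 andbT; apply/eqP => dy; apply: by_.
  exact: (dist0_boundary dd).
apply: (@le_trans _ _ (cross x y)); first by rewrite /cross_kernel xO yO dy !mul1r.
by rewrite lerDl.
Qed.

Definition ext_const : R := (rC / s_lo + @dom_vol R n Omega) / c +
  ((@kernel_extC R n Omega s_lo / c) * (1 + (@farC1 R n s_lo + @farC2 R n Omega dd) / outer_vol dd) +
   nearC / c ^+ 2).

Lemma extension_norm_le : (L1in Omega extension + (1 - s)%:E * energy Omega s extension <=
  ext_const%:E * (@ext_T1 R n Omega s f + @ext_T2 R n Omega s f))%E.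
Proof.
have mA : measurable_fun setT A by exact: (measurable_ext_avg dd s1 mf).
have s1' : 0 <= 1 - s by rewrite subr_ge0 ltW.
set T1 := ext_T1 s f; set T2 := ext_T2 s f.
have T10 : (0 <= T1)%E by apply: integral_ge0 => z _; rewrite lee_fin; nng; exact: w0.
have T20 : (0 <= T2)%E.
  by apply: integral_ge0 => z _; apply: integral_ge0 => y _; rewrite lee_fin T2_kernel_ge0.
have rs0 : 0 <= rC / s_lo by rewrite divr_ge0 ?radialC_ge0// ltW.
have KC0 := @kernel_extC_ge0 R n Omega s_lo sl0.
have Ea : (L1in Omega extension <= ((rC / s_lo + @dom_vol R n Omega) / c)%:E * T1)%E.
  have -> : L1in Omega extension = (\int[leb]_x ([?x \in Omega] * `|A x|)%:E)%E.
    apply: eq_integral => x _; have [xO|_] := boolP (x \in Omega); last by rewrite !mul0r.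
    by rewrite (extension_in (set_mem xO)).
  by apply: lee_pdivlM => //; exact: (ext_L1in dd sl0 sls s1 c0 Hc mf fint).
set X := cross_energy s f A (Omega := Omega).
set F := (\int[leb]_x \int[leb]_y (far x y)%:E)%E.
set N := (\int[leb]_x \int[leb]_y (near_kernel A x y)%:E)%E.
have X0 : (0 <= X)%E.
  by apply: integral_ge0 => x _; apply: integral_ge0 => y _; rewrite lee_fin cross_kernel_ge0.
have F0 : (0 <= F)%E.
  by apply: integral_ge0 => x _; apply: integral_ge0 => y _; rewrite lee_fin far_kernel_ge0.
have N0 : (0 <= N)%E.
  by apply: integral_ge0 => x _; apply: integral_ge0 => y _; rewrite lee_fin near_kernel_ge0.
have EX : ((1 - s)%:E * X <= (@kernel_extC R n Omega s_lo / c)%:E * T2)%E.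
  apply: lee_pdivlM => //; rewrite muleA -EFinM (mulrC c).
  exact: (ext_cross_le dd sl0 sls s1 c0 Hc mf fint).
set FC := (@farC1 R n s_lo + @farC2 R n Omega dd) / outer_vol dd.
have FC0 : 0 <= FC.
  by rewrite /FC divr_ge0 ?addr_ge0 ?farC1_ge0 ?farC2_ge0// ltW// outer_vol0.
have EF : (F <= FC%:E * X)%E.
  apply: lee_pdivlM; [exact: outer_vol0|exact: (far_energy_le dd sl0 sls s1 mA mf)].
have EN : ((1 - s)%:E * N <= (nearC / c ^+ 2)%:E * T2)%E.
  apply: lee_pdivlM; first by rewrite exprn_gt0.
  by rewrite muleA -EFinM (mulrC (c ^+ 2)); exact: near_energy_le.
have K0 : 0 <= @kernel_extC R n Omega s_lo / c by rewrite divr_ge0// ltW.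
have q0 : 0 <= nearC / c ^+ 2 by rewrite divr_ge0 ?nearC_ge0// sqr_ge0.
have Ee := energy_sum_bound s1' K0 FC0 q0 X0 F0 N0 T20 energy_extension_le EX EF EN.
apply: (le_trans (leeD Ea Ee)).
have a0 : 0 <= (rC / s_lo + @dom_vol R n Omega) / c.
  by rewrite divr_ge0 ?addr_ge0 ?dom_vol_ge0// ltW.
have b0 : 0 <= @kernel_extC R n Omega s_lo / c * (1 + FC) + nearC / c ^+ 2.
  by rewrite addr_ge0// mulr_ge0// addr_ge0.
exact: lee_addM_bound a0 b0 T10 T20.
Qed.

Lemma ext_const_ge0 : 0 <= ext_const.
Proof.
have rs0 : 0 <= rC / s_lo by rewrite divr_ge0 ?radialC_ge0// ltW.
have v0 := @dom_vol_ge0 R n Omega.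
have KC0 := @kernel_extC_ge0 R n Omega s_lo sl0.
have FC0 : 0 <= (@farC1 R n s_lo + @farC2 R n Omega dd) / outer_vol dd.
  by rewrite divr_ge0 ?addr_ge0 ?farC1_ge0 ?farC2_ge0// ltW// outer_vol0.
rewrite /ext_const addr_ge0//; first by rewrite divr_ge0 ?addr_ge0// ltW.
rewrite addr_ge0//; first by rewrite mulr_ge0 ?addr_ge0// divr_ge0// ltW.
by rewrite divr_ge0 ?nearC_ge0// sqr_ge0.
Qed.

End extension_bound.

(** * The operators between the function spaces *)

Section extension_operator.
Context {R : realType} {n : nat} {Omega : set 'rV[R]_n.+1}.
Variable dd : domain_data Omega.
Local Notation leb := (@lebesgue_rV R n.+1).
Local Notation d_ := (dist_boundary Omega).
Local Notation dim := (n.+1%:R : R).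
Local Notation wgt := (@exterior_weight R n Omega).
Local Notation T1 := (@ext_T1 R n Omega).
Local Notation T2 := (@ext_T2 R n Omega).

Let oO := dd_open dd.
Let mO := measurable_domain dd.

(** [Tr Omega g] erases the values of g inside Omega, so the extension depends on g only through the
    complement. *)
Definition trace_extension (s : R) (g : 'rV[R]_n.+1 -> R) := @extension R n Omega s (Tr Omega g).

Lemma Tr_in (g : 'rV[R]_n.+1 -> R) x : Omega x -> Tr Omega g x = 0.
Proof. by move=> Ox; rewrite /Tr patchE memNset//; apply/not_notP. Qed.

Lemma Tr_out (g : 'rV[R]_n.+1 -> R) x : ~ Omega x -> Tr Omega g x = g x.
Proof. by move=> Ox; rewrite /Tr patchE mem_set. Qed.

Lemma measurable_TrT (g : 'rV[R]_n.+1 -> R) : measurable_fun (~` Omega) g ->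
  measurable_fun setT (Tr Omega g).
Proof. by move=> mg; apply/(measurable_restrictT _ _).1 => //; exact: measurableC. Qed.

Lemma trace_extension_out s g x : ~ Omega x -> trace_extension s g x = g x.
Proof.
move=> Ox; rewrite /trace_extension extension_out ?Tr_out//.
by apply/negP => xO; exact: Ox (set_mem xO).
Qed.

Lemma ext_T1_Tr s g : s <= 1 -> measurable_fun (~` Omega) g ->
  T1 s (Tr Omega g) = L1_norm Omega s g.
Proof.
move=> s1 mg; rewrite (L1_normE dd)//; apply: eq_integral => x _; congr EFin.
rewrite /exterior_weight; have [xO|xO] := boolP (x \in Omega); first by rewrite !mul0r.
rewrite Tr_out; last by move=> Ox; move/negP: xO; apply; exact: mem_set.
by rewrite -mulrA (mulrC (mu_density _ _ _)).
Qed.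

(** Both integrals against [mu_s] become Lebesgue integrals with weights, the inner one for each
    fixed y and then the outer one, matching the form of the estimates above. *)
Lemma T_norm_Tr s g : 0 < s -> s < 1 -> measurable_fun (~` Omega) g ->
  T_norm Omega s g = (T1 s (Tr Omega g) + T2 s (Tr Omega g))%E.
Proof.
move=> s0 s1 mg; have s1' := ltW s1; rewrite /T_norm ext_T1_Tr//; congr (_ + _)%E.
have mf := measurable_TrT mg; set f := Tr Omega g in mf *.
pose J (y x : 'rV[R]_n.+1) : R :=
  `|f x - f y| / Num.min (enorm (x - y) + d_ x + d_ y) 1 `^ (dim - s).
have J0 y x : 0 <= J y x by rewrite /J divr_ge0 ?powR_ge0.
have mJ : measurable_fun setT (fun p : 'rV[R]_n.+1 * 'rV[R]_n.+1 => J p.1 p.2) by rewrite /J; mea.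
have md := @measurable_mu_density R n Omega s.
pose I y x : R := [?x \notin Omega] * (J y x * mu_density Omega s x).
have I0 y x : 0 <= I y x by rewrite /I mulr_ge0// mulr_ge0// (mu_density_ge0 _ s1').
have mI : measurable_fun setT (fun p : 'rV[R]_n.+1 * 'rV[R]_n.+1 => (I p.1 p.2)%:E).
  by apply/measurable_EFinP; rewrite /I; mea.
have inner y : (\int[mu_s Omega s]_(x in ~` Omega) (J y x)%:E = \int[leb]_x (I y x)%:E)%E.
  have mJy : measurable_fun (~` Omega) (J y).
    by apply: measurable_funTS; exact: (measurableT_comp mJ (measurable_pair1 y)).
  exact: (integral_mu_s_EFin dd s1' mJy (J0 y)).
transitivity (\int[mu_s Omega s]_(y in ~` Omega) \int[leb]_x (I y x)%:E)%E.
  apply: (eq_integral (mu := Defs_mu_s__canonical__measure_function_Measure oO s1')) => y yO.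
  rewrite -inner.
  apply: (eq_integral (mu := Defs_mu_s__canonical__measure_function_Measure oO s1')) => x xO.
  by rewrite /J /f !Tr_out//; [exact: (set_mem yO)|exact: (set_mem xO)].
pose K y := (\int[leb]_x (I y x)%:E)%E.
have mK : measurable_fun (~` Omega) K.
  apply: measurable_funTS; apply: (measurable_fun_fubini_tonelli_F (fun p => (I p.1 p.2)%:E) mI).
  by move=> p; rewrite lee_fin.
have K0 y : (~` Omega) y -> (0 <= K y)%E by move=> _; apply: integral_ge0 => x _; rewrite lee_fin.
apply: (etrans (integral_mu_s dd s1' mK K0)).
rewrite integral_mkcond; apply: eq_integral => y _; rewrite patchE.
case: ifPn => yO; last first.
  have yO' : y \in Omega by apply/mem_set/not_notP => Oy; move/negP: yO; apply; exact: mem_set.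
  by rewrite integral0_eq// => x _; rewrite /T2_kernel (wgt_dom s yO') mul0r mulr0.
have Oy : ~ Omega y := set_mem yO.
have yO' : y \notin Omega by apply/negP => yO'; exact: Oy (set_mem yO').
have mIy : measurable_fun setT (I y).
  by apply/measurable_EFinP; exact: (measurableT_comp mI (measurable_pair1 y)).
rewrite /K muleC -integralZl_EFin//; last exact: mu_density_ge0.
apply: eq_integral => x _; congr EFin.
have Wy : wgt s y = mu_density Omega s y by rewrite /exterior_weight yO' mul1r.
rewrite /T2_kernel Wy /I /J /exterior_weight /separation -(opprB dim) powRN.
by move: (mu_density _ _ _) (mu_density _ _ _) (_^-1) => a b e; ring.
Qed.

Lemma T_normE s g : 0 < s -> s < 1 -> fcarrier (T_space Omega s) g ->
  [/\ measurable_fun setT (Tr Omega g), (T1 s (Tr Omega g) < +oo)%E &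
      (T1 s (Tr Omega g) + T2 s (Tr Omega g) < +oo)%E].
Proof.
move=> s0 s1 [mg]; rewrite T_norm_Tr// => H; split => //; first exact: measurable_TrT.
apply: le_lt_trans H; rewrite leeDl//.
apply: integral_ge0 => z _; apply: integral_ge0 => y _.
by rewrite lee_fin T2_kernel_ge0.
Qed.

(** The constant is fixed before s. The dimension enters the range of uniformity only through the
    condition on [sigma]. *)
Lemma trace_extension_bound (s_lo sigma : R) : 0 < s_lo -> 0 < sigma ->
  exists2 C : R, 0 <= C & forall s, s_lo <= s -> s < 1 -> sigma <= dim - s ->
    continuity_constant (T_space Omega s) (V_space Omega s) (trace_extension s) C.
Proof.
move=> sl0 sg0; have [c c0 Hc] := mass_lower dd sl0.
exists (ext_const dd s_lo sigma c); first exact: ext_const_ge0.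
move=> s sls s1 sgs g Tg; have s0 : 0 < s by exact: lt_le_trans sls.
have [mf fint _] := T_normE s0 s1 Tg; have [mg _] := Tg.
rewrite /= L1inE V_seminormE T_norm_Tr//.
exact: (extension_norm_le dd sl0 sls s1 sg0 sgs c0 (fun x => Hc s x sls s1) mf fint (@Tr_in g)).
Qed.

Lemma trace_extension_carrier s g : 0 < s -> s < 1 -> fcarrier (T_space Omega s) g ->
  fcarrier (V_space Omega s) (trace_extension s g).
Proof.
move=> s0 s1 Tg; have [mf fint Tlty] := T_normE s0 s1 Tg; have [mg _] := Tg.
have ds0 : 0 < dim - s by rewrite subr_gt0; apply: lt_le_trans s1 _; rewrite ler1n.
have [C C0 H] := trace_extension_bound s0 ds0.
split; first exact: (measurable_extension dd s1 mf).
have := H s (lexx s) s1 (lexx _) g Tg; rewrite /= => {}H.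
have Vn : (V_seminorm Omega s (trace_extension s g) <=
    \int[leb]_(x in Omega) `|trace_extension s g x|%:E + V_seminorm Omega s (trace_extension s g))%E.
  by rewrite leeDr// integral_ge0.
apply: (le_lt_trans Vn); apply: (le_lt_trans H).
by rewrite T_norm_Tr// lte_mul_pinfty.
Qed.

Let ker_int s f x : 0 < s -> s < 1 -> measurable_fun setT f -> (T1 s f < +oo)%E -> Omega x ->
  leb.-integrable setT (EFin \o (fun z => @ext_ker R n Omega s x z * f z)).
Proof.
move=> s0 s1 mf fint Ox.
apply: integrable_kernelM => //.
- exact: (measurable_ext_ker dd).
- exact: ext_ker_ge0.
- exact: (ext_ker_lty dd s1 mf fint Ox).
Qed.

(** This holds at every point: the denominator depends on x alone, and the numerators are integrals
    of integrable functions. *)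
Lemma trace_extension_lincomb s (a b : R) g h : 0 < s -> s < 1 ->
  fcarrier (T_space Omega s) g -> fcarrier (T_space Omega s) h ->
  trace_extension s (fun x => a * g x + b * h x) =
  (fun x => a * trace_extension s g x + b * trace_extension s h x).
Proof.
move=> s0 s1 Tg Th; have [mf fint _] := T_normE s0 s1 Tg; have [mh hint _] := T_normE s0 s1 Th.
apply/funext => x; have [Ox|Ox] := pselect (Omega x); last by rewrite !trace_extension_out.
rewrite /trace_extension !extension_in; try exact: Tr_in; try by [].
rewrite /ext_avg /average !mulrA -mulrDl; congr (_ / _).
have Ig := ker_int s0 s1 mf fint Ox; have Ih := ker_int s0 s1 mh hint Ox.
have fg := integrable_fin_num measurableT Ig; have fh := integrable_fin_num measurableT Ih.
have sc (k : R) (u : 'rV[R]_n.+1 -> R) :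
    leb.-integrable setT (EFin \o (fun z => @ext_ker R n Omega s x z * u z)) ->
    leb.-integrable setT (EFin \o (fun z => k * (@ext_ker R n Omega s x z * u z))).
  by move=> Iu; apply: (eq_integrable _ _ _ _ (integrableZl measurableT k Iu)).
have -> : (\int[leb]_z (@ext_ker R n Omega s x z * Tr Omega (fun x => a * g x + b * h x)%R z)%:E =
    \int[leb]_z (a * (@ext_ker R n Omega s x z * Tr Omega g z) +
      b * (@ext_ker R n Omega s x z * Tr Omega h z))%:E)%E.
  apply: eq_integral => z _; congr EFin.
  have [Oz|Oz] := pselect (Omega z); first by rewrite !Tr_in//; ring.
  by rewrite !Tr_out//; ring.
have zl (k : R) (u : 'rV[R]_n.+1 -> R) :
    leb.-integrable setT (EFin \o (fun z => @ext_ker R n Omega s x z * u z)) ->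
    (\int[leb]_z (k * (@ext_ker R n Omega s x z * u z))%:E =
     k%:E * \int[leb]_z (@ext_ker R n Omega s x z * u z)%:E)%E.
  by move=> Iu; rewrite -(integralZl measurableT Iu).
rewrite (integralD_EFin measurableT (sc a _ Ig) (sc b _ Ih)) zl// zl//.
by rewrite fineD ?fin_numM// !fineM.
Qed.

(** Averages do not see the null set where g and h differ, so inside Omega the extensions agree
    everywhere. *)
Lemma trace_extension_ae s g h : 0 < s -> s < 1 ->
  fcarrier (T_space Omega s) g -> fcarrier (T_space Omega s) h ->
  fequiv (T_space Omega s) g h ->
  fequiv (V_space Omega s) (trace_extension s g) (trace_extension s h).
Proof.
move=> s0 s1 Tg Th; have [mf fint _] := T_normE s0 s1 Tg; have [mh hint _] := T_normE s0 s1 Th.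
move=> [N [mN N0 HN]].
have eqN z : ~ N z -> Tr Omega g z = Tr Omega h z.
  move=> nz; have [Oz|Oz] := pselect (Omega z); first by rewrite !Tr_in.
  by rewrite !Tr_out//; apply/not_notP => gh; apply: nz; apply: HN => /= H; exact: gh (H Oz).
have E x : @ext_avg R n Omega s (Tr Omega g) x = @ext_avg R n Omega s (Tr Omega h) x.
  rewrite /ext_avg /average; congr (fine _ / _).
  have mk := measurable_ext_ker dd s x.
  apply: ae_eq_integral => //.
  - by apply/measurable_EFinP; exact: measurable_funM.
  - by apply/measurable_EFinP; exact: measurable_funM.
  exists N; split => // z /= nz; apply/not_notP => Nz; apply: nz => _.
  by rewrite eqN.
exists N; split => // x /= nx; apply/not_notP => Nx; apply: nx => _.
by rewrite /trace_extension /extension E eqN.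
Qed.

Lemma trace_extension_linear s : 0 < s -> s < 1 ->
  linear_operator (T_space Omega s) (V_space Omega s) (trace_extension s).
Proof.
move=> s0 s1; split.
- by move=> g Tg; exact: trace_extension_carrier.
- by move=> g h Tg Th; exact: trace_extension_ae.
- move=> a b g h Tg Th; rewrite trace_extension_lincomb//.
  by exists set0; split => // x /=; apply.
Qed.

Lemma trace_extension_continuous s : 0 < s -> s < 1 ->
  continuous_operator (T_space Omega s) (V_space Omega s) (trace_extension s).
Proof.
move=> s0 s1; have ds0 : 0 < dim - s by rewrite subr_gt0; apply: lt_le_trans s1 _; rewrite ler1n.
have [C C0 H] := trace_extension_bound s0 ds0.
apply: (bounded_continuous C0) => [|g h [mg _] [mh _] /= lt|g h Tg Th _|g].
- exact: H.
- by split => //; exact: measurable_funB.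
(* The difference is the linear combination with coefficients 1 and -1, to which the pointwise
   linearity applies. *)
- congr (fnorm _ _); apply/esym.
  have -> : h \- g = (fun x => 1 * h x + (-1) * g x).
    by apply/funext => x /=; rewrite mul1r mulN1r.
  by rewrite trace_extension_lincomb//; apply/funext => x /=; rewrite mul1r mulN1r.
- rewrite /= /T_norm adde_ge0//.
    by apply: (@integral_ge0 _ _ _ (Defs_mu_s__canonical__measure_function_Measure oO (ltW s1))).
  apply: (@integral_ge0 _ _ _ (Defs_mu_s__canonical__measure_function_Measure oO (ltW s1))) => y _.
  apply: (@integral_ge0 _ _ _ (Defs_mu_s__canonical__measure_function_Measure oO (ltW s1))) => x _.
  by rewrite lee_fin divr_ge0 ?powR_ge0.
Qed.

Lemma Tr_continuous s : 0 < s -> s < 1 ->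
  continuous_operator (V_space Omega s) (L1_space Omega s) (Tr Omega).
Proof.
move=> s0 s1; have [C C0 H] := Tr_constant dd s0.
apply: (bounded_continuous C0) => [|u v [mu _] [mv _] /= lt|u v _ _ _|u].
- by apply: H; rewrite lexx.
- split; first exact: measurable_funB.
  by apply: le_lt_trans lt; rewrite leeDr// integral_ge0.
- congr (fnorm _ _); apply/funext => x /=.
  by rewrite /Tr !patchE; case: ifP => // _; rewrite subr0.
- rewrite /= adde_ge0 ?integral_ge0//.
  rewrite V_seminormE mule_ge0 ?energy_ge0//.
  by rewrite lee_fin subr_ge0 ltW.
Qed.

End extension_operator.

Theorem theorem1p3 (R : realType) (n : nat) (Omega : set 'rV[R]_n.+1)
    (lipOmega : lipschitz_domain Omega) (bndOmega : bounded_set Omega) :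
  [/\ (forall s : R, 0 < s < 1 ->
        linear_operator (V_space Omega s) (L1_space Omega s) (Tr Omega) /\
        continuous_operator (V_space Omega s) (L1_space Omega s) (Tr Omega)),
      (forall s_lo : R, 0 < s_lo < 1 -> exists C : R,
        forall s, s_lo <= s < 1 ->
        continuity_constant (V_space Omega s) (L1_space Omega s) (Tr Omega) C) &
      exists Ext : R -> ('rV[R]_n.+1 -> R) -> 'rV[R]_n.+1 -> R,
        [/\ (forall s : R, 0 < s < 1 ->
              [/\ linear_operator (T_space Omega s) (V_space Omega s) (Ext s),
                  continuous_operator (T_space Omega s) (V_space Omega s) (Ext s) &
                  forall g, fcarrier (T_space Omega s) g ->
                    fequiv (T_space Omega s) (Tr Omega (Ext s g)) g]),
            ((2 <= n.+1)%N -> forall s_lo : R, 0 < s_lo < 1 -> exists C : R,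
              forall s, s_lo <= s < 1 ->
              continuity_constant (T_space Omega s) (V_space Omega s) (Ext s) C) &
            (n.+1 = 1%N -> forall s_lo s_hi : R, 0 < s_lo -> s_lo <= s_hi ->
              s_hi < 1 -> exists C : R, forall s, s_lo <= s <= s_hi ->
              continuity_constant (T_space Omega s) (V_space Omega s) (Ext s) C)]].
Proof.
have [dd] := lipschitz_domain_data lipOmega bndOmega.
split.
- by move=> s /andP[s0 s1]; split; [exact: (Tr_linear dd)|exact: (Tr_continuous dd)].
- by move=> s_lo /andP[s0 _]; have [C _ H] := Tr_constant dd s0; exists C.
exists (@trace_extension R n Omega); split.
- move=> s /andP[s0 s1]; split.
  + exact: (trace_extension_linear dd).
  + exact: (trace_extension_continuous dd).
  + move=> g _; exists set0; split => // x /=; apply => Ox.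
    by rewrite Tr_out// trace_extension_out.
- move=> n2 s_lo /andP[s0 _].
  (* From dimension two on, d - s >= 1 for all s < 1, so [sigma] = 1 serves. *)
  have [C _ H] := trace_extension_bound dd s0 (ltr01 : 0 < 1 :> R).
  exists C => s /andP[sls s1]; apply: H => //.
  have : (2 : R) <= n.+1%:R by rewrite ler_nat.
  by move: n.+1%:R => N; lra.
- move=> _ s_lo s_hi s0 slh sh1.
  (* In dimension one d - s = 1 - s, for which 1 - s_hi is the available lower bound. *)
  have sg0 : 0 < 1 - s_hi by rewrite subr_gt0.
  have [C _ H] := trace_extension_bound dd s0 sg0.
  exists C => s /andP[sls ssh]; apply: H => //; first exact: le_lt_trans sh1.
  have : (1 : R) <= n.+1%:R by rewrite ler1n.
  by move: n.+1%:R => N; lra.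
Qed.
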